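(* Let $(\mathcal K,\tau)$ be a Hausdorff geometric structure. Let $\mathcal M=(M,\dots)$ be a non-locally modular strongly minimal definable $\mathcal K$-relic such that: every $\emptyset$-definable set in $\mathcal M$ is $\emptyset$-definable in $\mathcal K$; the language of $\mathcal M$ is countable; $\operatorname{acl}_{\mathcal M}(\emptyset)$ is infinite; and there is a $\emptyset$-definable excellent family of plane curves in $\mathcal M$. If $\mathcal M$ weakly detects closures, then $\mathcal M$ detects multiple intersections.
   Context: **Geometric structures.** Definable means definable with parameters, without imaginary sorts; interpretable means definable in $\mathcal K^{eq}$. A complete theory is geometric if in its models $\operatorname{acl}$ satisfies exchange and the theory eliminates $\exists^\infty$; a structure is geometric if its theory is. All parameter sets $A,B,\dots$ are countable. In an $\aleph_1$-saturated geometric structure $\mathcal K$: $\dim(a/A)$ is the length of a maximal subtuple of the finite tuple $a$ that is $\operatorname{acl}$-independent over $A$; for $A$-definable $X$, $\dim X=\max\{\dim(x/A):x\in X\}$; $a,b$ are independent over $A$ if $\dim(ab/A)=\dim(a/A)+\dim(b/A)$; $a\in X$ is generic in $X$ over $A$ if $\dim(a/A)=\dim X$. Dimension extends to tuples and sets of $\mathcal K^{eq}$ (following Gagelman) preserving additivity. **Hausdorff geometric structures.** Let $\mathcal K=(K,\dots)$ be a structure in a language $\mathcal L$ and $\tau$ a topology on $K$; each $K^n$ has the product topology and definable sets the subspace topology. $(\mathcal K,\tau)$ is a Hausdorff geometric structure if: (1) $\tau$ is Hausdorff; (2) $\mathcal K$ is geometric and $\aleph_1$-saturated ($\mathcal L$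 may be uncountable); (3) if $X\subset K^n$ is definable over $A$ and $a\in\overline{\operatorname{Fr}(X)}$, where $\operatorname{Fr}(X)=\overline X\setminus X$, then $\dim(a/A)<\dim X$; (4) if $X\subset K^n$ is definable over countable $A$, $a\in X$ is generic over $A$, and $B\supset A$ is countable, then every neighborhood of $a$ contains a generic of $X$ over $B$; (5) if $X,Y$ and $Z\subset X\times Y$ are $A$-definable of the same dimension, $Z\to X$ and $Z\to Y$ are finite-to-one, and $(x,y)\in Z$ is generic over $A$, then there are open neighborhoods $U$ of $x$ in $X$ and $V$ of $y$ in $Y$ such that $Z\cap(U\times V)$ is the graph of a homeomorphism $U\to V$. **Relics and families.** A $\mathcal K$-relic is a structure $\mathcal M=(M,\dots)$ such that $M$ and all $\mathcal M$-definable subsets of powers of $M$ are interpretable in $\mathcal K$; it is definable if $M\subset K^n$ for some $n$. A structure is strongly minimal if in all elementary extensions every definable set in one variable is finite or cofinite; $\operatorname{rk}$ is Morley rank in $\mathcal M$. A plane curve is an $\mathcal M$-definable subset of $M^2$ of rank 1; it is non-trivial if both its projections to $M$ are finite-to-one. A definable family $\{X_t:t\in T\}$ is almost faithful if all $X_t$ have the same rank $d$ and for each $t$ only finitely many $t'$ satisfy $\operatorname{rk}(X_t\cap X_{t'})=d$. A strongly minimal structure is not locally modular if it admits a definable almost faithful family of plane curves with $\operatorname{rk}(T)=2$. An almost faithful family $\{C_t:t\in T\}$ of plane curves is excellent if $T$ is a generic (rank 2) subset of $M^2$, each $C_t$ is non-trivial, and for each $p\in M^2$ the set $\{t\in T:p\in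 C_t\}$ is empty or a non-trivial plane curve. In the following ''generic'' and ''independent'' are in the sense of $\mathcal K$; parameter sets are countable sets of tuples from $\mathcal M^{eq}$; $\mathcal M(A)$- and $\mathcal K(A)$-definable mean definable over $A$ in $\mathcal M$, resp. $\mathcal K$; $a,b$ are $\mathcal M$-independent over $A$ if $\operatorname{rk}(ab/A)=\operatorname{rk}(a/A)+\operatorname{rk}(b/A)$, and $\mathcal M$-dependent otherwise. A standard family of plane curves over $A$ is an almost faithful $\mathcal M(A)$-definable family of plane curves $\{C_t:t\in T\}$ such that $\operatorname{rk}(T)\ge1$, $T$ is a generic subset of $M^{\operatorname{rk}(T)}$ (i.e. of full rank), and for each $x\in M^2$ the set $\{t\in T:x\in C_t\}$ has rank at most $\operatorname{rk}(T)-1$. **Weak detection of closures.** A tuple $x=(x_1,\dots,x_n)\in M^n$ is coordinate-wise generic if each $x_i$ is generic in $M$ over $\emptyset$. For $\mathcal M(A)$-definable $X\subset M^n$, the projections $\pi_i,\pi_j:M^n\to M$ are independent on $X$ if for all $x\in X$ generic over $A$, $x_i$ and $x_j$ are independent over $A$. $\mathcal M$ weakly detects closures if: whenever $X\subset M^n$ is $\mathcal M(A)$-definable of rank $r\ge0$ and $x=(x_1,\dots,x_n)\in\overline X$ is coordinate-wise generic, then $\operatorname{rk}(x/A)\le r$, and moreover either $\operatorname{rk}(x/A)<r$, or for all $i\ne j$ such that $\pi_i,\pi_j$ are independent on $X$, the elements $x_i,x_j$ are $\mathcal M$-independent over $A$. **Detection of multiple intersections.** Let $\mathcal Y=\{Y_t:t\in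 T\}$, $\mathcal Z=\{Z_u:u\in U\}$ be $\mathcal K(A)$-definable families of subsets of a $\mathcal K(A)$-definable set $X$, with graphs $Y=\{(x,t):x\in Y_t\}$, $Z=\{(x,u):x\in Z_u\}$. A weakly generic $(\mathcal Y,\mathcal Z)$-intersection over $A$ is a tuple $(x,t,u)$ such that $x\in X$, $t\in T$, $u\in U$, $(x,t)\in Y$, $(x,u)\in Z$ are all generic over $A$. For a function $f:X\to Y$ with $X\subset K^m$, $Y\subset K^n$, $x_0\in X$ is a topological ramification point of $f$ if $(x_0,x_0)$ is in the closure of $\{(x,x')\in X^2:x\ne x', f(x)=f(x')\}$. A weakly generic intersection $(x,t,u)$ over $A$ is a generic multiple $(\mathcal Y,\mathcal Z)$-intersection over $A$ if it is a topological ramification point of the projection $I\to T\times U$, where $I=\{(x',t',u'):(x',t')\in Y,(x',u')\in Z\}$. $\mathcal M$ detects multiple intersections if, whenever $\mathcal C=\{C_t:t\in T\}$ and $\mathcal D=\{D_u:u\in U\}$ are standard families of plane curves over $A$ and $(x,t,u)$ is a generic multiple $(\mathcal C,\mathcal D)$-intersection over $A$ (with ambient set $X=M^2$), $t$ and $u$ are $\mathcal M$-dependent over $A$. *)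

(* Defs.v *)
(* The Cartesian power T^n is represented by the functions I -> T on a finite
   index type I, and T^(n+k) by the functions I + J -> T. *)
From mathcomp Require Import all_boot.
From mathcomp Require Import boolp classical_sets functions cardinality.
From mathcomp Require Import topology.

Set Implicit Arguments.
Unset Strict Implicit.
Unset Printing Implicit Defensive.

(* So that functions I -> K carry the product topology. *)
Export ArrowAsProduct.

Local Open Scope classical_set_scope.

Definition tcat (T I J : Type) (x : I -> T) (y : J -> T) : I + J -> T :=
  fun v => match v with inl i => x i | inr j => y j end.

Definition flat (K : Type) (m : nat) (D : set ('I_m -> K)) (I : Type)
    (x : I -> D) : I * 'I_m -> K :=
  fun p => val (x p.1) p.2.

Record language := Language {
  fsym : Type; far : fsym -> nat;
  rsym : Type; rar : rsym -> nat }.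

Definition countable_language (L : language) : Prop :=
  countable [set: fsym L] /\ countable [set: rsym L].

Record structure (L : language) (T : Type) := Structure {
  fint : forall f : fsym L, ('I_(far f) -> T) -> T;
  rint : forall r : rsym L, set ('I_(rar r) -> T) }.

(* [term L V] and [formula L V]: the free variables are the elements of V.
   The quantifier binds the variable [None]. *)
Inductive term (L : language) (V : Type) : Type :=
| Var of V
| App (f : fsym L) of ('I_(far f) -> term L V).

Inductive formula (L : language) (V : Type) : Type :=
| Bot
| Eq of term L V & term L V
| Rel (r : rsym L) of ('I_(rar r) -> term L V)
| Imp of formula L V & formula L V
| All of formula L (option V).

Fixpoint teval (L : language) (T : Type) (S : structure L T) (V : Type)
    (v : V -> T) (t : term L V) : T :=
  match t with
  | Var x => v x
  | App f u => fint S (fun i => teval S v (u i))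
  end.

Fixpoint holds (L : language) (T : Type) (S : structure L T) (V : Type)
    (phi : formula L V) (v : V -> T) {struct phi} : Prop :=
  match phi with
  | Bot => False
  | Eq s t => teval S v s = teval S v t
  | Rel r u => rint S (fun i => teval S v (u i))
  | Imp p q => holds S p v -> holds S q v
  | All p => forall a : T, holds S p (fun x => if x is Some y then v y else a)
  end.

Definition elem_equiv (L : language) (T T' : Type)
    (S : structure L T) (S' : structure L T') : Prop :=
  forall (phi : formula L void) (v : void -> T) (v' : void -> T'),
    holds S phi v <-> holds S' phi v'.

Definition elem_embedding (L : language) (T T' : Type)
    (S : structure L T) (S' : structure L T') (h : T -> T') : Prop :=
  forall (V : Type) (phi : formula L V) (v : V -> T),
    holds S phi v <-> holds S' phi (h \o v).

(* Formulas in the variables I + T are the L(T)-formulas in the variables I: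
   each parameter is a variable naming itself. *)
Definition definable (L : language) (T : Type) (S : structure L T) (I : finType)
    (X : set (I -> T)) : Prop :=
  exists phi : formula L (I + T),
    forall x, X x <-> holds S phi (tcat x (fun a => a)).

(* An element of S^eq is an equivalence class of a 0-definable equivalence
   relation on some power of T, and is represented by this class. *)
Record eqelt (T : Type) := Eqelt { eq_ar : nat; eq_class : set ('I_eq_ar -> T) }.
Arguments eq_class {T} e.

Definition is_imaginary (L : language) (T : Type) (S : structure L T)
    (e : eqelt T) : Prop :=
  exists E : formula L ('I_(eq_ar e) + 'I_(eq_ar e)),
    [/\ forall a, holds S E (tcat a a),
        forall a b, holds S E (tcat a b) -> holds S E (tcat b a),
        forall a b c, holds S E (tcat a b) -> holds S E (tcat b c) ->
          holds S E (tcat a c)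
      & exists a, eq_class e = [set b | holds S E (tcat a b)]].

Definition params (L : language) (T : Type) (S : structure L T)
    (A : set (eqelt T)) : Prop :=
  countable A /\ forall e, A e -> is_imaginary S e.

(* Real elements are the classes of equality on T. *)
Definition reals (T : Type) (A : set T) : set (eqelt T) :=
  [set @Eqelt T 1 [set x | x ord0 = a] | a in A].

(* X is definable over A in S^eq: some L-formula, evaluated at representatives
   of (finitely many) elements of A, defines X whatever the representatives. *)
Definition definable_over (L : language) (T : Type) (S : structure L T)
    (A : set (eqelt T)) (I : finType) (X : set (I -> T)) : Prop :=
  exists phi : formula L (I + {e : A & 'I_(eq_ar (val e))}),
    forall r : (forall e : A, 'I_(eq_ar (val e)) -> T),
      (forall e : A, eq_class (val e) (r e)) ->
      forall x, X x <-> holds S phi (tcat x (fun p => r (tag p) (tagged p))).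

Definition acl (L : language) (T : Type) (S : structure L T)
    (A : set (eqelt T)) : set T :=
  [set b | exists X : set (unit -> T),
     [/\ definable_over S A X, finite_set X & X (fun=> b)]].

Definition acl_exchange (L : language) (T : Type) (S : structure L T) : Prop :=
  forall (A : set T) (b c : T),
    acl S (reals (A `|` [set b])) c -> ~ acl S (reals A) c ->
    acl S (reals (A `|` [set c])) b.

Definition geometric (L : language) (T : Type) (S : structure L T) : Prop :=
  (forall (T' : Type) (S' : structure L T'), elem_equiv S S' ->
     acl_exchange S') /\
  (forall (n : nat) (phi : formula L (unit + 'I_n)),
     exists psi : formula L 'I_n,
       forall (T' : Type) (S' : structure L T'), elem_equiv S S' ->
       forall y : 'I_n -> T',
         holds S' psi y <->
         infinite_set [set a : T' | holds S' phi (tcat (fun=> a) y)]).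

Definition aleph1_saturated (L : language) (T : Type) (S : structure L T) : Prop :=
  forall (A : set T), countable A ->
  forall Phi : set (formula L (unit + A)),
    (forall F : set (formula L (unit + A)), finite_set F -> F `<=` Phi ->
       exists a : T, forall phi, F phi -> holds S phi (tcat (fun=> a) val)) ->
    exists a : T, forall phi, Phi phi -> holds S phi (tcat (fun=> a) val).

Definition acl_independent (L : language) (T : Type) (S : structure L T)
    (A : set (eqelt T)) (I : finType) (a : I -> T) (J : {set I}) : Prop :=
  forall j, j \in J ->
    ~ acl S (A `|` reals [set a i | i in [set i | i \in J :\ j]]) (a j).

(* dim(a/A). The elements of a are real; A may contain imaginaries. Over
   imaginary parameters acl still satisfies exchange on the real elements of a
   geometric structure, and the value below is the additive extension of the
   dimension. *)
Definition dim (L : language) (T : Type) (S : structure L T)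
    (A : set (eqelt T)) (I : finType) (a : I -> T) : nat :=
  \max_(J : {set I} | `[< acl_independent S A a J >]) #|J|.

(* Only meant for X definable over A; the value is 0 if X is empty. *)
Definition dim_set (L : language) (T : Type) (S : structure L T)
    (A : set (eqelt T)) (I : finType) (X : set (I -> T)) : nat :=
  \max_(d < #|I|.+1 | `[< exists2 x, X x & dim S A x = d >]) d.

Definition generic (L : language) (T : Type) (S : structure L T)
    (A : set (eqelt T)) (I : finType) (X : set (I -> T)) (a : I -> T) : Prop :=
  X a /\ dim S A a = dim_set S A X.

Definition independent (L : language) (T : Type) (S : structure L T)
    (A : set (eqelt T)) (I J : finType) (a : I -> T) (b : J -> T) : Prop :=
  dim S A (tcat a b) = dim S A a + dim S A b.

Definition frontier (T : topologicalType) (X : set T) : set T :=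
  closure X `\` X.

Record hausdorff_geometric (L : language) (K : topologicalType)
    (S : structure L K) : Prop := HausdorffGeometric {
  hg_hausdorff : hausdorff_space K;
  hg_geometric : geometric S;
  hg_saturated : aleph1_saturated S;
  hg_frontier : forall (A : set K) (I : finType) (X : set (I -> K)) (a : I -> K),
    countable A -> definable_over S (reals A) X -> closure (frontier X) a ->
    dim S (reals A) a < dim_set S (reals A) X;
  hg_generic : forall (A B : set K) (I : finType) (X : set (I -> K)) (a : I -> K),
    countable A -> countable B -> A `<=` B ->
    definable_over S (reals A) X -> generic S (reals A) X a ->
    forall U, nbhs a U -> exists2 b, U b & generic S (reals B) X b;
  hg_homeo : forall (A : set K) (I J : finType) (X : set (I -> K))
      (Y : set (J -> K)) (Z : set (I + J -> K)) (x : I -> K) (y : J -> K),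
    countable A ->
    definable_over S (reals A) X -> definable_over S (reals A) Y ->
    definable_over S (reals A) Z ->
    (forall x' y', Z (tcat x' y') -> X x' /\ Y y') ->
    dim_set S (reals A) X = dim_set S (reals A) Z ->
    dim_set S (reals A) Y = dim_set S (reals A) Z ->
    (forall x', X x' -> finite_set [set y' | Z (tcat x' y')]) ->
    (forall y', Y y' -> finite_set [set x' | Z (tcat x' y')]) ->
    generic S (reals A) Z (tcat x y) ->
    exists (U : set (I -> K)) (V : set (J -> K)),
      [/\ open U, open V, U x, V y &
      exists (f : (I -> K) -> (J -> K)) (g : (J -> K) -> (I -> K)),
      [/\ (forall x', (U `&` X) x' -> (V `&` Y) (f x') /\ g (f x') = x'),
          (forall y', (V `&` Y) y' -> (U `&` X) (g y') /\ f (g y') = y'),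
          {within U `&` X, continuous f},
          {within V `&` Y, continuous g} &
          forall x' y', (U `&` X) x' -> (V `&` Y) y' ->
            (Z (tcat x' y') <-> y' = f x')]] }.

Definition strongly_minimal (L : language) (T : Type) (S : structure L T) : Prop :=
  forall (T' : Type) (S' : structure L T') (h : T -> T'), elem_embedding S S' h ->
  forall X : set (unit -> T'), definable S' X -> finite_set X \/ finite_set (~` X).

(* [morley_ge n S X]: the Morley rank of the definable set X is at least n.
   Allowing an elementary extension at each step amounts to computing the rank
   in a monster model. Only finite ranks are needed: in a strongly minimal
   structure the rank of a subset of T^I is at most #|I|. *)
Fixpoint morley_ge (n : nat) (L : language) (T : Type) (S : structure L T)
    (I : finType) (X : set (I -> T)) {struct n} : Prop :=
  match n with
  | 0 => X !=set0
  | n'.+1 =>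
    exists (T' : Type) (S' : structure L T') (h : T -> T'),
      elem_embedding S S' h /\
    exists phi : formula L (I + T),
      (forall x, X x <-> holds S phi (tcat x (fun a => a))) /\
    exists Y : nat -> set (I -> T'),
      (forall i, [/\ definable S' (Y i),
                     Y i `<=` [set x | holds S' phi (tcat x h)]
                   & morley_ge n' S' (Y i)]) /\
      (forall i j, i <> j -> Y i `&` Y j = set0)
  end.

(* rk(X) = n; the rank of the empty set is not a natural number. *)
Definition morley (L : language) (T : Type) (S : structure L T) (I : finType)
    (X : set (I -> T)) (n : nat) : Prop :=
  morley_ge n S X /\ ~ morley_ge n.+1 S X.

(* rk(x/A): the least rank of a set definable over A and containing x. The
   default value is irrelevant in strongly minimal structures. *)
Definition rk (L : language) (T : Type) (S : structure L T)
    (A : set (eqelt T)) (I : finType) (x : I -> T) : nat :=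
  xget 0 [set n |
    (exists X : set (I -> T), [/\ definable_over S A X, X x & morley S X n]) /\
    (forall X : set (I -> T), definable_over S A X -> X x -> morley_ge n S X)].

Definition morley_independent (L : language) (T : Type) (S : structure L T)
    (A : set (eqelt T)) (I J : finType) (a : I -> T) (b : J -> T) : Prop :=
  rk S A (tcat a b) = rk S A a + rk S A b.

(* A family {C_t : t in P} is given by P and C; the values of C outside P are
   irrelevant. *)
Definition fam_graph (T : Type) (I J : Type) (P : set (J -> T))
    (C : (J -> T) -> set (I -> T)) : set (I + J -> T) :=
  [set z : I + J -> T | P (fun j => z (inr j)) /\ C (fun j => z (inr j)) (fun i => z (inl i))].

Definition definable_family (L : language) (T : Type) (S : structure L T)
    (I J : finType) (P : set (J -> T)) (C : (J -> T) -> set (I -> T)) : Prop :=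
  definable S P /\ definable S (fam_graph P C).

Definition family_over (L : language) (T : Type) (S : structure L T)
    (A : set (eqelt T)) (I J : finType) (P : set (J -> T))
    (C : (J -> T) -> set (I -> T)) : Prop :=
  definable_over S A P /\ definable_over S A (fam_graph P C).

Definition almost_faithful (L : language) (T : Type) (S : structure L T)
    (I J : finType) (P : set (J -> T)) (C : (J -> T) -> set (I -> T)) : Prop :=
  exists d : nat,
    (forall t, P t -> morley S (C t) d) /\
    (forall t, P t ->
       finite_set [set t' | P t' /\ morley S (C t `&` C t') d]).

Definition plane_curve (L : language) (T : Type) (S : structure L T)
    (X : set ('I_2 -> T)) : Prop :=
  definable S X /\ morley S X 1.

Definition nontrivial (T : Type) (X : set ('I_2 -> T)) : Prop :=
  forall (i : 'I_2) (a : T), finite_set [set x | X x /\ x i = a].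

Definition not_locally_modular (L : language) (T : Type) (S : structure L T) : Prop :=
  exists (n : nat) (P : set ('I_n -> T)) (C : ('I_n -> T) -> set ('I_2 -> T)),
    [/\ definable_family S P C, almost_faithful S P C,
        forall t, P t -> plane_curve S (C t) & morley S P 2].

Definition excellent_family (L : language) (T : Type) (S : structure L T)
    (P : set ('I_2 -> T)) (C : ('I_2 -> T) -> set ('I_2 -> T)) : Prop :=
  [/\ almost_faithful S P C,
      morley S P 2,
      forall t, P t -> plane_curve S (C t) /\ nontrivial (C t) &
      forall p, let Cp := [set t | P t /\ C t p] in
        Cp = set0 \/ plane_curve S Cp /\ nontrivial Cp].

Definition standard_family (L : language) (T : Type) (S : structure L T)
    (A : set (eqelt T)) (r : nat) (P : set ('I_r -> T))
    (C : ('I_r -> T) -> set ('I_2 -> T)) : Prop :=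
  [/\ 1 <= r,
      family_over S A P C /\ almost_faithful S P C,
      forall t, P t -> plane_curve S (C t),
      morley S P r &
      forall x, ~ morley_ge r S [set t | P t /\ C t x]].

(* A class of tuples of D becomes a class of tuples of K. It is an imaginary of
   K when the 0-definable sets of the relic are 0-definable in K. *)
Definition flat_eqelt (K : Type) (m : nat) (D : set ('I_m -> K))
    (e : eqelt D) : eqelt K :=
  @Eqelt K #|{: 'I_(eq_ar e) * 'I_m}|
    [set fun k => flat b (enum_val k) | b in eq_class e].

Definition flat_params (K : Type) (m : nat) (D : set ('I_m -> K))
    (A : set (eqelt D)) : set (eqelt K) :=
  @flat_eqelt K m D @` A.

Definition flat_set (K : Type) (m : nat) (D : set ('I_m -> K)) (I : Type)
    (X : set (I -> D)) : set (I * 'I_m -> K) :=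
  @flat K m D I @` X.

Definition flat_family (K : Type) (m : nat) (D : set ('I_m -> K)) (I J : Type)
    (C : (J -> D) -> set (I -> D)) : (J * 'I_m -> K) -> set (I * 'I_m -> K) :=
  fun s => [set y | exists t x, [/\ s = flat t, C t x & y = flat x]].

Definition definable_relic (LK : language) (K : Type) (SK : structure LK K)
    (LM : language) (m : nat) (D : set ('I_m -> K)) (SM : structure LM D) : Prop :=
  definable SK D /\
  forall (I : finType) (X : set (I -> D)),
    definable SM X -> definable SK (flat_set X).

Definition preserves_0definable (LK : language) (K : Type) (SK : structure LK K)
    (LM : language) (m : nat) (D : set ('I_m -> K)) (SM : structure LM D) : Prop :=
  forall (I : finType) (X : set (I -> D)),
    definable_over SM set0 X -> definable_over SK set0 (flat_set X).

Definition coordinatewise_generic (LK : language) (K : Type) (SK : structure LK K)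
    (m : nat) (D : set ('I_m -> K)) (n : nat) (x : 'I_n -> D) : Prop :=
  forall i, generic SK set0 D (val (x i)).

Definition independent_projections (LK : language) (K : Type)
    (SK : structure LK K) (m : nat) (D : set ('I_m -> K)) (A : set (eqelt D))
    (n : nat) (X : set ('I_n -> D)) (i j : 'I_n) : Prop :=
  forall x, X x -> generic SK (flat_params A) (flat_set X) (flat x) ->
    independent SK (flat_params A) (val (x i)) (val (x j)).

Definition weakly_detects_closures (LK : language) (K : topologicalType)
    (SK : structure LK K) (LM : language) (m : nat) (D : set ('I_m -> K))
    (SM : structure LM D) : Prop :=
  forall (A : set (eqelt D)) (n : nat) (X : set ('I_n -> D)) (r : nat)
      (x : 'I_n -> D),
    params SM A -> definable_over SM A X -> morley SM X r ->
    closure (flat_set X) (flat x) -> coordinatewise_generic SK x ->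
    rk SM A x <= r /\
    (rk SM A x < r \/
     forall i j : 'I_n, i <> j -> independent_projections SK A X i j ->
       morley_independent SM A (fun _ : unit => x i) (fun _ : unit => x j)).

Definition ramification_point (S : topologicalType) (S' : Type) (X : set S)
    (f : S -> S') (x0 : S) : Prop :=
  X x0 /\
  closure [set p : S * S | [/\ X p.1, X p.2, p.1 <> p.2 & f p.1 = f p.2]] (x0, x0).

Definition weakly_generic_intersection (L : language) (K : Type)
    (S : structure L K) (A : set (eqelt K)) (I J1 J2 : finType)
    (X : set (I -> K)) (P : set (J1 -> K)) (Y : (J1 -> K) -> set (I -> K))
    (Q : set (J2 -> K)) (Z : (J2 -> K) -> set (I -> K))
    (x : I -> K) (t : J1 -> K) (u : J2 -> K) : Prop :=
  [/\ generic S A X x, generic S A P t, generic S A Q u,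
      generic S A (fam_graph P Y) (tcat x t) &
      generic S A (fam_graph Q Z) (tcat x u)].

Definition generic_multiple_intersection (L : language) (K : topologicalType)
    (S : structure L K) (A : set (eqelt K)) (I J1 J2 : finType)
    (X : set (I -> K)) (P : set (J1 -> K)) (Y : (J1 -> K) -> set (I -> K))
    (Q : set (J2 -> K)) (Z : (J2 -> K) -> set (I -> K))
    (x : I -> K) (t : J1 -> K) (u : J2 -> K) : Prop :=
  weakly_generic_intersection S A X P Y Q Z x t u /\
  @ramification_point ((I -> K) * (J1 -> K) * (J2 -> K))%type
    ((J1 -> K) * (J2 -> K))%type
    [set p | fam_graph P Y (tcat p.1.1 p.1.2) /\ fam_graph Q Z (tcat p.1.1 p.2)]
    (fun p => (p.1.2, p.2)) (x, t, u).

Definition detects_multiple_intersections (LK : language) (K : topologicalType)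
    (SK : structure LK K) (LM : language) (m : nat) (D : set ('I_m -> K))
    (SM : structure LM D) : Prop :=
  forall (A : set (eqelt D)) (r s : nat)
      (P : set ('I_r -> D)) (C : ('I_r -> D) -> set ('I_2 -> D))
      (Q : set ('I_s -> D)) (E : ('I_s -> D) -> set ('I_2 -> D))
      (x : 'I_2 -> D) (t : 'I_r -> D) (u : 'I_s -> D),
    params SM A -> standard_family SM A P C -> standard_family SM A Q E ->
    generic_multiple_intersection SK (flat_params A)
      (flat_set [set: 'I_2 -> D])
      (flat_set P) (flat_family C) (flat_set Q) (flat_family E)
      (flat x) (flat t) (flat u) ->
    ~ morley_independent SM A t u.

(* Main.v *)
(* Suppose t and u are M-independent over A, and let x be a multiple intersection point of
   C_t and E_u. The set of (x, x', t, u) with x <> x' in C_t and E_u has (x, x, t, u) in its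
   closure, but its two copies of the i-th coordinate need not be independent. So take a
   generic v in the excellent family F and y with (x_i, y) in F_v, and consider instead the
   tuples (t, u, v, y, y') for which there are x, x' in C_t and E_u with (x_i, y) and
   (x'_i, y') in F_v, excluding those where the intersection of C_t and E_u is infinite or
   where (x_i, y) and (x'_i, y') lie on infinitely many common curves. On this set v is
   algebraic over x, x', y, y', so y and y' are independent, and its rank is at most
   r + s + 2. F_v is locally the graph of a homeomorphism, so (t, u, v, y, y) is in the
   closure: the first exclusion is harmless by weak detection of closures, the second because
   by the frontier axiom a set of dimension 2 dim(M) does not accumulate at a pair (p, p) with
   p generic in M^2. The rank of (t, u, v, y, y) is r + s + 2, so weak detection of closures
   makes y independent of itself, which is absurd. *)
Require Import Defs.
From mathcomp Require Import all_boot.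
From mathcomp Require Import boolp classical_sets functions cardinality.
From mathcomp Require Import topology.

Set Implicit Arguments.
Unset Strict Implicit.
Unset Printing Implicit Defensive.

Local Open Scope classical_set_scope.

(** * Formulas and definable sets *)

(** Two notions of size have to be matched: genericity and the frontier axiom speak of dimension in
    K, weak detection of closures of Morley rank in M, which is defined through elementary
    extensions. The link is largeness, a first-order counting condition: a set of rank n has
    dimension n * [dim_relic]. So the estimates are made with the additive dimension of K, and only
    their results become ranks. The exception is the pair (t, u): it is assumed independent in M and
    need not be so in K, so its rank has to be carried along as a rank. The role of v is to force y
    and y' apart. Over t and u the points x, x' are algebraic, so a v of rank 2 that is algebraic
    over x, x', y, y' can only draw its rank from y and y', which must then be independent. The
    first exclusion makes x, x' algebraic over t, u; the second makes v algebraic over the four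
    points. Parameters are imaginary, whereas generic points are built over countable sets of real
    elements; a countable set B of representatives mediates between the two. *)

Definition ocons (T V : Type) (a : T) (v : V -> T) : option V -> T :=
  fun x => if x is Some y then v y else a.

Section Syntax.
Variable L : language.

Fixpoint term_rename (V W : Type) (f : V -> W) (t : term L V) : term L W :=
  match t with
  | Var x => Var L (f x)
  | App g u => App (fun i => term_rename f (u i))
  end.

Fixpoint formula_rename (V : Type) (p : formula L V) : forall W, (V -> W) -> formula L W :=
  match p with
  | Bot => fun W f => Bot L W
  | Eq s t => fun W f => Eq (term_rename f s) (term_rename f t)
  | Rel r u => fun W f => Rel (fun i => term_rename f (u i))
  | Imp p q => fun W f => Imp (formula_rename p f) (formula_rename q f)
  | All p => fun W f => All (formula_rename p (omap f))
  end.

Lemma teval_rename (T : Type) (S : structure L T) (V W : Type) (f : V -> W)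
    (t : term L V) (v : W -> T) :
  teval S v (term_rename f t) = teval S (v \o f) t.
Proof. by elim: t => [x|g u IH] //=; congr fint; apply/funext => i; exact: IH. Qed.

Lemma ocons_omap (T V W : Type) (f : V -> W) (a : T) (v : W -> T) :
  ocons a v \o omap f = ocons a (v \o f).
Proof. by apply/funext => -[]. Qed.

Lemma holds_rename (T : Type) (S : structure L T) (V : Type) (p : formula L V) :
  forall (W : Type) (f : V -> W) (v : W -> T),
  holds S (formula_rename p f) v <-> holds S p (v \o f).
Proof.
elim: p => {V} [V|V s t|V r u|V p IHp q IHq|V p IH] W f v //=.
- by rewrite !teval_rename.
- suff -> : (fun i => teval S v (term_rename f (u i))) =
    (fun i => teval S (v \o f) (u i)) by [].
  by apply/funext => i; rewrite teval_rename.
- by split=> h /IHp /h /IHq.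
- by split=> h a; have := h a; rewrite -/(ocons a v) -/(ocons a (v \o f)) -ocons_omap;
    move=> ?; apply/IH.
Qed.

Lemma term_support (V : Type) (t : term L V) :
  exists (J : finType) (g : J -> V) (s : term L J), t = term_rename g s.
Proof.
elim: t => [x|f u IH].
  by exists unit, (fun=> x), (Var L tt).
have /choice[z zP] : forall i, exists z : {J : finType & (J -> V) * term L J}%type,
    u i = term_rename (tagged z).1 (tagged z).2.
  by move=> i; have [J [g [s us]]] := IH i; exists (existT _ J (g, s)).
pose n i := tag (z i); pose g i := (tagged (z i)).1; pose s i := (tagged (z i)).2.
exists {i : 'I_(far f) & n i}, (fun p => g (tag p) (tagged p)).
exists (App (fun i => term_rename (fun k => Tagged n k) (s i))).
rewrite /=; congr App; apply/funext => i; rewrite zP -/(g i) -/(s i).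
elim: (s i) => [x|h w IHw] //=.
by congr App; apply/funext => k.
Qed.

(** The support of the body of a quantifier maps to [option V]. The indices sent to [None] stand for
    the bound variable and have to be removed; at the others the dependent match extracts the free
    variable. *)
Definition osome (J : finType) (V : Type) (g : J -> option V) (k : {k | g k}) : V :=
  match g (val k) as o return isSome o -> V with
  | Some v => fun=> v
  | None => fun h => match notF h with end
  end (valP k).

Lemma osomeE (J : finType) (V : Type) (g : J -> option V) (k : J) :
  omap (@osome J V g) (insub k) = g k.
Proof.
case: insubP => [k' gk kk'|] /=; last by case: (g k).
rewrite -kk' /osome; move: (valP k').
by case: (g (val k')).
Qed.

(** The type of variables is arbitrary, as it also holds the parameters. That only finitely many
    variables occur rests on the arities being finite; it allows formulas to be moved to finite
    powers of K and parameters to be quantified away. *)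
Lemma formula_support (V : Type) (p : formula L V) :
  exists (J : finType) (g : J -> V) (q : formula L J),
    forall T (S : structure L T) v, holds S p v <-> holds S q (v \o g).
Proof.
elim: p => {V} [V|V s t|V r u|V p [J [f [p' pE]]] q [J' [f' [q' qE]]]|V p [J [g [q pE]]]].
- by exists void, (fun x : void => match x with end), (Bot L void).
- have [J [f [s' ->]]] := term_support s; have [J' [f' [t' ->]]] := term_support t.
  exists (J + J')%type, (fun k => match k with inl i => f i | inr j => f' j end).
  exists (Eq (term_rename inl s') (term_rename inr t')) => T S v /=.
  by rewrite !teval_rename.
- have /choice[z zP] : forall i, exists z : {J : finType & (J -> V) * term L J}%type,
      u i = term_rename (tagged z).1 (tagged z).2.
    by move=> i; have [J [g [s us]]] := term_support (u i); exists (existT _ J (g, s)).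
  pose n i := tag (z i); pose g i := (tagged (z i)).1; pose s i := (tagged (z i)).2.
  exists {i : 'I_(rar r) & n i}, (fun p => g (tag p) (tagged p)).
  exists (Rel (fun i => term_rename (fun k => Tagged n k) (s i))) => T S v /=.
  suff -> : (fun i => teval S v (u i)) = fun i => teval S
    (v \o (fun p : {i : 'I_(rar r) & n i} => g (tag p) (tagged p)))
    (term_rename [eta Tagged n] (s i)) by [].
  by apply/funext => i; rewrite zP !teval_rename.
- exists (J + J')%type, (fun k => match k with inl i => f i | inr j => f' j end).
  exists (Imp (formula_rename p' inl) (formula_rename q' inr)) => T S v /=.
  by split=> h; [move=> /holds_rename /pE /h /qE hq; apply/holds_rename|
    move=> /pE hp; apply/qE; have := h; rewrite !holds_rename; apply].
- exists {k | g k}, (@osome J V g), (All (formula_rename q (fun k => insub k))) => T S v /=.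
  split=> h a; have := h a; rewrite -/(ocons a _) -/(ocons a v) ?holds_rename pE;
    rewrite ?holds_rename; congr (holds S q _); apply/funext => k /=;
    rewrite -(osomeE g k); by case: (insub k).
Qed.

Lemma formula_exists_ord n (V : Type) (p : formula L ('I_n + V)) : exists q : formula L V,
  forall T (S : structure L T) v, holds S q v <-> exists x, holds S p (tcat x v).
Proof.
elim: n V p => [|n IH] V p.
  pose f (k : 'I_0 + V) := match k with inl i => match notF (ltn_ord i) with end | inr v => v
    end.
  exists (formula_rename p f) => T S v; rewrite holds_rename.
  have E x : tcat x v = v \o f by apply/funext => -[[]|].
  split=> [h|[x]]; last by rewrite E.
  by exists (fun i : 'I_0 => match notF (ltn_ord i) with end); rewrite E.
pose f (k : 'I_n.+1 + V) : 'I_n + option V := match k with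
  | inl i => if unlift ord0 i is Some j then inl j else inr None | inr v => inr (Some v) end.
have [q qP] := IH _ (formula_rename p f).
exists (Imp (All (Imp q (Bot L _))) (Bot L _)) => T S v /=.
have E a y : tcat y (ocons a v) \o f =
    tcat (fun i => if unlift ord0 i is Some j then y j else a) v.
  by apply/funext => -[i|//] /=; case: (unlift ord0 i).
split=> [h|[x hx] h].
  apply: contrapT => k; apply: h => a /qP[y] /holds_rename; rewrite E => hp; apply: k.
  by eexists; exact: hp.
apply: (h (x ord0)); apply/qP; exists (fun j => x (lift ord0 j)).
apply/holds_rename; rewrite E; move: hx; congr (holds S p (tcat _ _)).
by apply/funext => i; case: unliftP => [j|] ->.
Qed.

Lemma formula_exists_fin (J : finType) (V : Type) (p : formula L (J + V)) : exists q : formula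
  L V,
  forall T (S : structure L T) v, holds S q v <-> exists x, holds S p (tcat x v).
Proof.
pose f (k : J + V) : 'I_#|J| + V :=
  match k with inl j => inl (enum_rank j) | inr v => inr v end.
have [q qP] := formula_exists_ord (formula_rename p f).
exists q => T S v; rewrite qP.
have E x : tcat x v \o f = tcat (x \o enum_rank) v by apply/funext => -[].
split=> -[x hx]; first by exists (x \o enum_rank); rewrite -E -holds_rename.
exists (x \o enum_val); apply/holds_rename; rewrite E; move: hx.
by congr (holds S p (tcat _ _)); apply/funext => i /=; rewrite enum_rankK.
Qed.

End Syntax.

Section Definability.
Variables (L : language) (T : Type) (S : structure L T).
Implicit Types (A : set (eqelt T)) (V W : Type).

Definition pvar A := {e : A & 'I_(eq_ar (val e))}.

Definition reps A (r : forall e : A, 'I_(eq_ar (val e)) -> T) : Prop :=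
  forall e : A, eq_class (val e) (r e).

Definition pval A (r : forall e : A, 'I_(eq_ar (val e)) -> T) : pvar A -> T :=
  fun p => r (tag p) (tagged p).

(* [definable_over], without the finiteness of the index type *)
Definition dfn A V (X : set (V -> T)) : Prop :=
  exists phi : formula L (V + pvar A), forall r, reps r ->
    forall x, X x <-> holds S phi (tcat x (pval r)).

Lemma dfnE A (I : finType) (X : set (I -> T)) : definable_over S A X = dfn A X.
Proof. by []. Qed.

Lemma dfn_ext A V (X Y : set (V -> T)) :
  (forall v, X v <-> Y v) -> dfn A X -> dfn A Y.
Proof. by move=> XY [p pX]; exists p => r hr x; rewrite -XY; exact: pX. Qed.

(** The substitution [t] is kept apart from [w \o f] so that the lemma applies to tuples written in
    any form; the equation is then left to extensionality. *)
Lemma dfn_ren A V W (f : V -> W) (X : set (V -> T)) (t : (W -> T) -> V -> T) :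
  dfn A X -> (forall w, t w = w \o f) -> dfn A (fun w : W -> T => X (t w)).
Proof.
move=> [p pX] tE; exists (formula_rename p (fun k => match k with inl v => inl (f v) | inr q
  => inr q end)).
move=> r hr x; rewrite holds_rename tE (pX r hr).
have -> // : tcat (x \o f) (pval r) = tcat x (pval r) \o
  (fun k => match k with inl v => inl (f v) | inr q => inr q end).
by apply/funext => -[].
Qed.

Lemma dfn_sub A A' V (X : set (V -> T)) : A `<=` A' -> dfn A X -> dfn A' X.
Proof.
move=> AA' [p pX].
have AA (e : A) : A' (val e) by apply: AA'; have := valP e; rewrite inE.
pose f (e : A) : A' := exist _ (val e) (mem_set (AA e)).
pose g (k : V + pvar A) : V + pvar A' := match k with inl v => inl v
  | inr q => inr (existT (fun e : A' => 'I_(eq_ar (val e))) (f (tag q)) (tagged q)) end.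
exists (formula_rename p g).
move=> r hr x; rewrite holds_rename.
rewrite (pX (fun e => r (f e))); last by move=> e; exact: hr (f e).
have -> // : tcat x (pval (fun e => r (f e))) = tcat x (pval r) \o g.
by apply/funext => -[].
Qed.

Lemma dfn_imp A V (X Y : set (V -> T)) :
  dfn A X -> dfn A Y -> dfn A (fun v => X v -> Y v).
Proof.
move=> [p pX] [q qY]; exists (Imp p q) => r hr x /=.
by rewrite -(pX r hr) -(qY r hr).
Qed.

Lemma dfn_false A V : dfn A (fun v : V -> T => False).
Proof. by exists (Bot _ _). Qed.

Lemma dfn_not A V (X : set (V -> T)) : dfn A X -> dfn A (fun v => ~ X v).
Proof. by move=> hX; exact: (dfn_imp hX (@dfn_false A V)). Qed.

Lemma dfn_and A V (X Y : set (V -> T)) :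
  dfn A X -> dfn A Y -> dfn A (fun v => X v /\ Y v).
Proof.
move=> hX hY; apply: dfn_ext (dfn_not (dfn_imp hX (dfn_not hY))) => v.
split; first by move=> /not_implyP[x /contrapT y].
by move=> [x y] h; exact: h x y.
Qed.

Lemma dfn_true A V : dfn A (fun v : V -> T => True).
Proof. by apply: dfn_ext (dfn_not (@dfn_false A V)) => v; split=> // _ []. Qed.

Lemma dfn_all A V (P : (V -> T) -> T -> Prop) :
  dfn A (fun w : option V -> T => P (w \o some) (w None)) ->
  dfn A (fun v => forall a, P v a).
Proof.
move=> [p pX].
exists (All (formula_rename p (fun k => match k with inl (Some v) => Some (inl v) | inl None
  => None
  | inr q => Some (inr q) end))) => r hr x /=.
split=> h a; have := h a; rewrite holds_rename;
  have -> : ((fun x0 => match x0 with Some y => tcat x (pval r) y | None => a end) \o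
    (fun k => match k with inl (Some v) => Some (inl v) | inl None => None
  | inr q => Some (inr q) end)) = tcat (ocons a x) (pval r) by apply/funext => -[[]|].
- by move=> ?; apply/pX.
- by move/(pX _ hr).
Qed.

Lemma dfn_ex A V (P : (V -> T) -> T -> Prop) :
  dfn A (fun w : option V -> T => P (w \o some) (w None)) ->
  dfn A (fun v => exists a, P v a).
Proof.
move=> h; have h1 : dfn A (fun v => forall a, ~ P v a).
  by apply: (dfn_all (P := fun v a => ~ P v a)); exact: dfn_not.
apply: dfn_ext (dfn_not h1) => v; split; last by move=> [a Pa] /(_ a).
by move/existsNP => [a /contrapT]; exists a.
Qed.

Lemma dfn_eq A V (i j : V) : dfn A (fun v : V -> T => v i = v j).
Proof. by exists (Eq (Var _ (inl i)) (Var _ (inl j))). Qed.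

Lemma dfn_all_in A V (J : eqType) (s : seq J) (P : J -> set (V -> T)) :
  (forall j, dfn A (P j)) -> dfn A (fun v => forall j, j \in s -> P j v).
Proof.
move=> h; elim: s => [|j s IH].
  by apply: dfn_ext (@dfn_true A V) => v; split.
apply: dfn_ext (dfn_and (h j) IH) => v; split.
  by move=> [Pj Ps] i; rewrite inE => /orP[/eqP->|/Ps].
move=> Ps; split; first by apply: Ps; rewrite mem_head.
by move=> i si; apply: Ps; rewrite inE si orbT.
Qed.

Lemma dfn_all_idx A V (J : finType) (P : J -> set (V -> T)) :
  (forall j, dfn A (P j)) -> dfn A (fun v => forall j, P j v).
Proof.
move=> h; apply: dfn_ext (dfn_all_in (enum J) h) => v; split=> k j //.
by apply: k; rewrite mem_enum.
Qed.

Lemma dfn_ex_idx A V (J : finType) (P : J -> set (V -> T)) :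
  (forall j, dfn A (P j)) -> dfn A (fun v => exists j, P j v).
Proof.
move=> h; have h1 := dfn_not (dfn_all_idx (fun j => dfn_not (h j))).
apply: dfn_ext h1 => v; split=> [/existsNP[j /contrapT]|[j Pj] /(_ j)//].
by exists j.
Qed.

Lemma dfn_exfin A V (J : finType) (P : (V -> T) -> (J -> T) -> Prop) :
  dfn A (fun w : V + J -> T => P (w \o inl) (w \o inr)) ->
  dfn A (fun v => exists b, P v b).
Proof.
move=> [p pP].
pose f (k : (V + J) + pvar A) : J + (V + pvar A) := match k with
  | inl (inl v) => inr (inl v) | inl (inr j) => inl j | inr q => inr (inr q) end.
have [q qP] := formula_exists_fin (formula_rename p f).
exists q => r hr v; rewrite qP.
have E b : tcat b (tcat v (pval r)) \o f = tcat (tcat v b) (pval r) by apply/funext => -[[]|].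
split=> -[b hb]; exists b.
  by apply/holds_rename; rewrite E -(pP r hr (tcat v b)).
by move/holds_rename: hb; rewrite E -(pP r hr (tcat v b)).
Qed.

Lemma dfn_allfin A V (J : finType) (P : (V -> T) -> (J -> T) -> Prop) :
  dfn A (fun w : V + J -> T => P (w \o inl) (w \o inr)) ->
  dfn A (fun v => forall b, P v b).
Proof.
move=> h; have h1 := dfn_not (dfn_exfin (P := fun v b => ~ P v b) (dfn_not h)).
apply: dfn_ext h1 => v; split=> [k b|k [b]//].
by apply: contrapT => Pb; apply: k; exists b.
Qed.

End Definability.

Definition real (T : Type) (a : T) : eqelt T := @Eqelt T 1 [set x | x ord0 = a].

(* Satisfied by sets of imaginaries. It passes to the images in K of imaginaries of a
   relic, and is all that is used about parameters. *)
Definition definable_classes (L : language) (T : Type) (S : structure L T) (A : set (eqelt T))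
  :=
  forall e, A e -> eq_class e !=set0 /\ dfn S A (eq_class e).

Section AclParams.
Variables (L : language) (T : Type) (S : structure L T).
Implicit Types (A E : set (eqelt T)) (C : set T).

Lemma real_class (e : eqelt T) (a : T) : real a = e -> eq_class e (fun=> a).
Proof. by move=> <-. Qed.

Lemma rep_real (e : eqelt T) (a : T) (x : 'I_(eq_ar e) -> T) i :
  real a = e -> eq_class e x -> x i = a.
Proof. by move=> ae; subst e => /= <-; rewrite ord1. Qed.

Lemma dfn_param E V J (X : set (V + J -> T)) (b : J -> T) :
  dfn S E X -> (forall j, E (real (b j))) -> dfn S E (fun v => X (tcat v b)).
Proof.
move=> [p pX] bE.
pose f j : pvar E := existT (fun e : E => 'I_(eq_ar (val e)))
  (exist _ (real (b j)) (mem_set (bE j))) ord0.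
pose g (k : (V + J) + pvar E) : V + pvar E := match k with
  | inl (inl v) => inl v | inl (inr j) => inr (f j) | inr q => inr q end.
exists (formula_rename p g) => r hr x; rewrite holds_rename (pX r hr).
suff -> : tcat (tcat x b) (pval r) = tcat x (pval r) \o g by [].
apply/funext => -[[v|j]|q] //=.
by rewrite /pval /=; rewrite (@rep_real _ (b j) _ _ _ (hr _)).
Qed.

Lemma acl_intro E W (X : set (option W -> T)) (c : W -> T) (b : T) :
  dfn S E X -> (forall w, E (real (c w))) -> finite_set [set a | X (ocons a c)] ->
  X (ocons b c) -> acl S E b.
Proof.
move=> hX cE fX Xb.
exists (fun y : unit -> T => X (ocons (y tt) c)); split => //.
- have h : dfn S E (fun y : unit + W -> T => X (ocons (y (inl tt)) (y \o inr))).
    apply: (dfn_ren (f := fun k : option W => match k with Some w => inr w | None => inl tt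
      end) hX).
    by move=> w; apply/funext => -[].
  exact: (dfn_param h cE).
- apply: sub_finite_set (finite_image (fun a _ => a) fX).
  by move=> y Xy; exists (y tt) => //; apply/funext => -[].
Qed.

Lemma reps_exist A : definable_classes S A -> exists r : (forall e : A, 'I_(eq_ar (val e)) ->
  T), reps r.
Proof.
move=> gA; have h (e : A) : {x | eq_class (val e) x}.
  by apply/cid; have [] := gA (val e) (set_mem (valP e)).
by exists (fun e => sval (h e)) => e; exact: svalP (h e).
Qed.

(** Replaces the representative of the single class [e]. The transport is there because the type of
    a representative depends on its class. *)
Definition upd A (e : A) (rho : 'I_(eq_ar (val e)) -> T)
    (r : forall e : A, 'I_(eq_ar (val e)) -> T) : forall e : A, 'I_(eq_ar (val e)) -> T :=
  fun e' => match pselect (e = e') with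
    | left h => eq_rect e (fun e' : A => 'I_(eq_ar (val e')) -> T) rho e' h
    | right _ => r e'
    end.

Lemma dfn0_holds V (p : formula L V) : dfn S set0 (holds S p).
Proof. by exists (formula_rename p inl) => r _ x; rewrite holds_rename. Qed.

Lemma pvar0_empty (q : pvar (@set0 (eqelt T))) : False.
Proof. by case: q => -[e he] _; have := set_mem he. Qed.

Lemma dfn0_formula V (X : set (V -> T)) : dfn S set0 X ->
  exists p : formula L V, forall v, X v <-> holds S p v.
Proof.
move=> [p pX]; pose f (k : V + pvar (@set0 (eqelt T))) : V :=
  match k with inl v => v | inr q => match pvar0_empty q with end end.
exists (formula_rename p f) => v; rewrite holds_rename.
pose r (e : @set0 (eqelt T)) : 'I_(eq_ar (val e)) -> T := match set_mem (valP e) with end.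
rewrite (pX r); last by move=> e; case: (set_mem (valP e)).
have -> // : tcat v (pval r) = v \o f.
by apply/funext => -[//|q]; have := pvar0_empty q.
Qed.

(** A formula mentions finitely many classes of [A], and each class is itself definable over [A], so
    quantifying over all representatives takes only finitely many quantifiers. The resulting set
    does not depend on representatives, as [dfn] demands. *)
Lemma dfn_all_reps A V (p : formula L (V + pvar A)) : definable_classes S A ->
  dfn S A (fun v => forall r, reps r -> holds S p (tcat v (@pval T A r))).
Proof.
move=> gA; have [J [g [q pE]]] := formula_support p.
pose agree (s : seq {classic A}) (r r' : forall e : A, 'I_(eq_ar (val e)) -> T) :=
  forall e : A, (e : {classic A}) \notin s -> r e = r' e.
(* Representatives of the classes in [s] are quantified and the others keep the values given by [r];
   hence agreement is required off [s] only. *)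
have key (s : seq {classic A}) : exists X : set (V + pvar A -> T), dfn S set0 X /\
    forall r, reps r -> forall v, X (tcat v (pval r)) <->
      (forall r', reps r' -> agree s r r' -> holds S p (tcat v (pval r'))).
  elim: s => [|e s [X [Xd XP]]].
    exists (holds S p); split; first exact: dfn0_holds.
    move=> r hr v; split=> [h r' _ rr'|]; last by apply.
    have <- // : r = r'.
    by apply/functional_extensionality_dep => e; exact: rr'.
  have [_ [c cP]] := gA (val e) (set_mem (valP e)).
  pose f (k : V + pvar A) : (V + pvar A) + 'I_(eq_ar (val e)) := match k with
    | inl v => inl (inl v)
    | inr a => match pselect (e = tag a) with
      | left h => inr (eq_rect_r (fun e' : A => 'I_(eq_ar (val e'))) (tagged a) h)
      | right _ => inl (inr a)
      end
    end.
  exists (fun v => forall b, holds S c (tcat b (v \o inr)) -> X (tcat v b \o f)); split.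
    apply: dfn_allfin; apply: dfn_imp.
      apply: (dfn_ren (f := fun k => match k with inl i => inr i | inr a => inl (inr a) end)
        (dfn0_holds c)).
      by move=> w; apply/funext => -[].
    apply: (dfn_ren (f := f) Xd) => w.
    by have -> // : tcat (w \o inl) (w \o inr) = w by apply/funext => -[].
  move=> r hr v.
  have fE b : tcat (tcat v (pval r)) b \o f = tcat v (pval (upd b r)).
    apply/funext => -[//|[e' i]] /=; rewrite /pval /upd /=.
    by case: pselect => // h; case: _ / h i.
  have updr b : eq_class (val e) b -> reps (upd b r).
    by move=> hb e'; rewrite /upd; case: pselect => // h; case: _ / h.
  split=> [h r' hr' rr'|h b hb].
    have /h : holds S c (tcat (r' e) (pval r)) by apply/(cP r hr).
    rewrite fE => /(XP _ (updr _ (hr' e))); apply => // e' es.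
    rewrite /upd; case: pselect => [h'|ne]; first by case: _ / h'.
    apply: rr'; rewrite inE negb_or es andbT; apply/eqP => e'e; exact: ne.
  rewrite fE; have {}hb : eq_class (val e) b by apply/(cP r hr).
  apply/(XP _ (updr _ hb)) => r' hr' rr'; apply: h => // e'.
  rewrite inE negb_or => /andP[/eqP e'e es]; rewrite -rr' // /upd.
  by case: pselect => // h; case: e'e.
have [r0 hr0] := reps_exist gA.
pose s : seq {classic A} :=
  pmap (fun j => match g j with inr a => Some (tag a) | inl _ => None end) (enum J).
have [X [Xd XP]] := key s.
have [c cX] := dfn0_formula Xd.
exists c => r hr v; rewrite -cX XP //; split=> [h r' hr' _|h r' hr']; first exact: h.
(* [r2] takes the new values only at the classes that occur in [p]: it agrees with [r] off [s] and
   still evaluates [p] as [r'] does. *)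
pose r2 (e : A) : 'I_(eq_ar (val e)) -> T :=
  if (e : {classic A}) \in s then r' e else r e.
have hr2 : reps r2 by move=> e; rewrite /r2; case: ifP.
have /pE : holds S p (tcat v (pval r2)).
  by apply: h => // e es; rewrite /r2 (negbTE es).
have -> : tcat v (pval r2) \o g = tcat v (pval r') \o g.
  apply/funext => j /=; case gj : (g j) => [//|[e i]] /=.
  rewrite /pval /r2 /= ifT // mem_pmap; apply/mapP; exists j; first by rewrite mem_enum.
  by rewrite gj.
by move/pE.
Qed.

(* A formula over A and C algebraic over both is independent of the representatives of A
   only at the given values of C; quantifying over all representatives makes it so for
   all values. *)
Lemma aclP A C b : definable_classes S A -> acl S (A `|` reals C) b ->
  exists X : set (option C -> T), [/\ dfn S A X, finite_set [set a | X (ocons a val)]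
    & X (ocons b val)].
Proof.
move=> gA [Y [[p pY] fY Yb]].
pose E := A `|` reals C.
have hC (e : E) : ~ A (val e) -> {c : C | real (val c) = val e}.
  move=> Ae; apply/cid; have [//|[c cC ce]] := set_mem (valP e).
  by exists (exist _ c (mem_set cC)).
(* Members of [A] stay parameters, even if they are also real elements of [C]; the remaining ones
   become variables indexed by [C]. *)
pose k (q : pvar E) : C + pvar A := match pselect (A (val (tag q))) with
  | left a => inr (existT (fun e : A => 'I_(eq_ar (val e)))
      (exist _ (val (tag q)) (mem_set a)) (tagged q))
  | right a => inl (sval (hC (tag q) a)) end.
pose f (v : unit + pvar E) : option C + pvar A := match v with inl _ => inl None
  | inr q => match k q with inl c => inl (Some c) | inr a => inr a end end.
have fP x rA : reps rA -> Y (fun=> x) <-> holds S (formula_rename p f) (tcat (ocons x val)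
  (pval rA)).
  move=> hr; pose rE (e : E) i := tcat val (pval rA) (k (existT _ e i)).
  have hrE : reps rE.
    move=> e; rewrite /rE /k /=; case: pselect => a;
      first exact: (hr (exist (fun x => x \in A) (val e) (mem_set a))).
    by apply: real_class; exact: svalP (hC e a).
  rewrite (pY rE hrE) holds_rename.
  have -> // : tcat (fun=> x) (pval rE) = tcat (ocons x val) (pval rA) \o f.
  by apply/funext => -[[]//|[e i]] /=; rewrite /pval /rE /=; case: (k _).
have YX x : Y (fun=> x) <-> (forall r : (forall e : A, 'I_(eq_ar (val e)) -> T), reps r ->
    holds S (formula_rename p f) (tcat (ocons x val) (pval r))).
  have [r0 hr0] := reps_exist gA.
  by split=> [h r hr|h]; [apply/fP|apply/(fP _ r0) => //; exact: h].
exists (fun v => forall r, reps r -> holds S (formula_rename p f) (tcat v (@pval T A r)));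
  split.
- exact: dfn_all_reps.
- apply: sub_finite_set (finite_image (fun y => y tt) fY) => a ha.
  by exists (fun=> a) => //; apply/YX.
- exact/YX.
Qed.
End AclParams.

(** * Dimension in pregeometries *)

Section Matroid.
Variables (T : Type) (cl : set T -> set T).

Definition pregeometry :=
  [/\ forall C, C `<=` cl C,
      forall C C', C `<=` C' -> cl C `<=` cl C',
      forall C a b, cl C a -> cl (C `|` [set a]) b -> cl C b &
      forall C a b, cl (C `|` [set a]) b -> ~ cl C b -> cl (C `|` [set b]) a].

Definition indep (C : set T) (I : finType) (a : I -> T) (J : {set I}) : Prop :=
  forall j, j \in J -> ~ cl (C `|` [set a i | i in [set i | i \in J :\ j]]) (a j).

Definition mdim (C : set T) (I : finType) (a : I -> T) : nat :=
  \max_(J : {set I} | `[< indep C a J >]) #|J|.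

(** Rank of a list, found by scanning it and skipping what is already in the closure. Additivity
    along concatenation is immediate for it, and [mdim_greedy_rank] carries this over to [mdim]. *)
Fixpoint greedy_rank (C : set T) (s : seq T) : nat :=
  match s with
  | [::] => 0
  | a :: s' => ~~ `[< cl C a >] + greedy_rank (C `|` [set a]) s'
  end.

Fixpoint list_set (s : seq T) : set T :=
  if s is a :: s' then [set a] `|` list_set s' else set0.

Lemma mdim_ge C (I : finType) (a : I -> T) (J : {set I}) : indep C a J -> #|J| <= mdim C a.
Proof. by move=> h; apply: (leq_bigmax_cond (F := fun J : {set I} => #|J|)); apply/asboolP. Qed.

Lemma mdim_le C (I : finType) (a : I -> T) n :
  (forall J : {set I}, indep C a J -> #|J| <= n) -> mdim C a <= n.
Proof. by move=> h; apply/bigmax_leqP => J /asboolP /h. Qed.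

Lemma mdim_card C (I : finType) (a : I -> T) : mdim C a <= #|I|.
Proof. by apply: mdim_le => J _; exact: max_card. Qed.

Hypothesis pg : pregeometry.

Let ext C : C `<=` cl C. Proof. by case: pg => h _ _ _; exact: h. Qed.
Let mono C C' : C `<=` C' -> cl C `<=` cl C'.
Proof. by case: pg => _ h _ _; exact: h. Qed.
Let idem C a b : cl C a -> cl (C `|` [set a]) b -> cl C b.
Proof. by case: pg => _ _ h _; exact: h. Qed.
Let exch C a b : cl (C `|` [set a]) b -> ~ cl C b -> cl (C `|` [set b]) a.
Proof. by case: pg => _ _ _ h; exact: h. Qed.

Lemma greedy_rank_eq C C' s : (forall D x, cl (C `|` D) x <-> cl (C' `|` D) x) ->
  greedy_rank C s = greedy_rank C' s.
Proof.
elim: s C C' => //= a s IH C C' h; congr (_ + _); last first.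
  by apply: IH => D x; rewrite -!setUA.
congr nat_of_bool; congr negb; apply: asbool_equiv_eq.
by have := h set0 a; rewrite !setU0.
Qed.

Lemma greedy_rank_le C C' s : C `<=` C' -> greedy_rank C' s <= greedy_rank C s.
Proof.
elim: s C C' => //= a s IH C C' CC'; apply: leq_add; last by apply: IH; exact: setSU.
case: asboolP => //; case: asboolP => // h []; exact: mono h.
Qed.

Lemma greedy_rank_cl C a s : cl C a -> greedy_rank (C `|` [set a]) s = greedy_rank C s.
Proof.
move=> Ca; apply: greedy_rank_eq => D x; split; last by apply: mono;
  exact: setSU (@subsetUl _ _ _).
rewrite setUAC => h; apply: idem h; exact: mono Ca.
Qed.

Lemma greedy_rank_cat C s1 s2 : greedy_rank C (s1 ++ s2) = greedy_rank C s1 + greedy_rank (C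
  `|` list_set s1) s2.
Proof.
elim: s1 C => [|a s1 IH] C /=.
  by rewrite add0n setU0.
by rewrite IH addnA setUA.
Qed.

(** Exchange enters here, in the case where neither element is in the closure of [C]. Invariance
    under all permutations follows. *)
Lemma greedy_rank_swap C a b s : greedy_rank C (a :: b :: s) = greedy_rank C (b :: a :: s).
Proof.
rewrite /= !addnA -!setUA [[set a] `|` _]setUC; congr (_ + _).
have [Ca|Ca] := asboolP (cl C a); have [Cb|Cb] := asboolP (cl C b).
- by rewrite !asboolT //; apply: mono; try exact: Ca; try exact: Cb; exact: subsetUl.
- rewrite (asboolT (mono _ Ca)); last exact: subsetUl.
  by rewrite asboolF // => h; apply: Cb; exact: idem h.
- rewrite (asboolT (mono _ Cb)); last exact: subsetUl.
  by rewrite asboolF // => h; apply: Ca; exact: idem h.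
- have [h|h] := asboolP (cl (C `|` [set a]) b).
    by rewrite asboolT //; exact: exch.
  by rewrite asboolF // => k; apply: h; exact: exch.
Qed.

Lemma greedy_rank_move C s1 a s2 : greedy_rank C (s1 ++ a :: s2) = greedy_rank C (a :: s1 ++
  s2).
Proof. by elim: s1 C => // b s1 IH C; rewrite greedy_rank_swap /= IH. Qed.

Lemma greedy_rank_perm (I : eqType) C (a : I -> T) (s t : seq I) :
  perm_eq s t -> greedy_rank C (map a s) = greedy_rank C (map a t).
Proof.
elim: s C t => [|i s IH] C t; first by move/perm_size/esym/size0nil => ->.
move=> st; have it : i \in t by rewrite -(perm_mem st) mem_head.
case/splitPr: it st => t1 t2; rewrite perm_sym (perm_catCA t1 [:: i] t2) /= perm_sym perm_cons
  => st.
by rewrite map_cat /= greedy_rank_move /= -map_cat (IH _ (t1 ++ t2)).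
Qed.

Lemma greedy_rank_size C s : greedy_rank C s <= size s.
Proof. by elim: s C => //= a s IH C; rewrite -add1n leq_add // leq_b1. Qed.

Lemma list_set_map (I : eqType) (a : I -> T) (s : seq I) x :
  list_set (map a s) x <-> exists2 i, i \in s & a i = x.
Proof.
elim: s => [|i s IH] /=; first by split=> // -[].
split=> [[->|/IH[j js <-]]|[j]].
- by exists i; rewrite ?mem_head.
- by exists j; rewrite // inE js orbT.
- rewrite inE => /orP[/eqP -> <-|js jx]; first by left.
  by right; apply/IH; exists j.
Qed.

Lemma greedy_rank_indep C (I : finType) (a : I -> T) (J : {set I}) :
  indep C a J <-> greedy_rank C (map a (enum J)) = #|J|.
Proof.
split=> [hJ|hJ j jJ Cj].
  have h i : i \in enum J ->
      ~ cl (C `|` [set x | exists2 j, j \in enum J & j <> i /\ a j = x]) (a i).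
    rewrite mem_enum => iJ /mono h; apply: (hJ i iJ); apply: h; apply: setUS.
    move=> x [j]; rewrite mem_enum => jJ [ji <-]; exists j => //=.
    by rewrite !inE jJ andbT; apply/eqP.
  rewrite cardE; have := enum_uniq (mem J); elim: (enum J) C h {hJ} => //= i s IH C h.
  move=> /andP[si us]; rewrite asboolF; last first.
    by move/mono => k; apply: (h i); rewrite ?mem_head //; apply: k; exact: subsetUl.
  rewrite add1n IH // => j js; move/mono => k; apply: (h j); first by rewrite inE js orbT.
  apply: k; rewrite -setUA; apply: setUS => x [->|[k ks [kj <-]]].
    by exists i; rewrite ?mem_head; split=> // ij; move: si; rewrite ij js.
  by exists k; rewrite // inE ks orbT.
(* With [j] enumerated last, full rank forces [a j] out of the closure of the others. *)
have : perm_eq (enum J) (enum (J :\ j) ++ [:: j]).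
  apply: uniq_perm; rewrite ?enum_uniq //.
    by rewrite cat_uniq enum_uniq /= orbF andbT mem_enum !inE eqxx.
  by move=> i; rewrite mem_cat !mem_enum !inE; case: eqP => [->|]; rewrite ?orbF ?jJ.
move/(greedy_rank_perm C a); rewrite hJ map_cat greedy_rank_cat /= (cardsD1 j) jJ asboolT /=.
  rewrite !addn0 => e; have := greedy_rank_size C (map a (enum (J :\ j))).
  by rewrite -e size_map -cardE add1n ltnn.
apply: mono Cj; apply: setUS => _ [i /= iJ <-]; apply/list_set_map; exists i => //.
by rewrite mem_enum; move: iJ; rewrite inE.
Qed.

(** Keep exactly the elements that the scan counts. They are independent and as many as the rank,
    which bounds [mdim] from below. *)
Lemma greedy_rank_subseq (I : eqType) C (a : I -> T) (s : seq I) :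
  exists s', [/\ subseq s' s, greedy_rank C (map a s') = size s' & size s' = greedy_rank C
    (map a s)].
Proof.
elim: s C => [|i s IH] C; first by exists [::].
have [Ci|Ci] := asboolP (cl C (a i)).
  have [s' [ss e1 e2]] := IH C; exists s'; split => //=.
    exact: subseq_trans ss (subseq_cons _ _).
  by rewrite asboolT //= greedy_rank_cl.
have [s' [ss e1 e2]] := IH (C `|` [set a i]); exists (i :: s') => /=.
by rewrite asboolF //= e1 eqxx e2.
Qed.

Lemma greedy_rank_le_mdim C (I : finType) (a : I -> T) (s : seq I) : uniq s ->
  greedy_rank C (map a s) = size s -> size s <= mdim C a.
Proof.
move=> us hs; have ps : perm_eq s (enum [set i in s]).
  by apply: uniq_perm; rewrite ?enum_uniq // => i; rewrite mem_enum inE.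
rewrite (perm_size ps) -cardE; apply: mdim_ge; apply/greedy_rank_indep.
by rewrite -(greedy_rank_perm C a ps) hs (perm_size ps) -cardE.
Qed.

Lemma mdim_greedy_rank C (I : finType) (a : I -> T) : mdim C a = greedy_rank C (map a (enum I)).
Proof.
apply/eqP; rewrite eqn_leq; apply/andP; split.
  apply: mdim_le => J /greedy_rank_indep <-.
  have /(greedy_rank_perm C a) <- : perm_eq (enum J ++ enum (~: J)) (enum I).
    apply: uniq_perm; rewrite ?enum_uniq // ?cat_uniq ?enum_uniq /= ?andbT.
      by apply/hasPn => i; rewrite !mem_enum inE.
    by move=> i; rewrite mem_cat !mem_enum !inE; case: (i \in J).
  by rewrite map_cat greedy_rank_cat leq_addr.
have [s [ss e1 <-]] := greedy_rank_subseq C a (enum I).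
by apply: greedy_rank_le_mdim => //; exact: subseq_uniq ss (enum_uniq _).
Qed.

Lemma mdimD C (I J : finType) (a : I -> T) (b : J -> T) :
  mdim C (tcat a b) = mdim C a + mdim (C `|` range a) b.
Proof.
rewrite !mdim_greedy_rank.
have /(greedy_rank_perm C (tcat a b)) -> :
    perm_eq (enum {: I + J}) (map inl (enum I) ++ map inr (enum J)).
  apply: uniq_perm; rewrite ?enum_uniq // ?cat_uniq.
    rewrite (map_inj_uniq (f := inl)) ?(map_inj_uniq (f := inr)) ?enum_uniq //=;
      try by move=> ? ? [].
    by rewrite andbT /=; apply/hasPn => _ /mapP[i _ ->]; apply/mapP => -[].
  move=> [i|j]; rewrite mem_cat mem_enum.
    by rewrite (map_f inl) // mem_enum.
  by rewrite orbC (map_f inr) // mem_enum.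
rewrite map_cat -!map_comp greedy_rank_cat; congr (greedy_rank _ _ + greedy_rank (_ `|` _) _).
apply/seteqP; split=> x; first by move/list_set_map => [i _ <-]; exists i.
by move=> [i _ <-]; apply/list_set_map; exists i => //; rewrite mem_enum.
Qed.

Lemma mdim_mono C C' (I : finType) (a : I -> T) : C `<=` C' -> mdim C' a <= mdim C a.
Proof. by move=> h; rewrite !mdim_greedy_rank; exact: greedy_rank_le. Qed.

Lemma mdim0 C (I : finType) (a : I -> T) : (forall i, cl C (a i)) -> mdim C a = 0.
Proof.
rewrite mdim_greedy_rank => h; elim: (enum I) => //= i s IH.
by rewrite asboolT //= greedy_rank_cl.
Qed.

Lemma mdim0_cl C (I : finType) (a : I -> T) i : mdim C a = 0 -> cl C (a i).
Proof.
move=> h; apply: contrapT => Ci.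
suff : #|[set i]%SET| <= mdim C a by rewrite h cards1.
apply: mdim_ge => j; rewrite inE => /eqP ->.
rewrite [X in C `|` X](_ : _ = set0) ?setU0 //.
by apply/seteqP; split=> // x [k /=]; rewrite !inE andbC andbN.
Qed.

(** Additivity in both orders. Being free of subtraction, this equation is the form in which later
    dimension counts use additivity. *)
Lemma mdim_sym C (I J : finType) (a : I -> T) (b : J -> T) :
  mdim C a + mdim (C `|` range a) b = mdim C b + mdim (C `|` range b) a.
Proof.
rewrite -!mdimD !mdim_greedy_rank.
pose g (k : I + J) : J + I := match k with inl i => inr i | inr j => inl j end.
have -> : tcat a b = tcat b a \o g by apply/funext => -[].
rewrite map_comp; apply: greedy_rank_perm; apply: uniq_perm; rewrite ?enum_uniq //.
  by rewrite map_inj_uniq ?enum_uniq // => -[i|j] [i'|j'] //= [->].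
move=> k; rewrite mem_enum; case: k => k; [apply: (map_f g (x := inr k))|
  apply: (map_f g (x := inl k))]; by rewrite mem_enum.
Qed.

Lemma mdim_le_cl C (I J : finType) (a : I -> T) (b : J -> T) :
  (forall j, cl (C `|` range a) (b j)) -> mdim C b <= mdim C a.
Proof. by move=> h; have := mdim_sym C a b; rewrite (mdim0 h) addn0 => ->;
  rewrite leq_addr. Qed.

End Matroid.

(** * Algebraic closure over imaginaries *)

(** A property of the complete theory: one [q] serves all its models, because Morley rank refers to
    elementary extensions. The variables range over any type [V], so that representatives of
    parameters can be among them. *)
Definition eliminates_infinity (L : language) (T : Type) (S : structure L T) : Prop :=
  forall V (p : formula L (option V)), exists q : formula L V,
    forall T' (S' : structure L T'), elem_equiv S S' -> forall v : V -> T',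
    holds S' q v <-> infinite_set [set a | holds S' p (ocons a v)].

Lemma elem_equiv_refl (L : language) (T : Type) (S : structure L T) : elem_equiv S S.
Proof. by move=> p v v'; have -> : v = v' by apply/funext => -[]. Qed.

Lemma geometric_infinity (L : language) (T : Type) (S : structure L T) :
  geometric S -> eliminates_infinity S.
Proof.
move=> [_ gS] V p; have [J [g [q pq]]] := formula_support p.
pose f (k : J) : unit + 'I_#|{: {k | g k}}| :=
  if insub k is Some k' then inr (enum_rank (k' : {k | g k})) else inl tt.
have [psi psiP] := gS _ (formula_rename q f).
exists (formula_rename psi (osome (g := g) \o enum_val)) => T' S' SS' v.
rewrite holds_rename psiP //.
have -> // : [set a | holds S' (formula_rename q f)
    (tcat (fun=> a) (v \o (osome (g:=g) \o enum_val)))] = [set a | holds S' p (ocons a v)].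
apply/funext => a; apply/propext => /=; rewrite holds_rename pq.
have -> // : tcat (fun=> a) (v \o (osome (g:=g) \o enum_val)) \o f = ocons a v \o g.
apply/funext => k /=; rewrite -(osomeE g k) /f.
by case: insub => //= k'; rewrite enum_rankK.
Qed.

Lemma countable_setU (T : Type) (A B : set T) :
  countable A -> countable B -> countable (A `|` B).
Proof.
move=> cA cB; have -> : A `|` B = \bigcup_(b in [set: bool]) (if b then A else B).
  apply/seteqP; split=> x; first by case=> h; [exists true|exists false].
  by move=> [[] _ h]; [left|right].
by apply: bigcup_countable => [|[] _ //]; exact: countableP.
Qed.

Section Saturation.
Variables (L : language) (T : Type) (S : structure L T).
Implicit Types (A E : set (eqelt T)) (B C : set T).

Lemma dfn_inf A V (P : (V -> T) -> T -> Prop) : eliminates_infinity S ->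
  dfn S A (fun w : option V -> T => P (w \o some) (w None)) ->
  dfn S A (fun v => infinite_set [set a | P v a]).
Proof.
move=> QS [p pP].
pose f (k : option V + pvar A) : option (V + pvar A) := match k with
  | inl None => None | inl (Some v) => Some (inl v) | inr q => Some (inr q) end.
have [q qP] := QS _ (formula_rename p f).
exists q => r hr v; rewrite (qP _ _ (@elem_equiv_refl _ _ S)).
have -> // : [set a | P v a] = [set a | holds S (formula_rename p f) (ocons a (tcat v (pval
  r)))].
apply/funext => a; apply/propext => /=; rewrite holds_rename.
have -> : ocons a (tcat v (pval r)) \o f = tcat (ocons a v) (pval r) by apply/funext => -[[]|].
by rewrite -(pP r hr (ocons a v)).
Qed.

Lemma dfn_fin A V (P : (V -> T) -> T -> Prop) : eliminates_infinity S ->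
  dfn S A (fun w : option V -> T => P (w \o some) (w None)) ->
  dfn S A (fun v => finite_set [set a | P v a]).
Proof.
move=> QS h; apply: dfn_ext (dfn_not (dfn_inf QS h)) => v.
by split; [exact: contrapT|move=> f; apply].
Qed.

Lemma definable_classes0 : definable_classes S set0.
Proof. by move=> e; case. Qed.

Lemma saturated_transcendental V (X : set (option V -> T)) (c : V -> T) B :
  aleph1_saturated S -> dfn S set0 X -> countable B -> (forall v, B (c v)) ->
  infinite_set [set a | X (ocons a c)] ->
  exists2 a, X (ocons a c) & ~ acl S (reals B) a.
Proof.
move=> satS /dfn0_formula[p pX] cB cV infX.
pose f (k : option V) : unit + B := match k with
  | None => inl tt | Some v => inr (exist _ (c v) (mem_set (cV v))) end.
have fE a : tcat (fun=> a) val \o f = ocons a c by apply/funext => -[].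
(* The type says that [a] lies in the fibre over [c] and satisfies no formula over [B] with finitely
   many solutions. A finite part removes only finitely many points from the infinite fibre. *)
pose Phi := [set formula_rename p f] `|` [set Imp q (Bot L _) | q in
  [set q : formula L (unit + B) | finite_set [set a | holds S q (tcat (fun=> a) val)]]].
have [F fF FPhi|a aP] := satS B cB Phi.
  have fU : finite_set (\bigcup_(phi in F)
      [set a | X (ocons a c) /\ ~ holds S phi (tcat (fun=> a) val)]).
    apply: bigcup_finite => // phi /FPhi[->|[q fq <-]].
      have -> : [set a | X (ocons a c) /\ ~ holds S (formula_rename p f) (tcat (fun=> a) val)]
        = set0.
        by apply/seteqP; split=> // a [/= /pX Xa []]; apply/holds_rename; rewrite fE.
      exact: finite_set0.
    by apply: sub_finite_set fq => a [Xa /=] h; apply: contrapT => k; apply: h.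
  apply: contrapT => /forallNP h; apply: infX; apply: sub_finite_set fU => a Xa.
  by have /existsNP[phi /not_implyP[Fphi hphi]] := h a; exists phi.
exists a.
  by apply/pX; rewrite -fE; apply/holds_rename; apply: aP; left.
rewrite -(set0U (reals B)) => /(aclP definable_classes0)[Y [/dfn0_formula[q qY] fY Ya]].
pose g (k : option B) : unit + B := if k is Some b then inr b else inl tt.
have gE x : tcat (fun=> x) val \o g = ocons x val by apply/funext => -[].
suff : holds S (Imp (formula_rename q g) (Bot L _)) (tcat (fun=> a) val).
  by apply; apply/holds_rename; rewrite gE; apply/qY.
apply: aP; right; exists (formula_rename q g) => //=; apply: sub_finite_set fY => x /=.
by move/holds_rename; rewrite gE => /qY.
Qed.

(** The imaginary part [A] of the parameters is fixed and the real part [C] varies, so that closure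
    becomes an operator on sets of real elements, as [pregeometry] requires. *)
Definition acl_over A C : set T := acl S (A `|` reals C).

Lemma realsP A C c : C c -> (A `|` reals C) (real c).
Proof. by right; exists c. Qed.

Lemma reals_sub A C C' : C `<=` C' -> A `|` reals C `<=` A `|` reals C'.
Proof. by move=> CC'; apply: setUS; exact: image_subset. Qed.

Lemma acl_over_intro A C W (X : set (option W -> T)) (c : W -> T) (b : T) :
  dfn S A X -> (forall w, C (c w)) -> finite_set [set a | X (ocons a c)] ->
  X (ocons b c) -> acl_over A C b.
Proof.
move=> hX cC; apply: acl_intro; last by move=> w; exact: realsP.
exact: dfn_sub (@subsetUl _ _ _) hX.
Qed.

Lemma acl_over_ext A C : C `<=` acl_over A C.
Proof.
move=> c Cc; apply: (@acl_over_intro A C unit (fun w => w None = w (Some tt)) (fun=> c)) => //=.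
  exact: dfn_eq.
by apply: sub_finite_set (finite_set1 c) => x.
Qed.

Lemma acl_over_mono A C C' : C `<=` C' -> acl_over A C `<=` acl_over A C'.
Proof.
move=> CC' b [X [Xd fX Xb]]; exists X; split => //; apply: dfn_sub Xd; exact: reals_sub.
Qed.

Lemma acl_over_finite A C b : definable_classes S A -> acl_over A C b ->
  exists C0, [/\ finite_set C0, C0 `<=` C & acl_over A C0 b].
Proof.
move=> gA /(aclP gA)[X [[p pX] fX Xb]].
have [J [g [q pq]]] := formula_support p.
pose C0 : set T := [set x | exists j (c : C), g j = inl (Some c) /\ x = val c].
have C0C : C0 `<=` C by move=> _ [j [c [_ ->]]]; exact: set_mem (valP c).
exists C0; split => //.
  apply: sub_finite_set (finite_image
    (fun j => if g j is inl (Some c) then val c else b) (@finite_finset J setT)).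
  by move=> _ [j [c [gj ->]]]; exists j => //; rewrite gj.
(* Elements outside [C0] do not occur in [q], so their image is arbitrary. *)
pose f (c : C) : option C0 :=
  if pselect (C0 (val c)) is left h then Some (exist _ (val c) (mem_set h)) else None.
pose h (k : option C + pvar A) : option C0 + pvar A := match k with
  | inl None => inl None | inl (Some c) => inl (f c) | inr q => inr q end.
have [r hr] := reps_exist gA.
(* After the renaming the formula might depend on the representatives of [A] at values other than
   the given ones, hence the quantification over all of them. *)
pose Y := [set v | forall r : (forall e : A, 'I_(eq_ar (val e)) -> T), reps r ->
  holds S (formula_rename p h) (tcat v (pval r))].
have XY a : X (ocons a val) <-> Y (ocons a val).
  have key r' : reps r' -> X (ocons a val) <-> holds S (formula_rename p h) (tcat (ocons a
    val) (@pval T A r')).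
    move=> hr'; rewrite (pX _ hr') holds_rename !pq.
    have -> // : tcat (ocons a val) (pval r') \o g =
        (tcat (ocons a val) (pval r') \o h) \o g.
    apply/funext => j /=; case gj: (g j) => [[c|]|//] //=.
    rewrite /f; case: pselect => //= -[]; exists j, c; by split.
  by split=> [Xa r' hr'|Ya]; [apply/key|apply/(key r) => //; exact: Ya].
apply: (@acl_over_intro A C0 C0 Y val) => //.
- exact: dfn_all_reps.
- by move=> c; exact: set_mem (valP c).
- by apply: sub_finite_set fX => a /= /XY.
- exact/XY.
Qed.

(** [b] lies in the union of the fibres of [X] over the finitely many points of [Y]. Some of these
    fibres could be infinite; finiteness of the fibre is therefore made part of [W], which
    elimination of infinity permits. *)
Lemma acl_over_idem A C a b : eliminates_infinity S -> definable_classes S A ->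
  acl_over A C a -> acl_over A (C `|` [set a]) b -> acl_over A C b.
Proof.
move=> QS gA /(aclP gA)[Y [Yd fY Ya]] /(aclP gA)[X [Xd fX Xb]].
pose g (e : C `|` [set a]) : option C :=
  if pselect (C (val e)) is left h then Some (exist _ (val e) (mem_set h)) else None.
have gE x : ocons x (ocons a val \o g) = ocons x val.
  apply/funext => -[e|//] /=; rewrite /g; case: pselect => //= h.
  by have [/h|] := set_mem (valP e).
pose W := [set v : option C -> T | exists y, Y (ocons y (v \o some)) /\
   (finite_set [set x | X (ocons x (ocons y (v \o some) \o g))] /\
   X (ocons (v None) (ocons y (v \o some) \o g)))].
have Wd : dfn S A W.
  apply: dfn_ex; apply: dfn_and.
    apply: (dfn_ren (f := fun k => if k is Some c then Some (Some c) else None) Yd) => w.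
    by apply/funext => -[].
  apply: dfn_and.
    apply: dfn_fin => //.
    apply: (dfn_ren (f := fun k => if k is Some e then
      (if g e is Some c then Some (Some (Some c)) else Some None) else None) Xd) => w.
    by apply/funext => -[e|//] /=; case: (g e).
  apply: (dfn_ren (f := fun k => if k is Some e then
      (if g e is Some c then Some (Some c) else None) else Some None) Xd) => w.
  by apply/funext => -[e|//] /=; case: (g e).
apply: (acl_over_intro Wd (c := val)).
- by move=> c; exact: set_mem (valP c).
- apply: (@sub_finite_set _ _ (\bigcup_(y in [set y | Y (ocons y val) /\
      finite_set [set x | X (ocons x (ocons y val \o g))]])
    [set x | X (ocons x (ocons y val \o g))])).
    by move=> x [y [Yy [fy Xy]]]; exists y.
  by apply: bigcup_finite => [|y []//]; apply: sub_finite_set fY => y [].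
- exists a; split => //; change (finite_set [set x | X (ocons x (ocons a val \o g))] /\
    X (ocons b (ocons a val \o g))).
  split; last by rewrite gE.
  by apply: sub_finite_set fX => x /=; rewrite gE.
Qed.

Lemma reals_dfn A V (X : set (V -> T)) (r : forall e : A, 'I_(eq_ar (val e)) -> T) :
  dfn S A X -> reps r -> exists X0 : set (V + pvar A -> T), dfn S set0 X0 /\
    forall v, X v <-> X0 (tcat v (pval r)).
Proof.
by move=> [p pX] hr; exists (holds S p); split=> [|v]; [exact: dfn0_holds|exact: pX].
Qed.

Lemma countable_pvar A (r : forall e : A, 'I_(eq_ar (val e)) -> T) :
  countable A -> countable (range (pval r)).
Proof.
move=> cA; have -> : range (pval r) = \bigcup_(e in [set: A]) range (r e).
  apply/seteqP; split=> x; first by move=> [[e i] _ <-]; exists e => //; exists i.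
  by move=> [e _ [i _ <-]]; exists (existT _ e i).
apply: bigcup_countable => [|e _]; first by rewrite (eq_countable (card_setT A)).
apply: finite_set_countable; apply: finite_image; exact: finite_finset.
Qed.

(* Reduces to exchange over real parameters: as ``infinitely many'' is definable, the
   relation between a and b also holds for a pair that is generic over representatives
   of A. *)
Lemma acl_over_exch_countable A C a b : eliminates_infinity S -> acl_exchange S ->
  aleph1_saturated S -> definable_classes S A -> countable A -> countable C ->
  acl_over A (C `|` [set a]) b -> ~ acl_over A C b -> acl_over A (C `|` [set b]) a.
Proof.
move=> QS exS satS gA cA cC /(aclP gA)[X [Xd fX Xb]] nb; apply: contrapT => na.
pose g (e : C `|` [set a]) : option C :=
  if pselect (C (val e)) is left h then Some (exist _ (val e) (mem_set h)) else None.
have gE x : ocons x (ocons a val \o g) = ocons x val.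
  apply/funext => -[e|//] /=; rewrite /g; case: pselect => //= h.
  by have [/h|] := set_mem (valP e).
pose X3 (x y : T) (v : C -> T) := finite_set [set x | X (ocons x (ocons y v \o g))] /\
   X (ocons x (ocons y v \o g)).
have X3b : X3 b a val.
  by split; [apply: sub_finite_set fX => x /=; rewrite gE|rewrite gE].
have X3d (f1 f2 : option (option C)) (f : C -> option (option C)) :
    dfn S A (fun w : option (option C) -> T => X3 (w f1) (w f2) (w \o f)).
  apply: dfn_and.
    apply: dfn_fin => //.
    apply: (dfn_ren (f := fun k => if k is Some e then
      (if g e is Some c then Some (f c) else Some f2) else None) Xd) => w.
    by apply/funext => -[e|//] /=; case: (g e).
  apply: (dfn_ren (f := fun k => if k is Some e then
      (if g e is Some c then f c else f2) else f1) Xd) => w.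
  by apply/funext => -[e|//] /=; case: (g e).
have CV (v : C) : C (val v) by exact: set_mem (valP v).
have inf1 : infinite_set [set y | X3 b y val].
  move=> fin; apply: na.
  apply: (acl_over_intro (X3d (Some None) None (some \o some)) (c := ocons b val)) => //.
  by case=> [c|]; [left; exact: CV|right].
(* [G] collects the points related to infinitely many others. It contains [b], so it has infinitely
   many points, [b] not being algebraic. *)
pose G := [set v : option C -> T | infinite_set [set y | X3 (v None) y (v \o some)]].
have Gd : dfn S A G by apply: dfn_inf => //; exact: (X3d (Some None) None (some \o some)).
have infG : infinite_set [set x | G (ocons x val)].
  by move=> fin; apply: nb; apply: (acl_over_intro Gd (c := val)).
have [r hr] := reps_exist gA.
pose B := C `|` range (pval r).
have cB : countable B by apply: countable_setU => //; exact: countable_pvar.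
pose u := tcat val (pval r) : C + pvar A -> T.
have uB v : B (u v) by case: v => v; [left; exact: CV|right; exists v].
have [G0 [G0d GG0]] := reals_dfn Gd hr.
have G0d' : dfn S set0 (fun w : option (C + pvar A) -> T =>
    G0 (tcat (ocons (w None) (w \o some \o inl)) (w \o some \o inr))).
  apply: (dfn_ren (f := fun k => match k with inl None => None | inl (Some c) => Some (inl c)
    | inr q => Some (inr q) end) G0d) => w.
  by apply/funext => -[[]|].
have [|b' Gb' nb'] := saturated_transcendental satS G0d' cB uB.
  by apply: sub_infinite_set infG => x /GG0.
have {}Gb' : infinite_set [set y | X3 b' y val] by move/GG0: Gb'.
have [Y0 [Y0d YY0]] := reals_dfn (X3d None (Some None) (some \o some)) hr.
have Y0d' : dfn S set0 (fun w : option (option (C + pvar A)) -> T =>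
    Y0 (tcat (ocons (w (Some None)) (ocons (w None) (w \o some \o some \o inl)))
     (w \o some \o some \o inr))).
  apply: (dfn_ren (f := fun k => match k with inl None => Some None
    | inl (Some None) => None | inl (Some (Some c)) => Some (Some (inl c))
    | inr q => Some (Some (inr q)) end) Y0d) => w.
  by apply/funext => -[[[]|]|].
have cB' : countable (B `|` [set b']) by apply: countable_setU => //; exact: countable1.
have [||a' Ya' na'] := saturated_transcendental (c := ocons b' u) satS Y0d' cB'.
- by case=> [c|]; [left; exact: uB|right].
- by apply: sub_infinite_set Gb' => y /= h; apply/YY0.
(* [b'] is algebraic over [a'] and [B] but not over [B] alone, so exchange over real parameters
   makes [a'] algebraic over [b'], against its choice. *)
apply: na'; apply: exS nb'.
have {}Ya' : X3 b' a' val by move/YY0: Ya'.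
rewrite -(set0U (reals _)).
apply: (@acl_over_intro set0 _ (option (C + pvar A)) (fun w =>
    Y0 (tcat (ocons (w None) (ocons (w (Some None)) (w \o some \o some \o inl)))
     (w \o some \o some \o inr))) (ocons a' u)).
- apply: (dfn_ren (f := fun k => match k with inl None => None
    | inl (Some None) => Some None | inl (Some (Some c)) => Some (Some (inl c))
    | inr q => Some (Some (inr q)) end) Y0d) => w.
  by apply/funext => -[[[]|]|].
- by case=> [c|]; [left; exact: uB|right].
- case: Ya' => fin _; apply: sub_finite_set fin => x /=.
  by move/(YY0 (ocons x (ocons a' val))) => [].
- by apply/(YY0 (ocons b' (ocons a' val))).
Qed.

Lemma acl_over_pregeometry A : eliminates_infinity S -> acl_exchange S ->
  aleph1_saturated S -> definable_classes S A -> countable A -> pregeometry (acl_over A).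
Proof.
move=> QS exS satS gA cA; split.
- exact: acl_over_ext.
- exact: acl_over_mono.
- by move=> C a b; exact: acl_over_idem.
(* Saturation reaches countable sets only, so [C] is first cut down to the finite part that is
   used. *)
- move=> C a b h nb; have [C0 [fC0 C0C hb]] := acl_over_finite gA h.
  pose C1 := C0 `&` C.
  have hb1 : acl_over A (C1 `|` [set a]) b.
    by apply: acl_over_mono hb => x xC0; have [|->] := C0C x xC0; [left|right].
  have : acl_over A (C1 `|` [set b]) a.
    apply: acl_over_exch_countable hb1 _ => //.
      by apply: finite_set_countable; exact: finite_setIl.
    by move=> k; apply: nb; apply: acl_over_mono k; exact: subIsetr.
  apply: acl_over_mono; apply: setSU; exact: subIsetr.
Qed.
End Saturation.

(* X is large along [:: i1; ...; in] if there are infinitely many x_i1 such that there are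
   infinitely many x_i2 such that ... such that x is in X. Unlike Morley rank this is a
   first order condition; in a strongly minimal structure X has rank at least n iff it is
   large along a sequence of length n. *)
Fixpoint large_along (T I : Type) (s : seq I) (X : set (I -> T)) : Prop :=
  match s with
  | [::] => X !=set0
  | i :: s' => infinite_set [set a | large_along s' [set x | X x /\ x i = a]]
  end.

Lemma large_along_mono (T I : Type) (s : seq I) (X Y : set (I -> T)) :
  X `<=` Y -> large_along s X -> large_along s Y.
Proof.
elim: s X Y => [|i s IH] X Y XY /=; first by move=> [x /XY]; exists x.
by apply: sub_infinite_set => a; apply: IH => x [/XY].
Qed.

Lemma large_along_nonempty (T I : Type) (s : seq I) (X : set (I -> T)) : large_along s X ->
  X !=set0.
Proof.
elim: s X => [|i s IH] X //= /infinite_setN0[a /IH[x []]]; by exists x.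
Qed.

Lemma formula_slice (L : language) (I : Type) (i : I) V (p : formula L (I + V)) :
  exists p' : formula L (I + option V), forall T (S : structure L T) v a,
    [set x | holds S p' (tcat x (ocons a v))] = [set x | holds S p (tcat x v) /\ x i = a].
Proof.
pose f (k : I + V) : I + option V := match k with inl i => inl i | inr v => inr (Some v) end.
exists (Imp (Imp (formula_rename p f) (Imp (Eq (Var L (inl i)) (Var L (inr None))) (Bot L _)))
  (Bot L _)).
move=> T S v a; apply/funext => x; apply/propext => /=; rewrite holds_rename.
have -> : tcat x (ocons a v) \o f = tcat x v by apply/funext => -[].
split; last by move=> [hp xa] h; exact: h.
move=> h; apply: contrapT => k; apply: h => hp xa; exact: k.
Qed.

(** Elimination of infinity, once for each entry of [s]. Having the same [q] in all models is what
    brings largeness back from an elementary extension in [morley_large_along]. *)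
Lemma large_along_uniform (L : language) (T : Type) (S : structure L T) : eliminates_infinity
  S ->
  forall (I : finType) (s : seq I) V (p : formula L (I + V)),
  exists q : formula L V, forall T' (S' : structure L T'), elem_equiv S S' ->
    forall v, holds S' q v <-> large_along s [set x | holds S' p (tcat x v)].
Proof.
move=> QS I; elim=> [|i s IH] V p.
  by have [q qP] := formula_exists_fin p; exists q => T' S' _ v; exact: qP.
have [p' p'P] := formula_slice i p.
have [q qP] := IH _ p'; have [q' q'P] := QS _ q.
exists q' => T' S' SS' v; rewrite q'P //=.
suff -> : [set a | holds S' q (ocons a v)] =
  [set a | large_along s [set x | holds S' p (tcat x v) /\ x i = a]] by [].
by apply/funext => a; apply/propext; rewrite /= qP // p'P.
Qed.

Lemma dfn_large_along (L : language) (T : Type) (S : structure L T) (A : set (eqelt T)) V (I :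
  finType)
    (s : seq I) (P : (V -> T) -> (I -> T) -> Prop) : eliminates_infinity S ->
  dfn S A (fun w : V + I -> T => P (w \o inl) (w \o inr)) ->
  dfn S A (fun v => large_along s [set x | P v x]).
Proof.
move=> QS [p pP].
pose f (k : (V + I) + pvar A) : I + (V + pvar A) := match k with
  | inl (inl v) => inr (inl v) | inl (inr j) => inl j | inr q => inr (inr q) end.
have [q qP] := large_along_uniform QS s (formula_rename p f).
exists q => r hr v; rewrite (qP _ _ (@elem_equiv_refl _ _ S)).
suff -> : [set x | P v x] = [set x | holds S (formula_rename p f) (tcat x (tcat v (pval r)))]
  by [].
apply/funext => x; apply/propext => /=; rewrite holds_rename.
have -> : tcat x (tcat v (pval r)) \o f = tcat (tcat v x) (pval r) by apply/funext => -[[]|].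
by rewrite -(pP r hr (tcat v x)).
Qed.

Lemma dfn_fix_coordinate (L : language) (T : Type) (S : structure L T) (A : set (eqelt T)) V
    (I : Type) (i : I) (X : set (V + I -> T)) : dfn S A X ->
  dfn S A [set w : option V + I -> T | X (tcat (w \o inl \o some) (w \o inr)) /\
    w (inr i) = w (inl None)].
Proof.
move=> Xd; apply: dfn_and; last exact: dfn_eq.
apply: (dfn_ren (f := fun k => match k with inl v => inl (Some v) | inr i => inr i end) Xd).
by move=> w; apply/funext => -[].
Qed.

Lemma dfn_large_slice (L : language) (T : Type) (S : structure L T) (A : set (eqelt T)) V
    (I : finType) (i : I) (s : seq I) (X : set (V + I -> T)) :
  eliminates_infinity S -> dfn S A X ->
  dfn S A (fun w : option V -> T =>
    large_along s [set x | X (tcat (w \o some) x) /\ x i = w None]).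
Proof. by move=> QS Xd; apply: dfn_large_along => //; exact: dfn_fix_coordinate. Qed.

Lemma reals_setU (T : Type) (A : set (eqelt T)) (C Y : set T) :
  A `|` reals C `|` reals Y = A `|` reals (C `|` Y).
Proof. by rewrite -setUA /reals image_setU. Qed.

(** * Dimension of tuples and of definable sets *)

Section Dim.
Variables (L : language) (T : Type) (S : structure L T).
Implicit Types (A : set (eqelt T)) (B C : set T).

Lemma dimE A C (I : finType) (a : I -> T) : dim S (A `|` reals C) a = mdim (acl_over S A) C a.
Proof.
apply: eq_bigl => J; congr asbool; apply/propext.
by split=> h j jJ; have := h j jJ; rewrite /acl_over reals_setU.
Qed.

Lemma dim_realsE C (I : finType) (a : I -> T) : dim S (reals C) a = mdim (acl_over S set0) C a.
Proof. by rewrite -dimE set0U. Qed.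

Lemma dim_baseE A (I : finType) (a : I -> T) : dim S A a = mdim (acl_over S A) set0 a.
Proof. by rewrite -dimE /reals image_set0 setU0. Qed.

Lemma dim_set_ge A (I : finType) (X : set (I -> T)) x : X x -> dim S A x <= dim_set S A X.
Proof.
move=> Xx; have lt : dim S A x < #|I|.+1 by rewrite dim_baseE ltnS mdim_card.
apply: (leq_bigmax_cond (F := fun d : 'I_#|I|.+1 => d : nat) (Ordinal lt)).
by apply/asboolP; exists x.
Qed.

Lemma dim_set_le A (I : finType) (X : set (I -> T)) n :
  (forall x, X x -> dim S A x <= n) -> dim_set S A X <= n.
Proof. by move=> h; apply/bigmax_leqP => d /asboolP[x /h + <-]. Qed.

Lemma dim_set_attained A (I : finType) (X : set (I -> T)) : X !=set0 ->
  exists2 x, X x & dim S A x = dim_set S A X.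
Proof.
move=> [x0 Xx0].
have lt : dim S A x0 < #|I|.+1 by rewrite dim_baseE ltnS mdim_card.
have P0 : `[< exists2 x, X x & dim S A x = Ordinal lt >] by apply/asboolP; exists x0.
rewrite /dim_set (bigmax_eq_arg (Ordinal lt)) //.
by case: arg_maxnP => // d /asboolP.
Qed.

Lemma mdim_acl_over_le A A' C C' (I : finType) (a : I -> T) :
  (forall D, acl_over S A (C `|` D) `<=` acl_over S A' (C' `|` D)) ->
  mdim (acl_over S A') C' a <= mdim (acl_over S A) C a.
Proof. by move=> h; apply: mdim_le => J hJ; apply: mdim_ge => j jJ /h; exact: hJ. Qed.

Lemma acl_over_sub A A' C : A `<=` A' -> acl_over S A C `<=` acl_over S A' C.
Proof. by move=> AA' b [X [Xd fX Xb]]; exists X; split => //; apply: dfn_sub Xd;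
  exact: setSU. Qed.

(** A class is fixed by any of its representatives, so a formula over [A] can be read as a formula
    over their coordinates, which are real elements. *)
Lemma acl_over_reps A (r : forall e : A, 'I_(eq_ar (val e)) -> T) C : reps r ->
  acl_over S A C `<=` acl_over S set0 (range (pval r) `|` C).
Proof.
move=> hr b [X [Xd fX Xb]].
have hE e : (A `|` reals C) e -> ~ A e -> {c | C c /\ real c = e}.
  by move=> h nA; apply/cid; case: h => // -[c Cc <-]; exists c.
pose rE (e : (A `|` reals C : set _)) : 'I_(eq_ar (val e)) -> T :=
  match pselect (A (val e)) with
  | left h => r (exist _ (val e) (mem_set h))
  | right h => fun=> sval (hE _ (set_mem (valP e)) h)
  end.
have hrE : reps rE.
  move=> e; rewrite /rE; case: pselect => h; first exact: (hr (exist (fun x => x \in A) _ _)).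
  by apply: real_class; have [] := svalP (hE _ (set_mem (valP e)) h).
have [X0 [X0d XX0]] := reals_dfn Xd hrE.
apply: (@acl_over_intro _ _ S set0 _ (pvar (A `|` reals C))
   (fun w => X0 (tcat (fun=> w None) (w \o some))) (pval rE)).
- by apply: (dfn_ren (f := fun k => match k with inl _ => None | inr q => Some q end) X0d) => w;
    apply/funext => -[[]|].
- move=> [e i]; rewrite /pval /rE /=; case: pselect => h; last first.
    by right; have [] := svalP (hE _ (set_mem (valP e)) h).
  by left; exists (existT _ (exist (fun x => x \in A) (val e) (mem_set h)) i).
- apply: sub_finite_set (finite_image (fun y => y tt) fX) => x /= /XX0 Xx.
  by exists (fun=> x).
- exact/(XX0 (fun=> b)).
Qed.

Hypotheses (QS : eliminates_infinity S) (exS : acl_exchange S) (satS : aleph1_saturated S).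
Let pg0 : pregeometry (acl_over S set0).
Proof. by apply: acl_over_pregeometry => //; exact: countable0. Qed.

(** If only finitely many values of the first coordinate had a large slice, the value at [x] would
    be one of them, hence algebraic over [c], and the scan would not count it. *)
Lemma large_along_of_greedy_rank (I : finType) (s : seq I) V (X : set (V + I -> T)) (c : V ->
  T) (x : I -> T) :
  dfn S set0 X -> X (tcat c x) -> greedy_rank (acl_over S set0) (range c) (map x s) = size s ->
  large_along s [set x | X (tcat c x)].
Proof.
elim: s V X c => [|i s IH] V X c Xd Xx /=; first by exists x.
have [//|nx /= /eqP] := asboolP (acl_over S set0 (range c) (x i)).
  by move=> _ e; have := greedy_rank_size (acl_over S set0) (range c `|` [set x i]) (map x s);
  rewrite -[X in X <= _]add0n e size_map ltnn.
rewrite add1n eqSS => /eqP hs.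
have slice_d := dfn_large_slice i s QS Xd.
move=> fin; apply: nx.
apply: (acl_over_intro slice_d (c := c)) => //.
pose X' := [set w : option V + I -> T | X (tcat (w \o inl \o some) (w \o inr)) /\
  w (inr i) = w (inl None)].
have : large_along s [set y | X' (tcat (ocons (x i) c) y)].
  apply: IH => //.
    exact: dfn_fix_coordinate.
  rewrite -hs; congr greedy_rank; apply/seteqP; split=> y.
    by move=> [[v|] _ <-]; [left; exists v|right].
  by move=> [[v _ <-]|->]; [exists (Some v)|exists None].
exact.
Qed.

(** Saturation supplies the coordinates one after the other, each transcendental over [B] and the
    earlier ones. *)
Lemma greedy_rank_of_large_along (I : finType) (s : seq I) V (X : set (V + I -> T)) (c : V ->
  T) B :
  dfn S set0 X -> large_along s [set x | X (tcat c x)] -> countable B -> range c `<=` B ->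
  exists2 x, X (tcat c x) & greedy_rank (acl_over S set0) B (map x s) = size s.
Proof.
elim: s V X c B => [|i s IH] V X c B Xd /=; first by move=> [x Xx]; exists x.
move=> inf cB cBc.
have slice_d := dfn_large_slice i s QS Xd.
have [||a /= Ra na] := saturated_transcendental (c := c) satS slice_d cB.
- by move=> v; apply: cBc; exists v.
- by [].
pose X' := [set w : option V + I -> T | X (tcat (w \o inl \o some) (w \o inr)) /\
  w (inr i) = w (inl None)].
have [|||x [Xx /= xa] hs] := IH _ X' (ocons a c) (B `|` [set a]) _ Ra.
- exact: dfn_fix_coordinate.
- by apply: countable_setU => //; exact: countable1.
- by move=> _ [[v|] _ <-]; [left; apply: cBc; exists v|right].
exists x => //; rewrite xa hs asboolF ?add1n // => h; apply: na.
by move: h; rewrite /acl_over set0U.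
Qed.

(** Largeness along independent coordinates of [x] does not refer to a base, so it yields points
    equally independent over any countable [B]. This is the source of generic points of M. *)
Lemma dim_transfer (I : finType) (X : set (I -> T)) x B : dfn S set0 X -> X x -> countable B ->
  exists2 y, X y & mdim (acl_over S set0) set0 x <= mdim (acl_over S set0) B y.
Proof.
move=> Xd Xx cB; rewrite (mdim_greedy_rank pg0).
have [s [ss e1 <-]] := greedy_rank_subseq pg0 set0 x (enum I).
pose X' := [set w : void + I -> T | X (w \o inr)].
pose c (k : void) : T := match k with end.
have X'd : dfn S set0 X' by apply: (dfn_ren (f := inr) Xd).
have rc : range c = set0 by apply/seteqP; split=> // y [[]].
have RX : large_along s [set y | X' (tcat c y)] by apply: large_along_of_greedy_rank X'd Xx _;
  rewrite rc.
have [|y Xy hy] := greedy_rank_of_large_along X'd RX cB; first by rewrite rc.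
by exists y => //; apply: greedy_rank_le_mdim => //; exact: subseq_uniq ss (enum_uniq _).
Qed.

End Dim.

(** * Morley rank in strongly minimal structures *)

(* A has at least n elements, in a form that is first order. *)
Fixpoint at_least (T : Type) (n : nat) (A : set T) : Prop :=
  if n is n'.+1 then exists a, A a /\ at_least n' [set x | A x /\ x <> a] else True.

Lemma at_least_size (T : Type) n (A : set T) (s : seq {classic T}) :
  A `<=` [set x | (x : {classic T}) \in s] -> at_least n A -> n <= size s.
Proof.
elim: n A s => // n IH A s As [a [Aa h]].
have sa : (a : {classic T}) \in s := As a Aa.
have : n <= size (rem (a : {classic T}) s).
  apply: IH h => x [/As /= xs xa]; apply: rem_mem => //; exact/eqP.
by rewrite size_rem //; case: s sa {As}.
Qed.

Lemma infinite_at_least (T : Type) n (A : set T) : infinite_set A -> at_least n A.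
Proof.
elim: n A => //= n IH A infA; have [a Aa] := infinite_setN0 infA.
exists a; split => //; apply: IH; have -> : [set x | A x /\ x <> a] = A `\` [set a] by [].
exact: infinite_setD.
Qed.

Lemma not_at_least_cover (T : Type) n (A : set T) : ~ at_least n A ->
  exists s : seq {classic T}, size s < n /\ A `<=` [set x | (x : {classic T}) \in s].
Proof.
elim: n A => //= n IH A h; have [[a Aa]|A0] := pselect (A !=set0); last first.
  by exists [::]; split=> // x Ax; case: A0; exists x.
have [|s [ss As]] := IH [set x | A x /\ x <> a]; first by move=> k; apply: h; exists a.
exists ((a : {classic T}) :: s); split => // x Ax /=; rewrite inE.
by have [//|xa] := eqVneq (x : {classic T}) a; apply: As; split => //; exact: (elimN eqP xa).
Qed.

Lemma not_at_least_finite (T : Type) n (A : set T) : ~ at_least n A -> finite_set A.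
Proof. by move=> h; apply: contrapT => /(@infinite_at_least _ n). Qed.

Lemma finite_not_at_least (T : Type) (A : set T) : finite_set A -> exists n, ~ at_least n A.
Proof.
move=> /(@finite_seqP {classic T})[s ->]; exists (size s).+1 => /(@at_least_size _ _ _ s).
by rewrite ltnn => /(_ (fun x => id)).
Qed.

Lemma at_least_le (T : Type) n n' (A A' : set T) : n <= n' -> A `<=` A' -> at_least n' A ->
  at_least n A'.
Proof.
elim: n' n A A' => [|n' IH] [|n] A A' //= nn' AA' [a [Aa h]].
by exists a; split; [exact: AA'|apply: IH h => // x [/AA']].
Qed.

(** A point is coded by the positions of its coordinates in the lists. The number of codes depends
    on [n] and [I] alone, which gives [large_along_split] its uniform bound. *)
Lemma box_code (I : finType) (T : Type) (X : set (I -> T)) (s : I -> seq {classic T}) n :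
  (forall x i, X x -> (x i : {classic T}) \in s i) -> (forall i, size (s i) <= n) ->
  exists code : (I -> T) -> {ffun I -> 'I_n.+1}, forall x y, X x -> X y -> code x = code y ->
    x = y.
Proof.
move=> Xs sn; exists (fun x => [ffun i => inord (index (x i : {classic T}) (s i))]) => x y Xx
  Xy e.
apply/funext => i; have := congr1 (fun f : {ffun I -> 'I_n.+1} => nat_of_ord (f i)) e.
rewrite /= !ffunE !inordK; try by rewrite ltnS (leq_trans (index_size _ _)).
by move=> /(congr1 (nth (x i : {classic T}) (s i))); rewrite !nth_index //; exact: Xs.
Qed.

Lemma finite_box (I : finType) (T : Type) (X : set (I -> T)) :
  (forall i, finite_set [set x i | x in X]) -> finite_set X.
Proof.
move=> h; have /choice[s sP] : forall i, exists s : seq {classic T},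
    [set x i | x in X] = [set` s] by move=> i; apply/(@finite_seqP {classic T}).
have [||code codeP] := @box_code I T X s (\max_i size (s i)).
- move=> x i Xx; have : [set x i | x in X] (x i) by exists x.
  by rewrite sP.
- by move=> i; exact: (leq_bigmax (F := fun i => size (s i))).
have [[x0 Xx0]|X0] := pselect (X !=set0); last first.
  by have -> : X = set0 by apply/seteqP; split=> // x Xx; apply: X0; exists x.
pose dec c := if pselect (exists2 x, X x & code x = c) is left h then s2val (cid2 h) else x0.
apply: sub_finite_set (finite_image dec (@finite_finset _ setT)) => x Xx.
exists (code x) => //; rewrite /dec; case: pselect => [h'|[]]; last by exists x.
by case: cid2 => y Xy e /=; exact: codeP.
Qed.

Lemma infinite_inj (T : Type) (A : set T) : infinite_set A ->
  exists f : nat -> T, injective f /\ forall n, A (f n).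
Proof.
move=> /infiniteP /card_leP[f].
exists (fun n => val (f (exist _ n (mem_set I)))); split => [m n|n]; last exact: set_valP.
by move=> /val_inj /(inj (mem_set I) (mem_set I)) [].
Qed.

Section MorleyRank.
Variables (L : language) (T : Type) (S : structure L T).

(* Strong minimality as a property of the complete theory of S. *)
Definition uniformly_minimal : Prop :=
  (forall V (p : formula L (option V)), exists n, forall T' (S' : structure L T'),
    elem_equiv S S' -> forall v, ~ (at_least n [set a | holds S' p (ocons a v)] /\
      at_least n [set a | ~ holds S' p (ocons a v)])) /\
  infinite_set [set: T].

Lemma formula_at_least n V (p : formula L (option V)) : exists q : formula L V,
  forall T' (S' : structure L T') v,
    holds S' q v <-> at_least n [set a | holds S' p (ocons a v)].
Proof.
elim: n V p => [|n IH] V p; first by exists (Imp (Bot L V) (Bot L V)); move=> T1 S1 v;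
  split=> //= _ [].
pose f (k : option V) : option (option V) := if k is Some v then Some (Some v) else None.
have [q qP] := IH _ (Imp (Imp (formula_rename p f)
  (Eq (Var L None) (Var L (Some None)))) (Bot L _)).
exists (Imp (All (Imp p (Imp q (Bot L _)))) (Bot L _)) => T' S' v /=.
have E a : [set x | holds S' p (ocons x v) /\ x <> a] = [set x |
    (holds S' (formula_rename p f) (ocons x (ocons a v)) -> x = a) -> False].
  apply/funext => x; apply/propext => /=; rewrite holds_rename.
  have -> : ocons x (ocons a v) \o f = ocons x v by apply/funext => -[].
  split=> [[hp xa] h|h]; first exact: (xa (h hp)).
  by split; [apply: contrapT => k; apply: h => hp; case: (k hp)|move=> xa; apply: h].
split=> [h|[a [pa h]] k].
  apply: contrapT => k; apply: h => a pa /qP h; apply: k; exists a; split => //.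
  by rewrite E.
by apply: (k a pa); apply/qP; move: h; rewrite E.
Qed.

Hypothesis um : uniformly_minimal.

Lemma equiv_infinite T' (S' : structure L T') : elem_equiv S S' -> infinite_set [set: T'].
Proof.
move=> SS' /finite_not_at_least[n]; apply.
have [q qP] := formula_at_least n (Imp (Bot L (option void)) (Bot L _)).
have E T0 (S0 : structure L T0) v : [set a | holds S0 (Imp (Bot L (option void)) (Bot L _))
  (ocons a v)] =
  [set: T0] by apply/seteqP; split=> // a _ [].
pose v0 T0 (k : void) : T0 := match k with end.
have := (SS' q (v0 T) (v0 T')).1; rewrite !qP !E; apply.
by apply: infinite_at_least; case: um.
Qed.

Lemma minimal_infinity : eliminates_infinity S.
Proof.
move=> V p; have [n nP] := um.1 V p; have [q qP] := formula_at_least n p.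
exists q => T' S' SS' v; rewrite qP; split=> [h fin|]; last exact: infinite_at_least.
have : ~ at_least n [set a | ~ holds S' p (ocons a v)] by move=> k; apply: (nP _ _ SS' v).
move/not_at_least_finite => fin'; apply: (equiv_infinite SS').
have -> : [set: T'] = [set a | holds S' p (ocons a v)] `|` [set a | ~ holds S' p (ocons a v)].
  by apply/seteqP; split => // a _; case: (pselect (holds S' p (ocons a v))); [left|right].
by rewrite finite_setU.
Qed.

Lemma minimal_cofinite T' (S' : structure L T') V (p : formula L (option V)) v :
  elem_equiv S S' -> infinite_set [set a | holds S' p (ocons a v)] ->
  finite_set [set a | ~ holds S' p (ocons a v)].
Proof.
move=> SS' inf; have [n nP] := um.1 V p.
by apply: (@not_at_least_finite _ n) => k; apply: (nP _ _ SS' v); split=> //;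
  exact: infinite_at_least.
Qed.

Lemma minimal_at_least V (p : formula L (option V)) : exists n, forall T' (S' : structure L T'),
  elem_equiv S S' -> forall v, at_least n [set a | holds S' p (ocons a v)] ->
  infinite_set [set a | holds S' p (ocons a v)].
Proof.
have [n nP] := um.1 V p; exists n => T' S' SS' v h fin.
have : ~ at_least n [set a | ~ holds S' p (ocons a v)] by move=> k; apply: (nP _ _ SS' v).
move/not_at_least_finite => fin'; apply: (equiv_infinite SS').
have -> : [set: T'] = [set a | holds S' p (ocons a v)] `|` [set a | ~ holds S' p (ocons a v)].
  by apply/seteqP; split => // a _; case: (pselect (holds S' p (ocons a v))); [left|right].
by rewrite finite_setU.
Qed.

(* The disjoint sets Y k are large along s, so a generic choice of the coordinates in s is
   realised in all of them. Hence p has at least n points over it, and for n large some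
   further coordinate takes infinitely many values. *)
Lemma large_along_split (I : finType) (s : seq I) : forall V (p : formula L (I + V)), exists n,
  forall T' (S' : structure L T') v (Y : 'I_n -> set (I -> T')), elem_equiv S S' ->
  (forall k, [/\ definable S' (Y k),
    Y k `<=` [set x | holds S' p (tcat x v)] & large_along s (Y k)]) ->
  (forall k k', k <> k' -> Y k `&` Y k' = set0) ->
  exists i, large_along (rcons s i) [set x | holds S' p (tcat x v)].
Proof.
have QS := minimal_infinity.
elim: s => [|j s IH] V p.
  have /choice[q qP] : forall i, exists q : formula L (option V),
    forall T' (S' : structure L T'),
      elem_equiv S S' -> forall v a, holds S' q (ocons a v) <->
        large_along [::] [set x | holds S' p (tcat x v) /\ x i = a].
    move=> i; have [p' p'P] := formula_slice i p; have [q qP] := large_along_uniform QS [::] p'.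
    by exists q => T' S' SS' v a; rewrite qP // p'P.
  have /choice[n nP] := fun i => minimal_at_least (q i).
  (* One more than the number of codes from [box_code]: with that many disjoint nonempty sets,
     points of two of them would get the same code and coincide. *)
  pose n0 := \max_i n i; exists (n0.+1 ^ #|I|).+1 => T' S' v Y SS' YP Yd.
  pose X := [set x | holds S' p (tcat x v)].
  apply: contrapT => /forallNP h.
  have /choice[c cP] : forall i, exists c : seq {classic T'}, size c < n i /\
      [set a | holds S' (q i) (ocons a v)] `<=` [set x | (x : {classic T'}) \in c].
    move=> i; apply: not_at_least_cover => /(nP i _ _ SS' v) inf; apply: (h i) => /=.
    by apply: sub_infinite_set inf => a /qP; exact.
  have [x i Xx|i|code codeP] := @box_code I T' X c n0.
  - by have [_] := cP i; apply; apply/qP => //; exists x.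
  - have [/ltnW ci _] := cP i; apply: leq_trans ci _.
    exact: (leq_bigmax (F := n)).
  have /choice[y yP] : forall k, exists y, Y k y by move=> k; have [_ _ [y Yy]] := YP k;
    exists y.
  have yX k : X (y k) by have [_ YX _] := YP k; apply: YX; exact: yP.
  have /leq_card : injective (code \o y).
    move=> k k' /= /codeP e; apply: contrapT => kk'.
    have := Yd _ _ kk'; rewrite -subset0; apply; split; first exact: yP.
    by rewrite e //; exact: yP.
  by rewrite card_ffun !card_ord ltnn.
have [p' p'P] := formula_slice j p; have [n nP] := IH _ p'.
exists n => T' S' v Y SS' YP Yd.
pose X := [set x | holds S' p (tcat x v)].
pose Z k := [set a | large_along s [set x | Y k x /\ x j = a]].
have cofin k : finite_set (~` Z k).
  have [[pk pkY] _ /= inf] := YP k.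
  have [pk' pk'P] := formula_slice j pk; have [q qP] := large_along_uniform QS s pk'.
  have E a : holds S' q (ocons a id) <-> Z k a.
    rewrite qP // pk'P /Z /=.
    suff -> : [set x | holds S' pk (tcat x id) /\ x j = a] = [set x | Y k x /\ x j = a] by [].
    by apply/funext => x; apply/propext => /=; rewrite pkY.
  have inf' : infinite_set [set a | holds S' q (ocons a id)].
    by apply: sub_infinite_set inf => a /E.
  by apply: sub_finite_set (minimal_cofinite SS' inf') => a nZ /E.
(* Each [Z k] is cofinite by minimality, and there are finitely many of them, so [W] is cofinite as
   well. *)
pose W := [set a | forall k, Z k a].
have infW : infinite_set W.
  move=> fin; apply: (equiv_infinite SS').
  apply: (@sub_finite_set _ _ (W `|` \bigcup_k (~` Z k))).
    move=> a _; have [aW|/existsNP[k nZ]] := pselect (W a); first by left.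
    by right; exists k.
  by rewrite finite_setU; split=> //; apply: bigcup_finite => // ; exact: finite_finset.
have Wi a : W a -> exists i, large_along (rcons s i) [set x | X x /\ x j = a].
  move=> Wa; have [||i Ri] := nP _ S' (ocons a v) (fun k => [set x | Y k x /\ x j = a]) SS'.
  - move=> k; have [[pk pkY] YX _] := YP k; split; last exact: Wa.
      have [pk' pk'P] := formula_slice j pk.
      pose f (z : I + option T') : I + T' := match z with
        | inl i => inl i | inr None => inr a | inr (Some t) => inr t end.
      exists (formula_rename pk' f) => x; rewrite holds_rename.
      have -> : tcat x id \o f = tcat x (ocons a id) by apply/funext => -[|[]].
      have /(congr1 (fun A : set _ => A x)) /= -> := pk'P _ S' id a.
      by rewrite -pkY.
    by rewrite p'P => x [/YX].
  - by move=> k k' /Yd e; apply/seteqP; split=> // x [[Yk _] [Yk' _]]; rewrite -e.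
  by exists i; move: Ri; rewrite p'P.
(* The extra coordinate may vary with [a]; as there are finitely many coordinates, one of them
   serves infinitely many [a]. *)
apply: contrapT => /forallNP h; apply: infW.
apply: (@sub_finite_set _ _ (\bigcup_i [set a | large_along (rcons s i) [set x | X x /\ x j =
  a]])).
  by move=> a /Wi[i Ri]; exists i.
apply: bigcup_finite => [|i _]; first exact: finite_finset.
by have /contrapT := h i.
Qed.

Lemma definable_holds T' (S' : structure L T') (I : finType) V (p : formula L (I + V)) v :
  definable S' [set x | holds S' p (tcat x v)].
Proof.
exists (formula_rename p (fun k => match k with inl i => inl i | inr w => inr (v w) end)) => x.
rewrite holds_rename.
by have -> : tcat x id \o (fun k => match k with inl i => inl i | inr w => inr (v w) end) =
  tcat x v
  by apply/funext => -[].
Qed.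

Lemma elem_embedding_equiv T1 (S1 : structure L T1) T2 (S2 : structure L T2) h :
  elem_embedding S1 S2 h -> elem_equiv S S1 -> elem_equiv S S2.
Proof.
move=> h12 SS1 p v v2; pose v1 (k : void) : T1 := match k with end.
rewrite (SS1 p v v1) (h12 _ p v1).
by have -> : h \o v1 = v2 by apply/funext => -[].
Qed.

(** The disjoint subsets may be large along different sequences, but there are finitely many
    sequences of length [n], so infinitely many subsets share one and [large_along_split] applies to
    a finite number of these. It applies in the extension; the uniform formula for largeness returns
    the result to [S']. *)
Lemma morley_large_along n T' (S' : structure L T') (I : finType) (X : set (I -> T')) :
  elem_equiv S S' -> morley_ge n S' X -> exists2 s : seq I, size s = n & large_along s X.
Proof.
elim: n T' S' X => [|n IH] T' S' X SS' /=; first by exists [::].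
move=> [T2 [S2 [h [h2 [p [pX [Y [YP Yd]]]]]]]].
have SS2 := elem_embedding_equiv h2 SS'.
have /choice[c cP] : forall k, exists c : n.-tuple I, large_along c (Y k).
  move=> k; have [_ _ /(IH _ _ _ SS2)[s /eqP ss Rs]] := YP k.
  by exists (Tuple ss).
have [s infs] : exists s : n.-tuple I, infinite_set [set k | c k = s].
  apply: contrapT => /forallNP H; apply: infinite_nat.
  apply: (@sub_finite_set _ _ (\bigcup_s [set k | c k = s])); first by move=> k _; exists (c k).
  by apply: bigcup_finite => [|s _]; [exact: finite_finset|have /contrapT := H s].
have [f [finj fs]] := infinite_inj infs.
have [N NP] := large_along_split s p.
have [||i Ri] := NP _ S2 h (fun k : 'I_N => Y (f k)) SS2.
- by move=> k; have [Y1 Y2 _] := YP (f k); split=> //; rewrite -(fs k).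
- by move=> k k' kk'; apply: Yd => /finj /val_inj.
exists (rcons s i); first by rewrite size_rcons size_tuple.
have [q qP] := large_along_uniform minimal_infinity (rcons s i) p.
have /qP/(_ _) h3 := SS2; have := h2 _ q id; rewrite qP //.
have -> : X = [set x | holds S' p (tcat x id)] by apply/funext => x; apply/propext.
by move=> ->; apply/qP.
Qed.

(** The slices at infinitely many values of the first coordinate in [s] are disjoint and definable,
    so the identity can serve as the elementary embedding. *)
Lemma large_along_morley T' (S' : structure L T') (I : finType) (X : set (I ->
  T')) (s : seq I) :
  definable S' X -> large_along s X -> morley_ge (size s) S' X.
Proof.
elim: s X => //= i s IH X [p pX] /infinite_inj[a [ainj aP]].
exists T', S', id; split; first by move=> V q v.
exists p; split => //; exists (fun k => [set x | X x /\ x i = a k]); split.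
  have dfs k : definable S' [set x | X x /\ x i = a k].
    have [p' p'P] := formula_slice i p.
    have -> : [set x | X x /\ x i = a k] = [set x | holds S' p' (tcat x (ocons (a k) id))].
      by rewrite p'P; apply/funext => x; apply/propext; rewrite /= pX.
    exact: definable_holds.
  by move=> k; split=> //; [move=> x [/pX hx _]; exact: hx|exact: IH (dfs k) (aP k)].
by move=> k l kl; apply/seteqP; split=> // x [[_ e] [_ e']]; apply: kl; apply: ainj; rewrite -e.
Qed.

End MorleyRank.

Lemma option_support (L : language) V (p : formula L (option V)) :
  exists (J : finType) (g : J -> V) (q : formula L (option J)),
    forall T (S : structure L T) v a, holds S p (ocons a v) <-> holds S q (ocons a (v \o g)).
Proof.
have [J [g [q pq]]] := formula_support p.
exists {k | g k}, (osome (g := g)), (formula_rename q (fun k => insub k)) => T S v a.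
rewrite pq holds_rename.
suff -> : ocons a v \o g = ocons a (v \o osome (g := g)) \o (fun k => insub k) by [].
by apply/funext => k /=; rewrite -(osomeE g k); case: (insub k).
Qed.

Lemma bounded_index (T : Type) (F : set T) (f : nat -> T) :
  finite_set F -> F `<=` range f -> exists n, forall x, F x -> exists2 k, k <= n & f k = x.
Proof.
move=> fF Ff; have h x : exists k, F x -> f k = x.
  by have [/Ff[k _ <-]|nF] := pselect (F x); [exists k|exists 0].
have [g gP] := choice h.
have /(@finite_seqP nat)[s sP] := finite_image g fF.
exists (\max_(k <- s) k) => x Fx; exists (g x); last exact: gP.
have : [set g x | x in F] (g x) by exists x.
by rewrite sP => gs; exact: (leq_bigmax_seq (F := id)).
Qed.

(** [aleph1_saturated] concerns types in one variable. The coordinates are therefore fixed one at a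
    time; [s] lists those still to be chosen, and [v0] holds the chosen values. *)
Lemma saturated_sequence (L : language) (T : Type) (S : structure L T) (V : finType)
    (X : nat -> set (V -> T)) :
  aleph1_saturated S -> (forall n, dfn S set0 (X n)) -> (forall n, X n.+1 `<=` X n) ->
  (forall n, X n !=set0) -> exists v, forall n, X n v.
Proof.
move=> satS Xd Xdec Xne.
have dec m n : m <= n -> X n `<=` X m.
  elim: n => [|n IH]; first by rewrite leqn0 => /eqP ->.
  by rewrite leq_eqVlt ltnS => /orP[/eqP->//|/IH h x /Xdec /h].
suff key (s : seq V) v0 : (forall n, exists v, X n v /\ forall j, j \notin s -> v j = v0 j) ->
    exists v, forall n, X n v.
  have [v0 _] := Xne 0; apply: (key (enum V) v0) => n; have [v Xv] := Xne n.
  by exists v; split=> // j; rewrite mem_enum.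
elim: s v0 => [|i s IH] v0 h.
  exists v0 => n; have [v [Xv vv]] := h n.
  by have <- // : v = v0; apply/funext => j; exact: vv.
pose Y n := [set w : option V -> T | exists v, X n v /\ (v i = w None /\
  forall j, (j \notin i :: s -> v j = w (Some j)))].
have /choice[p pP] : forall n, exists p : formula L (option V), forall w, Y n w <-> holds S p w.
  move=> n; apply: dfn0_formula; apply: dfn_exfin; apply: dfn_and.
    exact: (dfn_ren (f := inr) (Xd n)).
  apply: dfn_and; first exact: dfn_eq.
  apply: dfn_all_idx => j; case: (j \notin i :: s).
    by apply: dfn_ext (@dfn_eq _ _ S set0 _ (inr j : option V + V) (inl (Some j))) => w;
      split=> [e _ //|]; exact.
  by apply: dfn_ext (@dfn_true _ _ S set0 _) => w; split.
have cB : countable (range v0).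
  by apply: finite_set_countable; apply: finite_image; exact: finite_finset.
have v0B j : range v0 (v0 j) by exists j.
pose f (k : option V) : unit + range v0 := match k with
  | None => inl tt | Some v => inr (exist _ (v0 v) (mem_set (v0B v))) end.
have fE a : tcat (fun=> a) val \o f = ocons a v0 by apply/funext => -[].
have [F fF FP|a aP] := satS _ cB (range (fun n => formula_rename (p n) f)).
  have [n nP] := bounded_index fF FP.
  have [v [Xv vv]] := h n; exists (v i) => phi /nP[k kn <-].
  apply/holds_rename; rewrite fE; apply/pP; exists v; split; first exact: dec Xv.
  by split=> // j /vv.
apply: (IH (fun j => if j == i then a else v0 j)) => n.
have : holds S (formula_rename (p n) f) (tcat (fun=> a) val) by apply: aP; exists n.
move=> /holds_rename; rewrite fE => /pP[v [Xv [vi vv]]]; exists v; split => // j js.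
have [->//|ji] := eqVneq j i.
by apply: vv; rewrite inE negb_or ji.
Qed.

(** * Dimension and rank in a relic *)

Section Relic.
Variables (LK : language) (K : Type) (SK : structure LK K).
Variables (LM : language) (m : nat) (D : set ('I_m -> K)) (SM : structure LM D).
Implicit Types (A : set (eqelt D)) (B C : set K).
Hypothesis H0 : preserves_0definable SK SM.

Lemma flat_inj (I : Type) (x y : I -> D) : flat x = flat y -> x = y.
Proof.
move=> e; apply/funext => i; apply: val_inj; apply/funext => j.
exact: (congr1 (fun f : I * 'I_m -> K => f (i, j)) e).
Qed.

Lemma flat_setP (I : Type) (X : set (I -> D)) x : flat_set X (flat x) <-> X x.
Proof. by split=> [[y Xy /flat_inj <-]|Xx] //; exists x. Qed.

(** The hypothesis on 0-definable sets gives no direct control over parameters. So parameters are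
    first turned into variables, the resulting 0-definable set is transferred, and the coordinates
    of the parameters are then read off representatives of the flattened classes. *)
Lemma dfn_flat A (I : finType) (X : set (I -> D)) :
  dfn SM A X -> dfn SK (flat_params A) (flat_set X).
Proof.
move=> [p pX]; have [J [g [q pq]]] := formula_support p.
have [p0 p0P] := dfn0_formula (H0 (dfn0_holds SM q)).
pose F (k : J * 'I_m) : I * 'I_m + pvar (flat_params A) := match g k.1 with
  | inl i => inl (i, k.2)
  | inr a => inr (existT (fun e : flat_params A => 'I_(eq_ar (val e)))
     (exist _ (flat_eqelt (val (tag a))) (mem_set (imageP (@flat_eqelt K m D) (set_mem (valP
       (tag a))))))
     (enum_rank (tagged a, k.2))) end.
have [p1 p1P] := dfn0_formula (H0 (@dfn_true _ _ SM set0 I)).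
exists (Imp (Imp (formula_rename p1 inl) (Imp (formula_rename p0 F) (Bot _ _))) (Bot _ _)) =>
  r hr z /=.
rewrite !holds_rename.
have -> : tcat z (pval r) \o inl = z by [].
have key x : flat x = z -> X x <-> holds SK p0 (tcat z (pval r) \o F).
  move=> xz.
  have hb (e : A) : {b | eq_class (val e) b /\
      forall k j, r (exist _ (flat_eqelt (val e))
        (mem_set (imageP (@flat_eqelt K m D) (set_mem (valP e))))) (enum_rank (k,
          j)) = val (b k) j}.
    apply/cid; have := hr (exist _ (flat_eqelt (val e))
        (mem_set (imageP (@flat_eqelt K m D) (set_mem (valP e))))).
    by move=> [b hb rb]; exists b; split=> // k j; rewrite -rb enum_rankK.
  pose rM (e : A) := sval (hb e).
  have hrM : reps rM by move=> e; have [] := svalP (hb e).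
  rewrite (pX rM hrM) pq; rewrite -p0P.
  suff -> : tcat z (pval r) \o F = flat (tcat x (pval rM) \o g) by rewrite flat_setP.
  apply/funext => -[j l] /=; rewrite /F /flat /=; case: (g j) => [i|[e k]] /=.
    by rewrite -xz.
  by have [_ <-] := svalP (hb e).
split=> [[x Xx xz] h|h].
  by apply: h; [apply/p1P; rewrite -xz; exists x|apply/key; first exact: xz].
have [x xz] : exists x : I -> D, flat x = z.
  apply: contrapT => k; case: h => /p1P[x _ xz] _; case: k; by exists x.
by exists x => //; apply/key => //; apply: contrapT => k; case: h => _ /k.
Qed.

Lemma definable_classes_params A : params SM A -> definable_classes SM A.
Proof.
move=> [_ h] e Ae; have [E [Er Es Et [a ae]]] := h e Ae.
split; first by exists a; rewrite ae; exact: Er.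
pose e' : A := exist _ e (mem_set Ae).
exists (formula_rename E (fun k => match k with
  | inl i => inr (existT (fun e : A => 'I_(eq_ar (val e))) e' i) | inr i => inl i end)) => r
    hr x.
rewrite holds_rename; have -> : tcat x (pval r) \o (fun k => match k with
  | inl i => inr (existT (fun e : A => 'I_(eq_ar (val e))) e' i) | inr i => inl i end) =
  tcat (r e') x by apply/funext => -[].
have := hr e'; rewrite /= ae /= => ar; split=> h1; first exact: Et (Es _ _ ar) h1.
exact: Et ar h1.
Qed.

Lemma definable_classes_flat A : definable_classes SM A -> definable_classes SK (flat_params A).
Proof.
move=> gA _ [e Ae <-]; have [[b eb] ed] := gA e Ae; split.
  by exists (fun k => flat b (enum_val k)), b.
have : dfn SK (flat_params A) (fun z : 'I_#|{: 'I_(eq_ar e) * 'I_m}| -> K =>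
    flat_set (eq_class e) (z \o enum_rank)).
  exact: (dfn_ren (f := enum_rank) (dfn_flat ed)).
apply: dfn_ext => z; split=> [[x ex xz]|[x ex <-]]; exists x => //.
  by rewrite xz; apply/funext => k /=; rewrite enum_valK.
by apply/funext => k /=; rewrite enum_rankK.
Qed.

Lemma countable_flat A : countable A -> countable (flat_params A).
Proof.
exact: card_le_trans (card_image_le _ _).
Qed.

Hypotheses (QK : eliminates_infinity SK) (exK : acl_exchange SK) (satK : aleph1_saturated SK).
Hypotheses (Hsm : strongly_minimal SM) (infD : infinite_set [set: D]).

(* The uniform bound on the smaller of a definable set and its complement exists by
   saturation of K, and it is first order. *)
Lemma relic_minimal : uniformly_minimal SM.
Proof.
split=> // V p; have [J [g [q pq]]] := option_support p.
pose nq := Imp q (Bot LM _).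
pose X n := [set y : J -> D | at_least n [set a | holds SM q (ocons a y)] /\
  at_least n [set a | holds SM nq (ocons a y)]].
have formX n : exists c : formula LM J, forall T' (S' : structure LM T') y, holds S' c y <->
   at_least n [set a | holds S' q (ocons a y)] /\ at_least n [set a | holds S' nq (ocons a y)].
  have [q1 q1P] := formula_at_least n q; have [q2 q2P] := formula_at_least n nq.
  exists (Imp (Imp q1 (Imp q2 (Bot _ _))) (Bot _ _)) => T' S' y /=.
  rewrite -q1P -q2P; split=> [h|[h1 h2] h]; last exact: h.
  by split; apply: contrapT => k; apply: h => // h1 h2; exact: k.
have [n Xn] : exists n, X n = set0.
  apply: contrapT => /forallNP h.
  have [|||z zP] := @saturated_sequence _ _ SK (J * 'I_m)%type (fun n => flat_set (X n)) satK.
  - move=> n; apply: H0; have [c cP] := formX n.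
    by apply: dfn_ext (dfn0_holds SM c) => y; exact: cP.
  - move=> n _ [y [h1 h2] <-]; exists y => //.
    by split; [apply: at_least_le h1|apply: at_least_le h2].
  - by move=> n; have /eqP/set0P[y Xy] := h n; exists (flat y), y.
  have [y _ yz] := zP 0.
  have {}zP n : X n y by have [y' Xy' y'z] := zP n; have -> : y = y' by apply: flat_inj;
    rewrite yz.
  pose f (k : option J) : unit + D := if k is Some j then inr (y j) else inl tt.
  have fE (u : unit -> D) : tcat u id \o f = ocons (u tt) y by apply/funext => -[].
  have idE : elem_embedding SM SM id by move=> V' p' v.
  have [|fin|fin] := Hsm idE (X := [set u | holds SM q (ocons (u tt) y)]).
  - by exists (formula_rename q f) => u; rewrite holds_rename fE.
  - have /finite_not_at_least[n] : finite_set [set a | holds SM q (ocons a y)].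
      apply: sub_finite_set (finite_image (fun u => u tt) fin) => a qa.
      by exists (fun=> a).
    by apply; have [] := zP n.
  - have /finite_not_at_least[n] : finite_set [set a | holds SM nq (ocons a y)].
      apply: sub_finite_set (finite_image (fun u => u tt) fin) => a qa.
      by exists (fun=> a).
    by apply; have [] := zP n.
exists n => T' S' SS' v.
have [c cP] := formX n; have [d dP] := formula_exists_fin (formula_rename c (@inl J void)).
pose v0 T0 (k : void) : T0 := match k with end.
have E T0 (S0 : structure LM T0) : holds S0 d (v0 T0) <-> exists y, holds S0 c y.
  by rewrite dP; split=> -[y h]; exists y; [move/holds_rename: h|apply/holds_rename].
have nd : ~ holds S' d (v0 T').
  move=> /(SS' d (v0 D)) /E[y /cP]; rewrite -[_ /\ _]/(X n y) Xn.
  exact.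
move=> [h1 h2]; apply: nd; apply/E; exists (v \o g); apply/cP.
by split; [apply: at_least_le h1|apply: at_least_le h2] => // a /=; rewrite pq.
Qed.

Let um := relic_minimal.
Let QM : eliminates_infinity SM := minimal_infinity um.

Lemma pregeometry_flat A : params SM A -> pregeometry (acl_over SK (flat_params A)).
Proof.
move=> pA; apply: acl_over_pregeometry => //; first by apply: definable_classes_flat;
  exact: definable_classes_params.
by apply: countable_flat; case: pA.
Qed.

Lemma pregeometry0 : pregeometry (acl_over SK set0).
Proof. exact: acl_over_pregeometry. Qed.

Definition dim_relic := dim_set SK set0 D.

Lemma dfn_D : dfn SK set0 D.
Proof.
have := H0 (@dfn_true _ _ SM set0 unit); rewrite dfnE => h.
apply: dfn_ext (dfn_ren (f := snd) (t := fun z : 'I_m ->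
  K => fun k : unit * 'I_m => z k.2) h _) => // z.
split=> [[x _ xz]|Dz].
  have <- : val (x tt) = z by apply/funext => j; exact: (congr1 (fun f => f (tt, j)) xz).
  exact: set_valP.
by exists (fun=> exist _ z (mem_set Dz)).
Qed.

Lemma mdim_point (A : set (eqelt K)) C (a : D) : mdim (acl_over SK A) C (val a) <= dim_relic.
Proof.
apply: leq_trans (mdim_acl_over_le (A := set0) (C := set0) _ _) _.
  move=> E y h; apply: (acl_over_sub (@sub0set _ A)); apply: acl_over_mono h.
  by rewrite set0U; exact: subsetUr.
by rewrite -dim_baseE; apply: dim_set_ge; exact: set_valP.
Qed.

Lemma generic_point B : countable B ->
  exists a : D, mdim (acl_over SK set0) B (val a) = dim_relic.
Proof.
move=> cB; have [a0 _] := infinite_setN0 infD.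
have [|x Dx dx] := @dim_set_attained _ _ SK set0 _ D; first by exists (val a0); exact: set_valP.
have [y Dy dy] := dim_transfer QK exK satK dfn_D Dx cB.
exists (exist _ y (mem_set Dy)); apply/eqP; rewrite eqn_leq mdim_point /=.
by rewrite /dim_relic -dx dim_baseE.
Qed.

(** As [D] is infinite, some coordinate takes infinitely many values on it, and saturation makes one
    of these values transcendental. *)
Lemma dim_relic_gt0 : 0 < dim_relic.
Proof.
have [i infi] : exists i, infinite_set [set z i | z in D].
  apply: contrapT => /forallNP h.
  have fD : finite_set D by apply: finite_box => i; have /contrapT := h i.
  apply: infD; have [a0 _] := infinite_setN0 infD.
  apply: sub_finite_set (finite_image (fun z => if pselect (D z) is left h then
     exist _ z (mem_set h) else a0) fD) => a _.
  exists (val a); first exact: set_valP.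
  case: pselect => [h'|]; last by case; exact: set_valP.
  exact: val_inj.
pose X := [set w : option void -> K | exists z : 'I_m -> K, D z /\ z i = w None].
have Xd : dfn SK set0 X.
  apply: dfn_exfin; apply: dfn_and; first exact: (dfn_ren (f := inr) dfn_D).
  exact: dfn_eq.
have [||a [z [Dz zi]] na] := saturated_transcendental (B := set0)
  (c := fun k : void => match k with end) satK Xd (@countable0 _).
- by case.
- by apply: sub_infinite_set infi => _ [z Dz <-]; exists z.
apply: leq_trans (mdim_point set0 set0 (exist _ z (mem_set Dz))).
rewrite lt0n; apply/negP => /eqP /(mdim0_cl i) /=; rewrite zi /= => h; apply: na.
by move: h; rewrite /acl_over set0U.
Qed.

(** Algebraicity in M implies algebraicity in K of every coordinate. Ranks control dimensions
    through this fact. *)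
Lemma alg_point A (J : finType) (Y : set (option J -> D)) b a j : params SM A ->
  dfn SM A Y -> finite_set [set a | Y (ocons a b)] -> Y (ocons a b) ->
  acl_over SK (flat_params A) (range (flat b)) (val a j).
Proof.
move=> pA Yd fY Ya.
pose W := [set w : option (J * 'I_m) -> K | exists z : option J * 'I_m -> K, flat_set Y z /\
  ((forall k : J * 'I_m, z (Some k.1, k.2) = w (Some k)) /\ z (None, j) = w None)].
have Wd : dfn SK (flat_params A) W.
  apply: dfn_exfin; apply: dfn_and; first exact: (dfn_ren (f := inr) (dfn_flat Yd)).
  by apply: dfn_and; [apply: dfn_all_idx => k|]; exact: dfn_eq.
apply: (acl_over_intro Wd (c := flat b)).
- by move=> k; exists k.
- apply: sub_finite_set (finite_image (fun a => val a j) fY) => k.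
  move=> [_ [[y Yy <-] [yb yk]]]; exists (y None) => //=.
  suff -> : ocons (y None) b = y by [].
  apply/funext => -[i|//] /=; apply: val_inj; apply/funext => l.
  exact/esym/(yb (i, l)).
- by exists (flat (ocons a b)); split; [exists (ocons a b)|split].
Qed.

(** If fixing some coordinate of [x] lowers the rank, adjoin that coordinate at a cost of at most
    [dim_relic] and use induction. Otherwise each coordinate takes one of the finitely many values
    with a slice of rank n, so [x] is algebraic over [b]. *)
Lemma dim_le_rank A n : params SM A -> forall (I J : finType) (X : set (J + I -> D)) b x C,
  dfn SM A X -> X (tcat b x) ->
  (forall s, size s = n.+1 -> ~ large_along s [set x | X (tcat b x)]) ->
  range (flat b) `<=` C -> mdim (acl_over SK (flat_params A)) C (flat x) <= n * dim_relic.
Proof.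
move=> pA I; have pg := pregeometry_flat pA.
elim: n => [|n IH] J X b x C Xd Xx nR bC.
  rewrite leqn0; apply/eqP; apply: mdim0 => // -[i j].
  have Yd := dfn_large_slice i [::] QM Xd.
  case: pg => _ mono _ _; apply: mono bC _ _; rewrite /flat /=.
  apply: (alg_point _ pA Yd); last by exists x.
  by have /contrapT := nR [:: i] erefl.
have Xd' i := dfn_fix_coordinate i Xd.
have [[i hi]|/forallNP h] := pselect (exists i, forall s, size s = n.+1 ->
    ~ large_along s [set y | X (tcat b y) /\ y i = x i]).
  have le : mdim (acl_over SK (flat_params A)) (C `|` range (val (x i))) (flat x) <= n *
    dim_relic.
    apply: (IH _ _ (ocons (x i) b) x _ (Xd' i)).
    - by [].
    - exact: hi.
    - by move=> _ [[[k|] j] _ <-]; [left; apply: bC; exists (k, j)|right; exists j].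
  have e := mdim_sym pg C (val (x i)) (flat x).
  rewrite mulSn; apply: leq_trans (leq_add (mdim_point (flat_params A) C (x i)) le).
  by rewrite e leq_addr.
rewrite (mdim0 pg) // => -[i j].
have /existsNP[s /not_implyP[ss /contrapT Rs]] := h i.
have Yd := dfn_large_slice i s QM Xd.
case: pg => _ mono _ _; apply: mono bC _ _; rewrite /flat /=.
apply: (alg_point _ pA Yd); last exact: Rs.
have /contrapT := nR (i :: s) (f_equal S ss); exact.
Qed.

Lemma dfn_cofinite A V (Y : set (option V -> D)) b : definable_classes SM A -> dfn SM A Y ->
  infinite_set [set a | Y (ocons a b)] -> finite_set [set a | ~ Y (ocons a b)].
Proof.
move=> gA [p pY] inf; have [r hr] := reps_exist gA.
pose f (k : option V + pvar A) : option (V + pvar A) := match k with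
  | inl None => None | inl (Some v) => Some (inl v) | inr q => Some (inr q) end.
have E a : Y (ocons a b) <-> holds SM (formula_rename p f) (ocons a (tcat b (pval r))).
  rewrite holds_rename (pY r hr).
  by have -> : ocons a (tcat b (pval r)) \o f = tcat (ocons a b) (pval r) by apply/funext =>
    -[[]|].
have inf' : infinite_set [set a | holds SM (formula_rename p f) (ocons a (tcat b (pval r)))].
  by apply: sub_infinite_set inf => a /E.
by apply: sub_finite_set (minimal_cofinite um (@elem_equiv_refl _ _ SM) inf') => a /= nY /E.
Qed.

(** Choose each coordinate in [s] generic in M over all that precedes. The values with a large slice
    are cofinite by minimality, and a generic value avoids the finite exceptional set, whose points
    are algebraic. *)
Lemma dim_ge_rank A B : params SM A ->
  (forall C, acl_over SK (flat_params A) C `<=` acl_over SK set0 (B `|` C)) ->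
  forall (I : finType) (s : seq I) (J : finType) (X : set (J + I -> D)) b B',
  dfn SM A X -> large_along s [set x | X (tcat b x)] -> countable B' -> B `<=` B' ->
  range (flat b) `<=` B' ->
  exists2 x, X (tcat b x) & size s * dim_relic <= mdim (acl_over SK set0) B' (flat x).
Proof.
move=> pA hB I; have pg := pregeometry0.
elim=> [|i s IH] J X b B' Xd; first by move=> [x Xx] *; exists x.
move=> inf cB' BB' bB'.
have Yd := dfn_large_slice i s QM Xd.
have [a da] := generic_point cB'.
have Ra : large_along s [set x | X (tcat b x) /\ x i = a].
  apply: contrapT => nR.
  have fin := dfn_cofinite (definable_classes_params pA) Yd (b := b) inf.
  have : mdim (acl_over SK set0) B' (val a) = 0.
    apply: mdim0 => // j; have /hB := alg_point j pA (dfn_not Yd) fin nR.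
    by case: pg => _ mono _ _; apply: mono; rewrite subUset.
  by rewrite da; apply/eqP; rewrite -lt0n dim_relic_gt0.
have Xd' := dfn_fix_coordinate i Xd.
have [||||x [Xx /= xa] dx] := IH _ _ (ocons a b) (B' `|` range (val a)) Xd'.
- exact: Ra.
- apply: countable_setU => //; apply: finite_set_countable; apply: finite_image.
  exact: finite_finset.
- by move=> y /BB'; left.
- by move=> _ [[[k|] j] _ <-]; [left; apply: bB'; exists (k, j)|right; exists j].
exists x => //; have := mdim_sym pg B' (val a) (flat x).
rewrite [mdim _ (B' `|` range (flat x)) _](mdim0 pg) ?addn0.
  by move=> <-; rewrite da /= mulSn leq_add2l.
move=> j; case: pg => ext _ _ _; apply: ext; right; exists (i, j) => //.
by rewrite /flat /= xa.
Qed.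

End Relic.

(** * Largeness, Morley rank of sets and rank of tuples *)

Definition large (T I : Type) (n : nat) (X : set (I -> T)) : Prop :=
  exists2 s : seq I, size s = n & large_along s X.

Lemma large_le (T I : Type) n n' (X : set (I -> T)) : n <= n' -> large n' X -> large n X.
Proof.
elim: n' => [|n' IH]; first by rewrite leqn0 => /eqP ->.
rewrite leq_eqVlt ltnS => /orP[/eqP -> //|/IH h [[|i s]] //= [ss] /infinite_setN0[a Ra]].
by apply: h; exists s => //; apply: large_along_mono Ra => x [].
Qed.

Lemma large_mono (T I : Type) n (X Y : set (I -> T)) : X `<=` Y -> large n X -> large n Y.
Proof. by move=> XY [s ss Rs]; exists s => //; exact: large_along_mono Rs. Qed.

Lemma large1P (T I : Type) (X : set (I -> T)) : large 1 X <-> exists i, large_along [:: i] X.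
Proof.
split=> [[[|i []] // _ h]|[i h]]; first by exists i.
by exists [:: i].
Qed.

Lemma large1_infinite (T I : Type) (X : set (I -> T)) : large 1 X -> infinite_set X.
Proof.
move=> /large1P[i inf] fX; apply: inf;
  apply: sub_finite_set (finite_image (fun x => x i) fX) => a.
by move=> [x [Xx <-]]; exists x.
Qed.

Lemma large_along_cat (T I1 I : Type) (f : I1 -> I) s1 s2 (X1 : set (I1 -> T)) (X : set (I ->
  T)) :
  large_along s1 X1 -> (forall w, X1 w -> large_along s2 [set z | X z /\ z \o f = w]) ->
    large_along (map f s1 ++ s2) X.
Proof.
elim: s1 X1 X => [|i s1 IH] X1 X /=; first by move=> [w Xw] /(_ w Xw);
  apply: large_along_mono => z [].
move=> inf h; apply: sub_infinite_set inf => a /= Ra; apply: IH Ra _ => w [X1w wi].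
by apply: large_along_mono (h w X1w) => z [Xz zw]; split=> //; split=> //; rewrite -wi -zw.
Qed.

Lemma large_along_map (T I1 I : Type) (f : I1 -> I) s (X1 : set (I1 -> T)) (X : set (I -> T)) :
  large_along s X1 -> (forall w, X1 w -> exists z, X z /\ z \o f = w) ->
    large_along (map f s) X.
Proof. by move=> R h; rewrite -[map f s]cats0; apply: large_along_cat R _ => w /h[z hz];
  exists z. Qed.

Lemma last_true (P : nat -> Prop) n : P 0 -> ~ P n -> exists k, P k /\ ~ P k.+1.
Proof.
move=> P0; elim: n => [//|n IH] nP; have [Pn|/IH//] := pselect (P n).
by exists n.
Qed.

Section SliceRank.
Variables (L : language) (T : Type) (S : structure L T).
Hypothesis um : uniformly_minimal S.
Hypothesis bounded : forall (I : finType) (X : set (I -> T)),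
  definable S X -> exists n, ~ large n X.

Lemma dfn_definable A (I : finType) V (X : set (V + I -> T)) b : definable_classes S A ->
  dfn S A X -> definable S [set x | X (tcat b x)].
Proof.
move=> gA [p pX]; have [r hr] := reps_exist gA.
exists (formula_rename p (fun k => match k with inl (inl v) => inr (b v) | inl (inr i) => inl i
  | inr q => inr (pval r q) end)) => x.
rewrite holds_rename /= (pX r hr).
suff -> : tcat (tcat b x) (pval r) = tcat x id \o (fun k => match k with
  | inl (inl v) => inr (b v) | inl (inr i) => inl i | inr q => inr (pval r q) end) by [].
by apply/funext => -[[]|].
Qed.

Lemma dfn_definable0 A (I : finType) (X : set (I -> T)) : definable_classes S A ->
  dfn S A X -> definable S X.
Proof.
move=> gA Xd; pose b (k : void) : T := match k with end.
have h : dfn S A (fun w : void + I -> T => X (w \o inr)) by exact: (dfn_ren (f := inr) Xd).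
exact: (dfn_definable b gA h).
Qed.

Lemma morley_geE (I : finType) (X : set (I -> T)) n : definable S X ->
  morley_ge n S X <-> large n X.
Proof.
move=> dX; split; first by move/(morley_large_along um (@elem_equiv_refl _ _ S))=> [s ss Rs];
  exists s.
by move=> [s <- Rs]; exact: large_along_morley.
Qed.

Lemma morleyE (I : finType) (X : set (I -> T)) n : definable S X ->
  morley S X n <-> large n X /\ ~ large n.+1 X.
Proof. by move=> dX; rewrite /morley !morley_geE. Qed.

Lemma morley_exists (I : finType) (X : set (I -> T)) : definable S X -> X !=set0 ->
  exists n, morley S X n.
Proof.
move=> dX X0; have [n nR] := bounded dX.
have [|k hk] := @last_true (fun n => large n X) n _ nR; first by exists [::].
by exists k; apply/morleyE.
Qed.

(** Definable sets have finite rank by [bounded], so a least rank exists and the default value in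
    [rk] is never taken. *)
Lemma rkP A (I : finType) (x : I -> T) : definable_classes S A ->
  (exists X : set (I -> T), [/\ dfn S A X, X x & morley S X (rk S A x)]) /\
  (forall X : set (I -> T), dfn S A X -> X x -> morley_ge (rk S A x) S X).
Proof.
move=> gA; rewrite /rk; set P := [set n | _].
suff : exists n, P n by move=> /(xgetPex 0).
pose Q n := `[< exists X : set (I -> T), [/\ dfn S A X, X x & morley S X n] >].
have exQ : exists n, Q n.
  have d := @dfn_true _ _ S A I.
  have [n hn] := morley_exists (dfn_definable0 gA d) (ex_intro _ x Logic.I).
  by exists n; apply/asboolP; exists (fun=> True).
exists (ex_minn exQ); case: ex_minnP => n /asboolP h nmin; split => // X Xd Xx.
have dX := dfn_definable0 gA Xd.
have [k hk] := morley_exists dX (ex_intro _ x Xx).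
have /nmin nk : Q k by apply/asboolP; exists X.
by apply/morley_geE => //; apply: large_le nk _; move/morleyE: hk => /(_ dX)[].
Qed.

Lemma rk_ge A (I : finType) (x : I -> T) n : definable_classes S A ->
  (forall X : set (I -> T), dfn S A X -> X x -> large n X) -> n <= rk S A x.
Proof.
move=> gA h; have [[X [Xd Xx mX]] _] := rkP x gA.
have [_ nR] := (morleyE _ (dfn_definable0 gA Xd)).1 mX; rewrite leqNgt; apply/negP => lt.
by apply: nR; apply: large_le lt _; exact: h.
Qed.

Lemma rk_le A (I : finType) (x : I -> T) n (X : set (I -> T)) : definable_classes S A ->
  dfn S A X -> X x -> ~ large n.+1 X -> rk S A x <= n.
Proof.
move=> gA Xd Xx nR; have [_ /(_ X Xd Xx)] := rkP x gA.
move=> /(morley_geE _ (dfn_definable0 gA Xd)) Rk; rewrite leqNgt; apply/negP => lt.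
by apply: nR; exact: large_le Rk.
Qed.

Lemma rk_large A (I : finType) (x : I -> T) (X : set (I -> T)) n : definable_classes S A ->
  dfn S A X -> X x -> n <= rk S A x -> large n X.
Proof.
move=> gA Xd Xx le; have [_ /(_ X Xd Xx)] := rkP x gA.
by move=> /(morley_geE _ (dfn_definable0 gA Xd)); exact: large_le.
Qed.

Lemma rk_diagonal A (y : T) : definable_classes S A ->
  rk S A (tcat (fun _ : unit => y) (fun _ : unit => y)) <= 1.
Proof.
move=> gA; apply: (@rk_le A _ _ 1 (fun z => z (inl tt) = z (inr tt))) => //.
  exact: dfn_eq.
move=> [[|i [|j []]] //= _] /infinite_setN0[a]; apply.
apply: sub_finite_set (finite_set1 a) => b [z [[e zi] <-]] /=; rewrite -zi.
by case: i {zi} => -[]; case: j => -[].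
Qed.

End SliceRank.

(** * Convergence in products *)

Lemma cvg_coordinates (Q : Type) (F : set_system Q) (N : Type) (K : topologicalType)
    (h : Q -> N -> K) (l : N -> K) {FF : Filter F} :
  (forall n, (fun q => h q n) @ F --> l n) -> h @ F --> l.
Proof.
move=> hl; apply/cvg_sup => n U [V] [[W oW <-] Wl WU].
apply: (filterS WU); apply: (hl n).
by apply: open_nbhs_nbhs; split.
Qed.

Lemma coordinate_continuous (N : eqType) (K : topologicalType) (n : N) :
  continuous (fun z : N -> K => z n).
Proof. exact: (@proj_continuous N (fun=> K)). Qed.

Lemma reindex_continuous (N : eqType) (N' : Type) (K : topologicalType) (f : N' -> N) :
  continuous (fun (z : N -> K) (n : N') => z (f n)).
Proof.
move=> z; apply: (@cvg_coordinates _ (nbhs z) _ _ _ _ (nbhs_filter z)) => n.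
exact: coordinate_continuous.
Qed.

Lemma large_along_reindex (T I I' : Type) (f : I -> I') (g : I' -> I) s (Z : set (I' -> T)) :
  (forall i, g (f i) = i) -> large_along s [set y : I -> T | Z (y \o g)] ->
    large_along (map f s) Z.
Proof.
move=> gf; elim: s Z => [|i s IH] Z /=; first by move=> [y Zy]; exists (y \o g).
apply: sub_infinite_set => a /= R; apply: IH; apply: large_along_mono R => y [Zy ya] /=.
by rewrite /= gf.
Qed.

(** * Rank and dimension for tuples and plane curves of the relic *)

Section RelicRank.
Variables (LK : language) (K : topologicalType) (SK : structure LK K).
Variables (LM : language) (m : nat) (D : set ('I_m -> K)) (SM : structure LM D).
Hypotheses (HK : hausdorff_geometric SK) (H0 : preserves_0definable SK SM).
Hypotheses (Hsm : strongly_minimal SM) (infD : infinite_set [set: D]).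
Implicit Types (A : set (eqelt D)) (B C : set K).

Let QK : eliminates_infinity SK := geometric_infinity (hg_geometric HK).
Let satK : aleph1_saturated SK := hg_saturated HK.

Lemma exchangeK : acl_exchange SK.
Proof. exact: (hg_geometric HK).1 (@elem_equiv_refl _ _ SK). Qed.
Let exK := exchangeK.

Lemma relic_uniformly_minimal : uniformly_minimal SM.
Proof. exact: relic_minimal H0 satK Hsm infD. Qed.

Lemma relic_infinity : eliminates_infinity SM.
Proof. exact: minimal_infinity relic_uniformly_minimal. Qed.

Lemma dfnT A (I : finType) : dfn SM A [set: I -> D].
Proof. exact: dfn_true. Qed.

Lemma params0 : params SM set0.
Proof. by split=> [|e]; [exact: countable0|case]. Qed.

Lemma flat_params0 : flat_params (@set0 (eqelt D)) = set0.
Proof. exact: image_set0. Qed.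

Definition acl_flat (A : set (eqelt D)) := acl_over SK (flat_params A).
Definition dim_flat A C (I : finType) (x : I -> D) := mdim (acl_flat A) C (flat x).

Lemma pregeometry_acl_flat A : params SM A -> pregeometry (acl_flat A).
Proof. exact: (pregeometry_flat H0 QK exK satK). Qed.

(** [B] consists of the coordinates of representatives of [A]. Points generic over [B] in K are then
    generic over the imaginary base [A] too. *)
Lemma base_exists A : params SM A -> exists B, countable B /\
  forall C, acl_flat A C `<=` acl_flat set0 (B `|` C).
Proof.
move=> pA; have [r hr] := reps_exist (definable_classes_flat H0 (definable_classes_params pA)).
exists (range (pval r)); split.
  by apply: countable_pvar; apply: countable_flat; case: pA.
by move=> C; rewrite /acl_flat flat_params0; exact: acl_over_reps.
Qed.

Lemma cl_base A C : acl_flat set0 C `<=` acl_flat A C.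
Proof. by apply: acl_over_sub; exact: image_subset. Qed.

Lemma dim_flatD A C (I J : finType) (x : I -> D) (y : J -> D) : params SM A ->
  dim_flat A C (tcat x y) = dim_flat A C x + dim_flat A (C `|` range (flat x)) y.
Proof.
move=> pA; have pg := pregeometry_acl_flat pA; have [ext _ _ _] := pg;
  rewrite /dim_flat -mdimD //.
apply/eqP; rewrite eqn_leq; apply/andP; split; apply: mdim_le_cl => // k; apply: ext; right.
  case: k => [[i|j] l]; [exists (inl (i, l))|exists (inr (j, l))] => //.
by case: k => [[i l]|[j l]]; [exists (inl i, l)|exists (inr j, l)].
Qed.

Lemma dim_flat_sym A C (I J : finType) (x : I -> D) (y : J -> D) : params SM A ->
  dim_flat A C x + dim_flat A (C `|` range (flat x)) y = dim_flat A C y + dim_flat A (C `|`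
    range (flat y)) x.
Proof. by move=> pA; rewrite /dim_flat mdim_sym //; exact: pregeometry_acl_flat. Qed.

Lemma dim_flat_mono A C C' (I : finType) (x : I -> D) : params SM A ->
  C `<=` C' -> dim_flat A C' x <= dim_flat A C x.
Proof. by move=> pA; apply: mdim_mono; exact: pregeometry_acl_flat. Qed.

Lemma dim_flat_sub A C (I J : finType) (x : I -> D) (y : J -> D) : params SM A ->
  range (flat y) `<=` range (flat x) -> dim_flat A C y <= dim_flat A C x.
Proof.
move=> pA yx; have pg := pregeometry_acl_flat pA; have [ext _ _ _] := pg;
  apply: mdim_le_cl => // k; apply: ext; right; apply: yx.
by exists k.
Qed.

Lemma dim_flat_eq0 A C (I : finType) (x : I -> D) : params SM A ->
  range (flat x) `<=` C -> dim_flat A C x = 0.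
Proof.
move=> pA xC; have pg := pregeometry_acl_flat pA; have [ext _ _ _] := pg; apply: mdim0 => // k.
by apply: ext; apply: xC; exists k.
Qed.

Lemma dim_flat_absorb A C (I J : finType) (x : I -> D) (y : J -> D) : params SM A ->
  dim_flat A C x = 0 -> dim_flat A (C `|` range (flat x)) y = dim_flat A C y.
Proof.
move=> pA x0; have := dim_flat_sym C x y pA; rewrite x0 add0n => ->.
suff -> : dim_flat A (C `|` range (flat y)) x = 0 by rewrite addn0.
apply/eqP; rewrite -leqn0 -x0; apply: dim_flat_mono => //; exact: subsetUl.
Qed.

Lemma range_pt (I : finType) (x : I ->
  D) i : range (flat (fun _ : unit => x i)) `<=` range (flat x).
Proof. by move=> _ [[u j] _ <-]; exists (i, j). Qed.

Lemma mdim_valE A C (a : D) : params SM A ->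
  mdim (acl_flat A) C (val a) = dim_flat A C (fun _ : unit => a).
Proof.
move=> pA; have pg := pregeometry_acl_flat pA; have [ext _ _ _] := pg.
apply/eqP; rewrite eqn_leq; apply/andP; split; apply: mdim_le_cl => // k; apply: ext; right.
  by exists (tt, k).
by exists k.2.
Qed.

Lemma dim_flat_pt A C (a : D) : params SM A ->
  dim_flat A C (fun _ : unit => a) <= dim_relic SK D.
Proof. by move=> pA; rewrite -mdim_valE //; exact: mdim_point. Qed.

Lemma dim_flat_le_seq A C (I : finType) (x : I -> D) (s : seq I) : params SM A ->
  (forall i, i \notin s -> range (val (x i)) `<=` C) ->
    dim_flat A C x <= size s * dim_relic SK D.
Proof.
move=> pA; elim: s C => [|i s IH] C h.
  by rewrite dim_flat_eq0 // => _ [[i j] _ <-]; apply: (h i) => //; exists j.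
have le := IH (C `|` range (flat (fun _ : unit => x i))).
have e := dim_flat_sym C (fun _ : unit => x i) x pA.
rewrite /= mulSn; apply: leq_trans (leq_add (dim_flat_pt C (x i) pA) (le _)).
  by rewrite e leq_addr.
move=> j js; have [->|ji] := eqVneq j i; first by move=> _ [k _ <-]; right; exists (tt, k).
by move=> y hy; left; apply: (h j) hy; rewrite inE negb_or ji.
Qed.

Lemma dim_flat_le_card A C (I : finType) (x : I -> D) : params SM A ->
  dim_flat A C x <= #|I| * dim_relic SK D.
Proof. by move=> pA; rewrite cardE; apply: dim_flat_le_seq => // i; rewrite mem_enum. Qed.

(** The other coordinates account for at most [#|I|.-1] times [dim_relic], so the remaining one has
    to supply a full [dim_relic]. *)
Lemma dim_flat_coordinate A (I : finType) (x : I -> D) i : params SM A ->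
  #|I| * dim_relic SK D <= dim_flat A set0 x ->
    dim_relic SK D <= dim_flat A set0 (fun _ : unit => x i).
Proof.
move=> pA h; have e := dim_flat_sym set0 (fun _ : unit => x i) x pA.
have z : dim_flat A (set0 `|` range (flat x)) (fun _ : unit => x i) = 0.
  by apply: dim_flat_eq0 => //; rewrite set0U; exact: range_pt.
rewrite z addn0 in e.
have : dim_flat A (set0 `|` range (flat (fun _ : unit => x i))) x <= size (enum (predC1 i)) *
  dim_relic SK D.
  apply: dim_flat_le_seq => // j; rewrite mem_enum inE negbK => /eqP -> _ [k _ <-].
  by right; exists (tt, k).
rewrite -cardE cardC1.
have I0 : 0 < #|I| by apply/card_gt0P; exists i.
move=> le; move: h; rewrite -e -(prednK I0) mulSn => h.
by rewrite -(leq_add2r (#|I|.-1 * dim_relic SK D)); apply: leq_trans h _; rewrite leq_add2l.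
Qed.

Lemma dim_flat_base A C (I : finType) (x : I -> D) : dim_flat A C x <= dim_flat set0 C x.
Proof. by apply: mdim_acl_over_le => E; exact: cl_base. Qed.

Lemma dim_flat_over_base A B C (I : finType) (x : I -> D) :
  (forall C, acl_flat A C `<=` acl_flat set0 (B `|` C)) ->
    dim_flat set0 (B `|` C) x <= dim_flat A C x.
Proof. by move=> hB; apply: mdim_acl_over_le => E y /hB; rewrite setUA. Qed.

Lemma rank_le A n (I J : finType) (X : set (J + I -> D)) b x C : params SM A ->
  dfn SM A X -> X (tcat b x) -> ~ large n.+1 [set x | X (tcat b x)] ->
  range (flat b) `<=` C -> dim_flat A C x <= n * dim_relic SK D.
Proof.
move=> pA Xd Xx nR bC.
apply: (dim_le_rank H0 QK exK satK Hsm infD pA Xd Xx) => // s ss Rs.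
by apply: nR; exists s.
Qed.

(** The empty tuple of parameters, which turns the statements about fibres below into statements
    about sets. *)
Definition no_point (k : void) : D := match k with end.

Lemma range_no_point C : range (flat no_point) `<=` C.
Proof. by move=> _ [[[]]]. Qed.

Lemma rank_le0 A n (I : finType) (X : set (I -> D)) x C : params SM A ->
  dfn SM A X -> X x -> ~ large n.+1 X -> dim_flat A C x <= n * dim_relic SK D.
Proof.
move=> pA Xd Xx nR.
have h : dfn SM A (fun w : void + I -> D => X (w \o inr)) by exact: (dfn_ren (f := inr) Xd).
by apply: (rank_le (b := no_point) pA h) => //; exact: range_no_point.
Qed.

Lemma rank_ge A B n (I J : finType) (X : set (J + I -> D)) b B' : params SM A ->
  (forall C, acl_flat A C `<=` acl_flat set0 (B `|` C)) ->
  dfn SM A X -> large n [set x | X (tcat b x)] -> countable B' -> B `<=` B' ->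
  range (flat b) `<=` B' ->
  exists2 x, X (tcat b x) & n * dim_relic SK D <= dim_flat set0 B' x.
Proof.
move=> pA hB Xd [s <- Rs] cB' BB' bB'; rewrite /dim_flat /acl_flat flat_params0.
apply: (dim_ge_rank H0 QK exK satK Hsm infD pA _ Xd Rs cB' BB' bB') => C.
by move=> y /hB; rewrite /acl_flat flat_params0.
Qed.

Lemma rank_ge0 A B n (I : finType) (X : set (I -> D)) B' : params SM A ->
  (forall C, acl_flat A C `<=` acl_flat set0 (B `|` C)) ->
  dfn SM A X -> large n X -> countable B' -> B `<=` B' ->
  exists2 x, X x & n * dim_relic SK D <= dim_flat set0 B' x.
Proof.
move=> pA hB Xd lX cB' BB'.
have h : dfn SM A (fun w : void + I -> D => X (w \o inr)) by exact: (dfn_ren (f := inr) Xd).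
by apply: (rank_ge (b := no_point) pA hB h) => //; exact: range_no_point.
Qed.

Lemma bounded (I : finType) (X : set (I -> D)) : definable SM X -> exists n, ~ large n X.
Proof.
move=> _; exists #|I|.+1 => h.
have {}h : large #|I|.+1 [set: I -> D] by apply: large_mono h.
have [||x _] := rank_ge0 (B := set0) params0 _ (dfnT set0 I) h (@countable0 _).
- by move=> C; rewrite set0U.
- by [].
move=> /leq_trans/(_ (dim_flat_le_card set0 x params0)).
by rewrite leq_pmul2r ?ltnn // (dim_relic_gt0 H0 satK infD).
Qed.
Lemma dim_flatE A (I : finType) (x : I ->
  D) : dim SK (flat_params A) (flat x) = dim_flat A set0 x.
Proof. by rewrite dim_baseE. Qed.

Lemma dim_set_rank A n (I : finType) (X : set (I -> D)) : params SM A ->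
  dfn SM A X -> large n X -> n * dim_relic SK D <= dim_set SK (flat_params A) (flat_set X).
Proof.
move=> pA Xd RX; have [B [cB hB]] := base_exists pA.
have [x Xx le] := rank_ge0 pA hB Xd RX cB (@subset_refl _ _).
have Xx' : flat_set X (flat x) by exists x.
apply: leq_trans (dim_set_ge SK (flat_params A) Xx'); rewrite dim_flatE.
by apply: leq_trans le _; rewrite -[B]setU0; exact: dim_flat_over_base.
Qed.

Lemma coordinate_generic A (I : finType) (x : I -> D) i : params SM A ->
  #|I| * dim_relic SK D <= dim_flat A set0 x -> generic SK set0 D (val (x i)).
Proof.
move=> pA h; split; first exact: set_valP.
rewrite -/(dim_relic SK D) dim_baseE; apply/eqP; rewrite eqn_leq mdim_point /=.
apply: leq_trans (dim_flat_coordinate i pA h) _.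
by rewrite -mdim_valE //; apply: mdim_acl_over_le => E; apply: acl_over_sub.
Qed.

(** Weak detection of closures for any finite index type, with ranks replaced by largeness. The last
    hypothesis says that [x] has rank at least k; if [X] has rank exactly k, the alternative of a
    strictly smaller rank is void and independence remains. *)
Lemma weak_closure A k (I : finType) (X : set (I -> D)) (x : I -> D) :
  weakly_detects_closures SK SM -> params SM A -> dfn SM A X ->
  closure (flat_set X) (flat x) -> (forall i, generic SK set0 D (val (x i))) ->
  (forall Z : set (I -> D), dfn SM A Z -> Z x -> large k Z) ->
  large k X /\ (~ large k.+1 X -> forall i j, i <> j ->
    (forall z, X z -> k * dim_relic SK D <= dim_flat A set0 z ->
      independent SK (flat_params A) (val (z i)) (val (z j))) ->
    morley_independent SM A (fun _ : unit => x i) (fun _ : unit => x j)).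
Proof.
move=> W pA Xd clx gx hk; have gA := definable_classes_params pA.
pose ev (k : 'I_#|I|) : I := enum_val k.
have evK i : ev (enum_rank i) = i by exact: enum_rankK.
have evI n : enum_rank (ev n) = n by exact: enum_valK.
pose X' := [set w : 'I_#|I| -> D | X (w \o enum_rank)].
pose x' := x \o ev.
have X'd : dfn SM A X' by exact: (dfn_ren (f := enum_rank) Xd).
have x'E : x' \o enum_rank = x by apply/funext => i; rewrite /x' /= evK.
have clx' : closure (flat_set X') (flat x').
  move=> U Ux; pose f (p : 'I_#|I| * 'I_m) := (ev p.1, p.2).
  have nU : nbhs (flat x) [set z | U (fun n => z (f n))].
    by apply: (@reindex_continuous _ _ K f (flat x) U); exact: Ux.
  have [_ [[y Xy <-] Uy]] := clx _ nU.
  exists (flat (y \o ev)); split => //; exists (y \o ev) => //.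
  rewrite /X' /=; suff -> : (y \o ev) \o enum_rank = y by [].
  by apply/funext => i /=; rewrite evK.
have X'0 : X' !=set0.
  by have [_ [[y X'y _] _]] := clx' setT filterT; exists y.
have [r mr] := morley_exists relic_uniformly_minimal bounded (dfn_definable0 gA X'd) X'0.
have [Rr nRr] := (morleyE relic_uniformly_minimal _ (dfn_definable0 gA X'd)).1 mr.
have gx' : coordinatewise_generic SK x' by move=> i; exact: gx.
have [le alt] := W A #|I| X' r x' pA X'd mr clx' gx'.
have krk : k <= rk SM A x'.
  apply: (rk_ge relic_uniformly_minimal bounded gA) => Z Zd Zx.
  have [|s ss Rs] := hk [set y : I -> D | Z (y \o ev)] (dfn_ren (f := ev) Zd _) Zx.
    by [].
  exists (map enum_rank s); first by rewrite size_map.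
  by apply: (large_along_reindex (g := ev)) Rs => i; rewrite evK.
have XX' n : large n X' <-> large n X.
  split=> -[s ss Rs].
    exists (map ev s); first by rewrite size_map.
    by apply: (large_along_reindex (g := enum_rank)) Rs => i; rewrite evI.
  exists (map enum_rank s); first by rewrite size_map.
  apply: (large_along_reindex (g := ev)); first by move=> i; rewrite evK.
  apply: large_along_mono Rs => y Xy; rewrite /X' /=.
  by suff -> : (y \o ev) \o enum_rank = y by []; apply/funext => i /=; rewrite evK.
split; first by apply/XX'; apply: large_le Rr; exact: leq_trans krk le.
move=> nk i j ij ind.
have rk_r : r = k.
  apply/eqP; rewrite eqn_leq (leq_trans krk le) andbT leqNgt; apply/negP => kr.
  by apply: nk; apply/XX'; exact: large_le Rr.
case: alt => [|alt]; first by rewrite rk_r ltnNge krk.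
have := alt (enum_rank i) (enum_rank j).
rewrite /x' /= !evK; apply; first by move=> /enum_rank_inj.
move=> w X'w [_ gw]; have := ind _ X'w; rewrite /=; apply.
have := dim_set_rank pA X'd Rr; rewrite -gw dim_flatE rk_r => h; apply: leq_trans h _.
apply: dim_flat_sub => // _ [[n l] _ <-]; exists (ev n, l) => //.
by rewrite /flat /= evI.
Qed.

Let d0_pos : 0 < dim_relic SK D := dim_relic_gt0 H0 satK infD.

Lemma dfn_large1 A V (I : finType) (P : (V -> D) -> (I -> D) -> Prop) :
  dfn SM A (fun w : V + I -> D => P (w \o inl) (w \o inr)) ->
  dfn SM A (fun v => large 1 [set x | P v x]).
Proof.
move=> h; apply: dfn_ext (dfn_ex_idx (fun i => dfn_large_along [:: i] relic_infinity h)) => v.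
by rewrite large1P.
Qed.

Lemma range_tcat (I J : finType) (x : I -> D) (y : J -> D) :
  range (flat (tcat x y)) = range (flat x) `|` range (flat y).
Proof.
apply/seteqP; split=> k.
  by move=> [[[i|j] l] _ <-]; [left; exists (i, l)|right; exists (j, l)].
by move=> [[[i l] _ <-]|[[j l] _ <-]]; [exists (inl i, l)|exists (inr j, l)].
Qed.

Lemma tcat_eta (I J T : Type) (z : I + J -> T) : tcat (z \o inl) (z \o inr) = z.
Proof. by apply/funext => -[]. Qed.

Lemma countable_range (I : finType) (x : I -> D) : countable (range (flat x)).
Proof. by apply: finite_set_countable; apply: finite_image; exact: finite_finset. Qed.

(** Otherwise take (t, u) generic in the set and p generic in the infinite intersection. As p has at
    most dimension [dim_relic] over t, and still that much over t and u, symmetry makes u as generic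
    over t, p as it is over t. But u belongs to the curves through p, which form a set of rank below
    s. *)
Lemma rank_infinite_intersections A r s (G1 : set ('I_2 + 'I_r ->
  D)) (G2 : set ('I_2 + 'I_s -> D)) :
  params SM A -> dfn SM A G1 -> dfn SM A G2 -> 0 < s ->
  (forall t, ~ large 2 [set p | G1 (tcat p t)]) ->
  (forall p, ~ large s [set u | G2 (tcat p u)]) ->
  ~ large (r + s) [set z : 'I_r + 'I_s -> D |
      large 1 [set p | G1 (tcat p (z \o inl)) /\ G2 (tcat p (z \o inr))]].
Proof.
move=> pA G1d G2d s0 h1 h2 RW; have [B [cB hB]] := base_exists pA.
have Id : dfn SM A (fun w : ('I_r + 'I_s) + 'I_2 -> D =>
    G1 (tcat (w \o inr) (w \o inl \o inl)) /\ G2 (tcat (w \o inr) (w \o inl \o inr))).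
  apply: dfn_and.
    apply: (dfn_ren (f := fun k => match k with inl i => inr i | inr j => inl (inl j) end) G1d).
    by move=> w; apply/funext => -[].
  apply: (dfn_ren (f := fun k => match k with inl i => inr i | inr j => inl (inr j) end) G2d).
  by move=> w; apply/funext => -[].
have Wd := dfn_large1 (P := fun z p => G1 (tcat p (z \o inl)) /\ G2 (tcat p (z \o inr))) Id.
have [z Wz le] := rank_ge0 pA hB Wd RW cB (@subset_refl _ _).
have [|||p [p1 p2] lep] := rank_ge (b := z) (B' := B `|` range (flat z)) pA hB Id Wz.
- by apply: countable_setU => //; exact: countable_range.
- exact: subsetUl.
- exact: subsetUr.
set t := z \o inl in p1 *; set u := z \o inr in p2 *.
have zE : z = tcat t u by rewrite tcat_eta.
have {}p1 : G1 (tcat p t) := p1; have {}p2 : G2 (tcat p u) := p2.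
have G1d' : dfn SM A (fun w : 'I_r + 'I_2 -> D => G1 (tcat (w \o inr) (w \o inl))).
  apply: (dfn_ren (f := fun k => match k with inl i => inr i | inr j => inl j end) G1d).
  by move=> w; apply/funext => -[].
have l1 := rank_le (b := t) pA G1d' p1 (h1 t) (@subset_refl _ (range (flat t))).
have l2 : dim_flat A (range (flat p)) u <= s.-1 * dim_relic SK D.
  by apply: (rank_le (b := p) pA G2d p2) => //; rewrite prednK //; exact: h2.
have l1' := leq_trans (dim_flat_over_base _ _ hB) l1.
have l2' := leq_trans (dim_flat_over_base _ _ hB) l2.
have l3 : dim_flat set0 (B `|` range (flat t) `|` range (flat p)) u <= s.-1 * dim_relic SK D.
  apply: leq_trans l2'; apply: (dim_flat_mono u params0).
  by rewrite setUAC; exact: subsetUl.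
have l4 := dim_flat_le_card B t params0; rewrite card_ord in l4.
have := dim_flat_sym (B `|` range (flat t)) p u params0.
rewrite zE (dim_flatD _ _ _ params0) in le.
rewrite zE range_tcat setUA in lep; rewrite mul1n in lep l1'.
move=> e.
have s1 : s.-1 * dim_relic SK D + dim_relic SK D = s * dim_relic SK D by rewrite -mulSnr prednK.
have e2 : r * dim_relic SK D + s * dim_relic SK D <= dim_flat set0 B t + dim_flat set0 (B `|`
  range (flat t)) u.
  by rewrite -mulnDl.
have d0p := d0_pos.
have : s * dim_relic SK D <= dim_flat set0 (B `|` range (flat t)) u.
  by rewrite -(leq_add2l (r * dim_relic SK D)); apply: leq_trans e2 _; rewrite leq_add2r.
move=> e3; have : s * dim_relic SK D + dim_relic SK D <= dim_relic SK D + s.-1 * dim_relic SK D.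
  apply: leq_trans (leq_add e3 lep) _; rewrite -e; exact: leq_add.
by rewrite [dim_relic SK D + _]addnC s1 -[X in _ <= X]addn0 leq_add2l leqn0; move: d0p;
  rewrite lt0n => /negbTE ->.
Qed.

(* For v and w generic in the common set, z is algebraic over v and w, since otherwise the
   curves of v and w have infinite intersection, so w is algebraic over v. *)
Lemma dim_common_infinite (G : set ('I_2 + 'I_2 -> D)) z : dfn SM set0 G ->
  (forall v, finite_set [set v' | large 1 [set p | G (tcat p v) /\ G (tcat p v')]]) ->
  large 1 [set v | G (tcat (z \o inl) v) /\ G (tcat (z \o inr) v)] ->
  dim_flat set0 set0 z <= 2 * dim_relic SK D.
Proof.
move=> Gd Gf Rz; rewrite leqNgt; apply/negP => lt.
have hB C : acl_flat set0 C `<=` acl_flat set0 (set0 `|` C) by rewrite set0U.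
have p0 := params0.
set p := z \o inl in Rz; set p' := z \o inr in Rz.
have zE : z = tcat p p' by rewrite tcat_eta.
have Id : dfn SM set0 (fun w : ('I_2 + 'I_2) + 'I_2 -> D =>
    G (tcat (w \o inl \o inl) (w \o inr)) /\ G (tcat (w \o inl \o inr) (w \o inr))).
  apply: dfn_and.
    apply: (dfn_ren (f := fun k => match k with inl i => inl (inl i) | inr j => inr j end) Gd).
    by move=> w; apply/funext => -[].
  apply: (dfn_ren (f := fun k => match k with inl i => inl (inr i) | inr j => inr j end) Gd).
  by move=> w; apply/funext => -[].
have cz := countable_range z.
have [v [v1 v1'] lev] := rank_ge (b := z) p0 hB Id Rz cz (@sub0set _ _) (@subset_refl _ _).
have [|||w [w1 w1'] lew] := rank_ge (b := z) (B' :=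
  range (flat z) `|` range (flat v)) p0 hB Id Rz.
- by apply: countable_setU => //; exact: countable_range.
- exact: sub0set.
- exact: subsetUl.
rewrite mul1n in lev lew.
have Jd : dfn SM set0 (fun w : ('I_2 + 'I_2) + 'I_2 -> D =>
    G (tcat (w \o inr) (w \o inl \o inl)) /\ G (tcat (w \o inr) (w \o inl \o inr))).
  apply: dfn_and.
    apply: (dfn_ren (f := fun k => match k with inr i => inl (inl i) | inl j => inr j end) Gd).
    by move=> k; apply/funext => -[].
  apply: (dfn_ren (f := fun k => match k with inr i => inl (inr i) | inl j => inr j end) Gd).
  by move=> k; apply/funext => -[].
have [R|nR] := pselect (large 1 [set p | G (tcat p v) /\ G (tcat p w)]).
  have Kd := dfn_large1 (P := fun z p => G (tcat p (z \o inl)) /\ G (tcat p (z \o inr))) Jd.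
  have : dim_flat set0 (range (flat z) `|` range (flat v)) w <= 0 * dim_relic SK D.
    apply: (rank_le (b := v) p0 Kd R) => [/large1_infinite|]; last exact: subsetUr.
    by apply; exact: Gf.
  by rewrite mul0n leqn0 => /eqP e; move: lew; rewrite e leqNgt d0_pos.
have zero q : G (tcat q v) -> G (tcat q w) -> dim_flat set0 (range (flat (tcat v w))) q = 0.
  move=> qv qw; apply/eqP; rewrite -leqn0.
  by have := rank_le (b := tcat v w) (x := q) p0 Jd (conj qv qw) nR (@subset_refl _ _);
    rewrite mul0n.
have zero2 : dim_flat set0 (range (flat (tcat v w))) z = 0.
  by rewrite zE dim_flatD // zero // dim_flat_absorb ?zero.
have e1 := dim_flat_sym set0 z (tcat v w) p0.
rewrite !set0U zero2 addn0 in e1.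
have e2 := dim_flat_le_card set0 (tcat v w) p0.
rewrite card_sum !card_ord in e2.
have e3 : dim_relic SK D + dim_relic SK D <= dim_flat set0 (range (flat z)) (tcat v w).
  by rewrite dim_flatD //; exact: leq_add.
have : (2 * dim_relic SK D).+1 + (dim_relic SK D + dim_relic SK D) <= (2 + 2) * dim_relic SK D.
  by apply: leq_trans e2; rewrite -e1; exact: leq_add.
by rewrite mulnDl !mul2n -!addnn addSn ltnn.
Qed.

Definition pair_pt (a b : D) : 'I_2 -> D := fun k => if k == ord0 then a else b.

Lemma pair_pt_eta (p : 'I_2 -> D) : p = pair_pt (p ord0) (p ord_max).
Proof.
apply/funext => k; rewrite /pair_pt; case: eqP => [-> //|ne]; congr p; apply: val_inj.
case: k ne => -[|[|//]] lt ne //; case: ne; exact: val_inj.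
Qed.

Lemma range_pair_pt a b : range (flat (pair_pt a b)) = range (flat (fun _ : unit => a)) `|`
   range (flat (fun _ : unit => b)).
Proof.
apply/seteqP; split=> y.
  move=> [[k l] _ <-]; rewrite /flat /= /pair_pt; case: eqP => _; [left|right];
    by exists (tt, l).
move=> [[[u l] _ <-]|[[u l] _ <-]]; first by exists (ord0, l).
by exists (ord_max, l).
Qed.

(** Take v generic over [B]. By symmetry [a] is generic over v, so it lies in the cofinite
    projection of the curve of v, which gives y. The curves through (a, y) have rank at most 1, so
    of the dimension 2 * [dim_relic] of v over [B] at least half must come from y. *)
Lemma generic_curve_point (PF : set ('I_2 -> D)) (G : set ('I_2 + 'I_2 ->
  D)) (B : set K) (a : D) :
  dfn SM set0 PF -> dfn SM set0 G -> large 2 PF ->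
  (forall v, PF v -> large 1 [set p | G (tcat p v)]) ->
  (forall v k b, PF v -> finite_set [set p | G (tcat p v) /\ p k = b]) ->
  (forall p, ~ large 2 [set v | G (tcat p v)]) ->
  countable B -> range (flat (fun _ : unit => a)) `<=` B ->
  dim_relic SK D <= dim_flat set0 set0 (fun _ : unit => a) ->
  exists v y, [/\ PF v, G (tcat (pair_pt a y) v), 2 * dim_relic SK D <= dim_flat set0 B v,
    dim_relic SK D <= dim_flat set0 B (fun _ : unit => y)
    & dim_relic SK D <= dim_flat set0 (range (flat v)) (fun _ : unit => a)].
Proof.
move=> Pd Gd RP RF finF RC cB aB da.
have hB C : acl_flat set0 C `<=` acl_flat set0 (set0 `|` C) by rewrite set0U.
have p0 := params0.
have [v Pv lev] := rank_ge0 p0 hB Pd RP cB (@sub0set _ _).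
have lev' := dim_flat_le_card set0 v p0; rewrite card_ord in lev'.
have dav : dim_relic SK D <= dim_flat set0 (range (flat v)) (fun _ : unit => a).
  have e := dim_flat_sym set0 v (fun _ : unit => a) p0; rewrite !set0U in e.
  have : dim_flat set0 B v <= dim_flat set0 (range (flat (fun _ : unit => a))) v by exact:
    dim_flat_mono.
  move=> /(leq_trans lev) h.
  rewrite -(leq_add2l (2 * dim_relic SK D)).
  apply: (@leq_trans (dim_flat set0 set0 v + dim_flat set0 (range (flat v)) (fun _ : unit =>
    a))).
    by rewrite e addnC; exact: leq_add.
  by rewrite leq_add2r.
have Yd : dfn SM set0 (fun w : option 'I_2 -> D =>
    exists p : 'I_2 -> D, G (tcat p (w \o some)) /\ p ord0 = w None).
  apply: dfn_exfin; apply: dfn_and; last exact: dfn_eq.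
  apply: (dfn_ren (f := fun k => match k with inl i => inr i | inr j => inl (Some j) end) Gd).
  by move=> w; apply/funext => -[].
have [y Gy] : exists y, G (tcat (pair_pt a y) v).
  have infY : infinite_set [set b | exists p : 'I_2 -> D, G (tcat p v) /\ p ord0 = b].
    move=> fY; apply: (large1_infinite (RF v Pv)).
    apply: (@sub_finite_set _ _ (\bigcup_(b in [set b | exists p : 'I_2 -> D,
      G (tcat p v) /\ p ord0 = b]) [set p | G (tcat p v) /\ p ord0 = b])).
      by move=> p Gp; exists (p ord0) => //; exists p.
    by apply: bigcup_finite => // b _; exact: finF.
  have := dfn_cofinite H0 satK Hsm infD (b := v) (definable_classes_params p0) Yd infY => fY.
  have [[p [Gp pa]]|na] := pselect (exists p : 'I_2 -> D, G (tcat p v) /\ p ord0 = a).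
    by exists (p ord_max); rewrite -pa -pair_pt_eta.
  have : mdim (acl_flat set0) (range (flat v)) (val a) = 0.
    apply: mdim0; first exact: pregeometry_acl_flat.
    by move=> j; exact: (alg_point H0 _ p0 (dfn_not Yd) fY na).
  by rewrite mdim_valE // => e; move: dav; rewrite e leqNgt d0_pos.
exists v, y; split => //.
have e := dim_flat_sym B (fun _ : unit => y) v p0.
have l1 : dim_flat set0 (B `|` range (flat (fun _ : unit => y))) v <= dim_relic SK D.
  rewrite -[dim_relic SK D]mul1n.
  apply: (rank_le (b := pair_pt a y) p0 Gd Gy) => //.
  by rewrite range_pair_pt; exact: setSU.
rewrite -(leq_add2r (dim_relic SK D)).
apply: (@leq_trans (dim_flat set0 B (fun _ : unit => y) + dim_flat set0 (B `|` range (flat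
  (fun _ : unit => y))) v)).
  by rewrite e addnn -mul2n (leq_trans lev) // leq_addr.
by rewrite leq_add2l.
Qed.

Lemma fibre_dim (G : set ('I_2 + 'I_2 -> D)) A a y v C : params SM A -> dfn SM A G ->
  (forall v k b, finite_set [set p | G (tcat p v) /\ p k = b]) ->
  G (tcat (pair_pt a y) v) -> range (flat v) `|` range (flat (fun _ : unit => a)) `<=` C ->
  dim_flat A C (fun _ : unit => y) = 0.
Proof.
move=> pA Gd fG Gy hC.
have Xd : dfn SM A (fun w : ('I_2 + unit) + 'I_2 -> D =>
    G (tcat (w \o inr) (w \o inl \o inl)) /\ w (inr ord0) = w (inl (inr tt))).
  apply: dfn_and; last exact: dfn_eq.
  apply: (dfn_ren (f := fun k => match k with inl i => inr i | inr j => inl (inl j) end) Gd).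
  by move=> w; apply/funext => -[].
have nR : ~ large 1 [set p | G (tcat p v) /\ p ord0 = a] by move=> /large1_infinite; apply;
  exact: fG.
apply/eqP; rewrite -leqn0; apply: (@leq_trans (dim_flat A C (pair_pt a y))).
  apply: dim_flat_sub => //; rewrite range_pair_pt; exact: subsetUr.
have := rank_le (b := tcat v (fun=> a)) (x := pair_pt a y) (C := C) pA Xd (conj Gy erefl) nR.
by rewrite mul0n; apply; rewrite range_tcat.
Qed.

(** * The witness set *)

Section Witness.
Variables (A : set (eqelt D)) (r s : nat) (i : 'I_2).
Variables (G1 : set ('I_2 + 'I_r -> D)) (G2 : set ('I_2 + 'I_s -> D)) (G : set ('I_2 + 'I_2 ->
  D)).
Hypotheses (pA : params SM A) (G1d : dfn SM A G1) (G2d : dfn SM A G2) (Gd : dfn SM set0 G).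
Hypothesis fG : forall v k b, finite_set [set p | G (tcat p v) /\ p k = b].

Let GdA : dfn SM A G := dfn_sub (@sub0set _ A) Gd.

Definition meets (tu : 'I_r + 'I_s -> D) : set ('I_2 -> D) :=
  [set p | G1 (tcat p (tu \o inl)) /\ G2 (tcat p (tu \o inr))].

Definition common (p p' : 'I_2 -> D) : set ('I_2 -> D) :=
  [set v | G (tcat p v) /\ G (tcat p' v)].

(* The coordinates of z are t, u, v and the pair (y, y'); q is the pair (x, x') of points of
   the intersection of the curves of t and u, and v is on the curves of (x_i, y) and
   (x'_i, y'). *)
Definition witness : set ((('I_r + 'I_s) + 'I_2) + 'I_2 -> D) :=
  [set z | exists q : 'I_2 + 'I_2 -> D,
    let p := pair_pt (q (inl i)) (z (inr ord0)) in
    let p' := pair_pt (q (inr i)) (z (inr ord_max)) in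
    (meets (z \o inl \o inl) (q \o inl) /\ meets (z \o inl \o inl) (q \o inr)) /\
    (common p p' (z \o inl \o inr) /\
    (~ large 1 (meets (z \o inl \o inl)) /\ ~ large 1 (common p p')))].

Lemma dfn_meets : dfn SM A (fun w : ('I_r + 'I_s) + 'I_2 -> D => meets (w \o inl) (w \o inr)).
Proof.
apply: dfn_and.
  apply: (dfn_ren (f := fun k => match k with inl i => inr i | inr j => inl (inl j) end) G1d).
  by move=> w; apply/funext => -[].
apply: (dfn_ren (f := fun k => match k with inl i => inr i | inr j => inl (inr j) end) G2d).
by move=> w; apply/funext => -[].
Qed.

Lemma dfn_common : dfn SM A (fun w : ('I_2 + 'I_2) + 'I_2 -> D =>
  common (w \o inl \o inl) (w \o inl \o inr) (w \o inr)).
Proof.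
apply: dfn_and.
  apply: (dfn_ren (f := fun k => match k with inl i => inl (inl i) | inr j => inr j end) GdA).
  by move=> w; apply/funext => -[].
apply: (dfn_ren (f := fun k => match k with inl i => inl (inr i) | inr j => inr j end) GdA).
by move=> w; apply/funext => -[].
Qed.

Lemma dfn_witness : dfn SM A witness.
Proof.
apply: dfn_exfin; apply: dfn_and.
  apply: dfn_and.
    apply: (dfn_ren (f := fun k => match k with inl k => inl (inl (inl k)) | inr j => inr (inl
      j) end)
      (t := fun w => tcat (w \o inl \o inl \o inl) (w \o inr \o inl)) dfn_meets).
    by move=> w; apply/funext => -[].
  apply: (dfn_ren (f := fun k => match k with inl k => inl (inl (inl k)) | inr j => inr (inr
    j) end)
      (t := fun w => tcat (w \o inl \o inl \o inl) (w \o inr \o inr)) dfn_meets).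
  by move=> w; apply/funext => -[].
pose f (k : 'I_2 + 'I_2) : ((('I_r + 'I_s) + 'I_2) + 'I_2) + ('I_2 + 'I_2) := match k with
  | inl j => if j == ord0 then inr (inl i) else inl (inr ord0)
  | inr j => if j == ord0 then inr (inr i) else inl (inr ord_max) end.
have fE (w : ((('I_r + 'I_s) + 'I_2) + 'I_2) + ('I_2 + 'I_2) -> D) :
  tcat (pair_pt (w (inr (inl i))) (w (inl (inr ord0)))) (pair_pt (w (inr (inr i))) (w (inl
    (inr ord_max)))) = w \o f.
  by apply/funext => -[j|j] /=; rewrite /pair_pt; case: ifP.
apply: dfn_and.
  apply: (dfn_ren (f := fun k => match k with inl k => f k | inr j => inl (inl (inr j)) end)
    (t := fun w => tcat (tcat (pair_pt (w (inr (inl i))) (w (inl (inr ord0))))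
      (pair_pt (w (inr (inr i))) (w (inl (inr ord_max))))) (w \o inl \o inl \o inr))
        dfn_common).
  by move=> w; rewrite fE; apply/funext => -[].
apply: dfn_and; apply: dfn_not.
  exact: (dfn_ren (f := inl \o inl \o inl) (dfn_large1 dfn_meets)).
exact: (dfn_ren (f := f) (dfn_large1 (P :=
  fun z => common (z \o inl) (z \o inr)) dfn_common) fE).
Qed.

Lemma witness_dim z : witness z ->
  dim_flat A set0 z <= (r + s + 2) * dim_relic SK D /\
  ((r + s + 2) * dim_relic SK D <= dim_flat A set0 z ->
    independent SK (flat_params A) (val (z (inr ord0))) (val (z (inr ord_max)))).
Proof.
move=> [q /= [[m1 m2] [[c1 c2] [nRm nRc]]]].
set tu := z \o inl \o inl in m1 m2 nRm; set v := z \o inl \o inr in c1 c2.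
set y := z (inr ord0) in c1 nRc *; set y' := z (inr ord_max) in c2 nRc *.
pose yy := z \o inr; have yyE : yy = pair_pt y y' by rewrite [yy]pair_pt_eta.
have zE : z = tcat (tcat tu v) yy by rewrite !tcat_eta.
(* By the first exclusion x and x' are algebraic over t, u. *)
have q0 C : range (flat tu) `<=` C -> dim_flat A C q = 0.
  move=> hC; have key p : meets tu p -> dim_flat A C p = 0.
    move=> mp; apply/eqP; rewrite -leqn0.
    by have := rank_le (b := tu) (x := p) pA dfn_meets mp nRm hC; rewrite mul0n.
  by rewrite -[q]tcat_eta dim_flatD // key // dim_flat_absorb // key.
(* The curve of v has finite fibres, and x, x' are already algebraic, so y and y' are algebraic over
   t, u, v. *)
have y0 C : range (flat tu) `|` range (flat v) `<=` C -> dim_flat A C yy = 0.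
  rewrite subUset => -[h1 h2]; have e1 a : dim_flat A (C `|` range (flat q)) (fun _ : unit =>
    a) = dim_flat A C (fun _ : unit => a).
    by apply: dim_flat_absorb => //; exact: q0.
  have ey : dim_flat A C (fun _ : unit => y) = 0.
    rewrite -e1 //; apply: (fibre_dim pA GdA fG c1).
    by move=> w [hw|hw]; [left; exact: h2|right; exact: range_pt hw].
  have ey' : dim_flat A C (fun _ : unit => y') = 0.
    rewrite -e1 //; apply: (fibre_dim pA GdA fG c2).
    by move=> w [hw|hw]; [left; exact: h2|right; exact: range_pt hw].
  apply/eqP; rewrite -leqn0; apply: (@leq_trans (dim_flat A C (tcat (fun _ : unit => y) (fun _
    : unit => y')))).
    by apply: dim_flat_sub => //; rewrite yyE range_pair_pt range_tcat.
  by rewrite dim_flatD // ey dim_flat_absorb // ey'.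
have dz : dim_flat A set0 z = dim_flat A set0 tu + dim_flat A (range (flat tu)) v.
  by rewrite zE !dim_flatD // !set0U range_tcat y0 // addn0.
have dtu := dim_flat_le_card set0 tu pA; have dv := dim_flat_le_card (range (flat tu)) v pA.
rewrite card_sum !card_ord in dtu dv; split; first by rewrite dz mulnDl leq_add.
rewrite dz mulnDl => h.
have {}h : 2 * dim_relic SK D <= dim_flat A (range (flat tu)) v.
  by rewrite -(leq_add2l ((r + s) * dim_relic SK D)); apply: leq_trans h _; rewrite leq_add2r.
(* By the second exclusion v is algebraic over x, x', y, y', and t, u absorb x and x'. *)
have v0 : dim_flat A (range (flat tu) `|` range (flat yy)) v = 0.
  rewrite -(dim_flat_absorb (x := q) v pA); last by apply: q0; exact: subsetUl.
  apply/eqP; rewrite -leqn0.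
  have cv : common (pair_pt (q (inl i)) y) (pair_pt (q (inr i)) y') v by [].
  have := rank_le (b := tcat (pair_pt (q (inl i)) y) (pair_pt (q (inr i)) y')) (x := v)
    (C := range (flat tu) `|` range (flat yy) `|` range (flat q)) pA dfn_common cv nRc.
  rewrite mul0n; apply; rewrite range_tcat !range_pair_pt yyE range_pair_pt.
  by move=> w [[/range_pt hw|hw]|[/range_pt hw|hw]]; [right|left; right; left|right|left;
    right; right].
(* Over t, u the tuples v and (y, y') are interalgebraic, so the dimension of v passes to (y,
   y'). *)
have dyy : 2 * dim_relic SK D <= dim_flat A set0 yy.
  apply: leq_trans h _; have e := dim_flat_sym (range (flat tu)) v yy pA.
  rewrite v0 y0 // !addn0 in e.
  by rewrite e; apply: dim_flat_mono.
have pg := pregeometry_acl_flat pA; have [ext _ _ _] := pg.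
have le1 : 2 * dim_relic SK D <= mdim (acl_flat A) set0 (tcat (val y) (val y')).
  apply: leq_trans dyy _; apply: mdim_le_cl => // -[k l]; apply: ext; right.
  by rewrite yyE /flat /pair_pt /=; case: ifP => _; [exists (inl l)|exists (inr l)].
rewrite /independent !dim_baseE mdimD // set0U; congr (_ + _).
apply/eqP; rewrite eqn_leq mdim_mono //=.
have l1 := mdim_point SK (flat_params A) set0 y;
  have l2 := mdim_point SK (flat_params A) set0 y'.
rewrite mdimD // set0U mul2n -addnn in le1.
apply: leq_trans l2 _; rewrite -(leq_add2l (dim_relic SK D)).
by apply: leq_trans le1 _; rewrite leq_add2r.
Qed.

Lemma witness_rank : ~ large (r + s + 2).+1 witness.
Proof.
move=> R; have [B [cB hB]] := base_exists pA.
have [z Wz le] := rank_ge0 pA hB dfn_witness R cB (@subset_refl _ _).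
have [le' _] := witness_dim Wz.
have h : dim_flat set0 B z <= dim_flat A set0 z by rewrite -[B]setU0; exact: dim_flat_over_base.
by have := leq_trans le (leq_trans h le'); rewrite leq_pmul2r // ltnn.
Qed.

(** Only the rank of (t, u) is known, whereas v is generic in the sense of K. So fix t, u first and
    find a sequence [k2] of length 2 along which the possible v are large; this is a definable
    condition on (t, u), to which [htu] applies. The last two coordinates add no rank and are
    quantified away. *)
Lemma rank_adjoin_generic t u v yy B : countable B ->
  (forall C, acl_flat A C `<=` acl_flat set0 (B `|` C)) ->
  range (flat (tcat t u)) `<=` B -> 2 * dim_relic SK D <= dim_flat set0 B v ->
  (forall Z : set ('I_r + 'I_s -> D), dfn SM A Z -> Z (tcat t u) -> large (r + s) Z) ->
  forall Z : set ((('I_r + 'I_s) + 'I_2) + 'I_2 -> D), dfn SM A Z ->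
  Z (tcat (tcat (tcat t u) v) yy) -> large (r + s + 2) Z.
Proof.
move=> cB hB tuB hv htu Z Zd Zz.
have Yd : dfn SM A (fun w : ('I_r + 'I_s) + 'I_2 -> D =>
    exists b : 'I_2 -> D, Z (tcat (tcat (w \o inl) (w \o inr)) b)).
  apply: dfn_exfin; apply: (dfn_ren (f := id) Zd) => w.
  by apply/funext => -[[[]|]|].
have Rv : large 2 [set v | exists b : 'I_2 -> D, Z (tcat (tcat (tcat t u) v) b)].
  apply: contrapT => nR.
  have Yv : exists b : 'I_2 -> D, Z (tcat (tcat (tcat t u) v) b) by exists yy.
  have l1 := rank_le (b := tcat t u) (x := v) pA Yd Yv nR (@subset_refl _ _).
  have l2 := leq_trans (dim_flat_over_base _ _ hB) l1.
  have : 2 * dim_relic SK D <= 1 * dim_relic SK D.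
    apply: (leq_trans hv); apply: leq_trans l2; apply: (dim_flat_mono v params0).
    by move=> w [|/tuB].
  by rewrite leq_pmul2r.
have [k2 sk2 Rk2] := Rv.
have [k1 sk1 Rk1] := htu [set w | large_along k2 [set v | exists b : 'I_2 ->
  D, Z (tcat (tcat w v) b)]]
  (dfn_large_along k2 relic_infinity Yd) Rk2.
exists (map (inl \o inl) k1 ++ map (inl \o inr) k2).
  by rewrite size_cat !size_map sk1 sk2.
apply: large_along_cat Rk1 _ => w Rw; apply: large_along_map Rw _ => v' [b Zb].
by exists (tcat (tcat w v') b).
Qed.

End Witness.

(** * The closure of the witness set *)

Lemma local_branch (G : set ('I_2 + 'I_2 -> D)) (v : 'I_2 -> D) (a y : D) : dfn SM set0 G ->
  (forall v k b, finite_set [set p | G (tcat p v) /\ p k = b]) ->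
  ~ large 2 [set p | G (tcat p v)] -> G (tcat (pair_pt a y) v) ->
  dim_relic SK D <= dim_flat set0 (range (flat v)) (fun _ : unit => a) ->
  exists (U : set ('I_m -> K)) (f : ('I_m -> K) -> ('I_m -> K)),
  [/\ nbhs (val a) U, f (val a) = val y, f @ within D (nbhs (val a)) --> val y &
   forall b : D, U (val b) -> exists2 z : D, val z = f (val b) & G (tcat (pair_pt b z) v)].
Proof.
move=> Gd fG nR Gay da; have p0 := params0.
pose h (w : 'I_m + 'I_m -> K) (kl : ('I_2 + 'I_2) * 'I_m) : K := match kl.1 with
  | inl k => if k == ord0 then w (inl kl.2) else w (inr kl.2)
  | inr k => flat v (k, kl.2) end.
(* The curve of v as a set of pairs of points of K^m, which is the form that [hg_homeo] takes. The
   parameters are the coordinates of v. *)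
pose Z : set ('I_m + 'I_m -> K) := [set w | flat_set G (h w)].
pose C := range (flat v).
have hE b z : h (tcat (val b) (val z)) = flat (tcat (pair_pt b z) v).
  by apply/funext => -[[k|k] l] //=; rewrite /h /flat /= /pair_pt; case: ifP.
have ZP b z : Z (tcat (val b) (val z)) <-> G (tcat (pair_pt b z) v).
  by rewrite /Z /= hE flat_setP.
have ZD x' z' : Z (tcat x' z') -> exists b z : D, x' = val b /\ z' = val z.
  move=> [g _ gh]; exists (g (inl ord0)), (g (inl ord_max)).
  by split; apply/funext => l; [have := congr1 (fun k => k (inl ord0, l)) gh|
    have := congr1 (fun k => k (inl ord_max, l)) gh]; rewrite /h.
have cC : countable C by exact: countable_range.
have Dd : definable_over SK (reals C) D.
  rewrite dfnE; exact: dfn_sub (@sub0set _ _) (dfn_D H0).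
have Zd : definable_over SK (reals C) Z.
  rewrite dfnE.
  have d1 : dfn SK (reals C) (flat_set G).
    have := dfn_flat H0 Gd; rewrite flat_params0; exact: dfn_sub (@sub0set _ _).
  have d2 : dfn SK (reals C) (fun w : ('I_m + 'I_m) + 'I_2 * 'I_m -> K =>
      flat_set G (fun kl => match kl.1 with
        | inl k => if k == ord0 then w (inl (inl kl.2)) else w (inl (inr kl.2))
        | inr k => w (inr (k, kl.2)) end)).
    apply: (dfn_ren (f := fun kl => match kl.1 with
        | inl k => if k == ord0 then inl (inl kl.2) else inl (inr kl.2)
        | inr k => inr (k, kl.2) end) d1).
    by move=> w; apply/funext => -[[k|k] l] //=; case: ifP.
  by apply: (dfn_param (b := flat v) d2) => kl; exists (flat v kl) => //; exists kl.
have dimC (I : finType) (w : I -> K) : dim SK (reals C) w = mdim (acl_flat set0) C w.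
  by rewrite dim_realsE /acl_flat flat_params0.
have pg := pregeometry_acl_flat p0; have [ext _ _ _] := pg.
have dimZ b z : dim SK (reals C) (tcat (val b) (val z)) = dim_flat set0 C (pair_pt b z).
  rewrite dimC; apply/eqP; rewrite eqn_leq; apply/andP; split; apply: mdim_le_cl => // k;
    apply: ext; right.
    by case: k => l; [exists (ord0, l)|exists (ord_max, l)].
  by case: k => k l; rewrite /flat /pair_pt /=; case: ifP => _; [exists (inl l)|exists (inr l)].
have da' : dim_relic SK D <= dim_flat set0 C (pair_pt a y).
  by apply: leq_trans da _; apply: dim_flat_sub => //; rewrite range_pair_pt; exact: subsetUl.
have dimD : dim_set SK (reals C) D = dim_relic SK D.
  apply/eqP; rewrite eqn_leq; apply/andP; split.
    apply: dim_set_le => z Dz; rewrite dimC.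
    exact: (mdim_point SK _ C (exist _ z (mem_set Dz))).
  apply: leq_trans da _; rewrite -mdim_valE // -dimC; apply: dim_set_ge; exact: set_valP.
have zle b z : G (tcat (pair_pt b z) v) -> dim_flat set0 C (pair_pt b z) <= dim_relic SK D.
  move=> Gbz; have Gd' : dfn SM set0 (fun w : 'I_2 + 'I_2 ->
    D => G (tcat (w \o inr) (w \o inl))).
    apply: (dfn_ren (f := fun k => match k with inl i => inr i | inr j => inl j end) Gd).
    by move=> w; apply/funext => -[].
  have := rank_le (b := v) (x := pair_pt b z) p0 Gd' Gbz nR (@subset_refl _ C).
  by rewrite mul1n.
have dimZs : dim_set SK (reals C) Z = dim_relic SK D.
  apply/eqP; rewrite eqn_leq; apply/andP; split.
    apply: dim_set_le => w; rewrite -(tcat_eta w) => Zw.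
    have [b [z [e1 e2]]] := ZD _ _ Zw; rewrite e1 e2 dimZ; apply: zle.
    by apply/ZP; rewrite -e1 -e2.
  apply: leq_trans da' _; rewrite -dimZ; apply: dim_set_ge; exact/ZP.
(* [a] already has full dimension over v, and the curve has no more, so (a, y) is generic on it. *)
have gZ : generic SK (reals C) Z (tcat (val a) (val y)).
  split; first exact/ZP.
  by rewrite dimZs dimZ; apply/eqP; rewrite eqn_leq da' andbT; exact: zle.
have [|||||U [V [oU oV Ua Vy [f [g [fU _ cf _ gr]]]]]] := hg_homeo HK cC Dd Dd Zd _ _ _ _ _ gZ.
- by move=> x' z' /ZD[b [z [-> ->]]]; split; exact: set_valP.
- by rewrite dimD dimZs.
- by rewrite dimD dimZs.
- move=> x' Dx; pose b : D := exist _ x' (mem_set Dx).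
  apply: sub_finite_set (finite_image (fun p => val (p ord_max)) (fG v ord0 b)) => z' Zz.
  have [b' [z [e1 e2]]] := ZD _ _ Zz; exists (pair_pt b' z); last by rewrite e2.
  by split; [apply/ZP; rewrite -e1 -e2|apply: val_inj; rewrite /pair_pt /= -e1].
- move=> z' Dz; pose b : D := exist _ z' (mem_set Dz).
  apply: sub_finite_set (finite_image (fun p => val (p ord0)) (fG v ord_max b)) => x' Zz.
  have [b' [z [e1 e2]]] := ZD _ _ Zz; exists (pair_pt b' z); last by rewrite e1.
  by split; [apply/ZP; rewrite -e1 -e2|apply: val_inj; rewrite /pair_pt /= -e2].
have Da : (U `&` D) (val a) by split => //; exact: set_valP.
have Dy : (V `&` D) (val y) by split => //; exact: set_valP.
have fa : f (val a) = val y by apply/esym/(gr _ _ Da Dy)/ZP.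
exists U, f; split => //.
- by apply: open_nbhs_nbhs; split.
- have /subspace_continuousP/(_ _ Da) := cf; move=> cfa; rewrite -fa => W /cfa nW.
  have nU : nbhs (val a) U by apply: open_nbhs_nbhs; split.
  change (nbhs (val a) [set b | D b -> W (f b)]).
  by apply: filterS (filterI nU nW) => b [Ub hb] Db; apply: hb.
- move=> b Ub; have Db : (U `&` D) (val b) by split => //; exact: set_valP.
  have [[Vf Df] _] := fU _ Db; exists (exist _ (f (val b)) (mem_set Df)) => //.
  by apply/ZP/(gr _ _ Db).
Qed.

(** Send a pair of intersection points (x1, t', u'), (x2, t', u') to (t', u', v, f(x1_i), f(x2_i)).
    Along the restricted filter this converges to (t, u, v, y, y), and the two tuples that the
    exclusions test converge to points outside the closures of the excluded sets, so nearby pairs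
    give points of the witness set. *)
Lemma witness_closure r s i (G1 : set ('I_2 + 'I_r -> D)) (G2 : set ('I_2 + 'I_s -> D))
    (G : set ('I_2 + 'I_2 -> D)) (x : 'I_2 -> D) (t : 'I_r -> D) (u : 'I_s -> D)
    (v : 'I_2 -> D) (y : D) (U : set ('I_m -> K)) (f : ('I_m -> K) -> ('I_m -> K)) :
  closure [set p : (('I_2 * 'I_m -> K) * ('I_r * 'I_m -> K) * ('I_s * 'I_m -> K)) *
                   (('I_2 * 'I_m -> K) * ('I_r * 'I_m -> K) * ('I_s * 'I_m -> K)) |
    exists x1 x2 t' u', [/\ x1 i <> x2 i, meets G1 G2 (tcat t' u') x1,
      meets G1 G2 (tcat t' u') x2
      & p = ((flat x1, flat t', flat u'), (flat x2, flat t', flat u'))]]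
    ((flat x, flat t, flat u), (flat x, flat t, flat u)) ->
  ~ closure (flat_set [set tu : 'I_r + 'I_s ->
    D | large 1 (meets G1 G2 tu)]) (flat (tcat t u)) ->
  ~ closure (flat_set [set z : 'I_2 + 'I_2 -> D | z \o inl <> z \o inr /\
      large 1 (common G (z \o inl) (z \o inr))]) (flat (tcat (pair_pt (x i) y) (pair_pt (x i)
        y))) ->
  nbhs (val (x i)) U -> f (val (x i)) = val y -> f @ within D (nbhs (val (x i))) --> val y ->
  (forall b : D, U (val b) -> exists2 z : D, val z = f (val b) & G (tcat (pair_pt b z) v)) ->
  closure (flat_set (witness i G1 G2 G)) (flat (tcat (tcat (tcat t u) v) (pair_pt y y))).
Proof.
set S := [set p | _]; set p0 := (_, _) => clS nW nB nU fx cf fG W nW'.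
pose Q := ((('I_2 * 'I_m -> K) * ('I_r * 'I_m -> K) * ('I_s * 'I_m -> K)) *
           (('I_2 * 'I_m -> K) * ('I_r * 'I_m -> K) * ('I_s * 'I_m -> K)))%type.
pose a1 (p : Q) : 'I_m -> K := fun l => p.1.1.1 (i, l).
pose a2 (p : Q) : 'I_m -> K := fun l => p.2.1.1 (i, l).
have fstc (T1 T2 : topologicalType) (p : T1 * T2) : (fun q => q.1) @ p --> p.1 by exact:
  cvg_fst.
have sndc (T1 T2 : topologicalType) (p : T1 * T2) : (fun q => q.2) @ p --> p.2 by exact:
  cvg_snd.
have c111 : (fun p : Q => p.1.1.1) @ nbhs (p0 : Q) --> flat x.
  exact: (cvg_comp _ _ (cvg_comp _ _ (fstc _ _ _) (fstc _ _ _)) (fstc _ _ _)).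
have c211 : (fun p : Q => p.2.1.1) @ nbhs (p0 : Q) --> flat x.
  exact: (cvg_comp _ _ (cvg_comp _ _ (sndc _ _ _) (fstc _ _ _)) (fstc _ _ _)).
have c112 : (fun p : Q => p.1.1.2) @ nbhs (p0 : Q) --> flat t.
  exact: (cvg_comp _ _ (cvg_comp _ _ (fstc _ _ _) (fstc _ _ _)) (sndc _ _ _)).
have c12 : (fun p : Q => p.1.2) @ nbhs (p0 : Q) --> flat u.
  exact: (cvg_comp _ _ (fstc _ _ _) (sndc _ _ _)).
have ca1 : a1 @ nbhs (p0 : Q) --> val (x i).
  exact: (cvg_comp _ _ c111 (@reindex_continuous _ _ K (fun l : 'I_m => (i, l)) (flat x))).
have ca2 : a2 @ nbhs (p0 : Q) --> val (x i).
  exact: (cvg_comp _ _ c211 (@reindex_continuous _ _ K (fun l : 'I_m => (i, l)) (flat x))).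
(* [f] is continuous relative to [D] only, so the filter is restricted to pairs whose i-th
   coordinates lie in [D]; the pairs coming from tuples of the relic satisfy this. *)
pose FF := within [set p : Q | D (a1 p) /\ D (a2 p)] (nbhs (p0 : Q)).
have FFF : Filter FF by exact: within_filter.
have FFn : FF --> nbhs (p0 : Q) by exact: cvg_within.
have cf1 : (f \o a1) @ FF --> val y.
  move=> V /cf nV; have nV' : nbhs (p0 : Q) [set p | D (a1 p) -> V (f (a1 p))] := ca1 _ nV.
  change (nbhs (p0 : Q) [set p | D (a1 p) /\ D (a2 p) -> V (f (a1 p))]).
  have sub : [set p | D (a1 p) -> V (f (a1 p))] `<=`
    [set p | D (a1 p) /\ D (a2 p) -> V (f (a1 p))] by move=> p hp [D1 D2]; exact: hp.
  exact: (@filterS _ (nbhs (p0 : Q)) (nbhs_filter _) _ _ sub nV').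
have cf2 : (f \o a2) @ FF --> val y.
  move=> V /cf nV; have nV' : nbhs (p0 : Q) [set p | D (a2 p) -> V (f (a2 p))] := ca2 _ nV.
  change (nbhs (p0 : Q) [set p | D (a1 p) /\ D (a2 p) -> V (f (a2 p))]).
  have sub : [set p | D (a2 p) -> V (f (a2 p))] `<=`
    [set p | D (a1 p) /\ D (a2 p) -> V (f (a2 p))] by move=> p hp [D1 D2]; exact: hp.
  exact: (@filterS _ (nbhs (p0 : Q)) (nbhs_filter _) _ _ sub nV').
have coord (N : eqType) (h : Q -> N -> K) (l : N -> K) (n : N) : h @ FF --> l ->
  (fun p => h p n) @ FF --> l n.
  move=> hl; exact: (cvg_comp _ _ hl (@coordinate_continuous _ K n l)).
have toFF (T1 : topologicalType) (h : Q -> T1) (l : T1) : h @ nbhs (p0 : Q) --> l ->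
  h @ FF --> l.
  by move=> hl; apply: cvg_trans hl; exact: cvg_app.
pose Psi (p : Q) (kl : ((('I_r + 'I_s) + 'I_2) + 'I_2) * 'I_m) : K := match kl.1 with
  | inl (inl (inl j)) => p.1.1.2 (j, kl.2)
  | inl (inl (inr j)) => p.1.2 (j, kl.2)
  | inl (inr j) => flat v (j, kl.2)
  | inr k => if k == ord0 then (f \o a1) p kl.2 else (f \o a2) p kl.2 end.
have cPsi : Psi @ FF --> flat (tcat (tcat (tcat t u) v) (pair_pt y y)).
  apply: cvg_coordinates => -[[[[j|j]|j]|k] l]; rewrite /Psi /flat /=.
  - exact: (coord _ _ _ (j, l) (@toFF _ _ _ c112)).
  - exact: (coord _ _ _ (j, l) (@toFF _ _ _ c12)).
  - exact: cvg_cst.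
  - by rewrite /pair_pt; case: (k == ord0);
    [exact: (coord _ _ _ l cf1)|exact: (coord _ _ _ l cf2)].
pose Tu (p : Q) (kl : ('I_r + 'I_s) * 'I_m) : K := match kl.1 with
  | inl j => p.1.1.2 (j, kl.2) | inr j => p.1.2 (j, kl.2) end.
have cTu : Tu @ FF --> flat (tcat t u).
  apply: cvg_coordinates => -[[j|j] l]; rewrite /Tu /flat /=.
  - exact: (coord _ _ _ (j, l) (@toFF _ _ _ c112)).
  - exact: (coord _ _ _ (j, l) (@toFF _ _ _ c12)).
pose Pp (p : Q) (kl : ('I_2 + 'I_2) * 'I_m) : K := match kl.1 with
  | inl k => if k == ord0 then a1 p kl.2 else (f \o a1) p kl.2
  | inr k => if k == ord0 then a2 p kl.2 else (f \o a2) p kl.2 end.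
have cPp : Pp @ FF --> flat (tcat (pair_pt (x i) y) (pair_pt (x i) y)).
  apply: cvg_coordinates => -[[k|k] l]; rewrite /Pp /flat /= /pair_pt; case: (k == ord0).
  - exact: (coord _ _ _ l (@toFF _ _ _ ca1)).
  - exact: (coord _ _ _ l cf1).
  - exact: (coord _ _ _ l (@toFF _ _ _ ca2)).
  - exact: (coord _ _ _ l cf2).
have away (N : Type) (X : set (N -> K)) (l : N -> K) (h : Q -> N -> K) :
    ~ closure X l -> h @ FF --> l -> FF [set p | ~ X (h p)].
  move=> nX hl; have /existsNP[V /not_implyP[nV XV]] := nX.
  have sub : [set p | V (h p)] `<=` [set p | ~ X (h p)].
    by move=> p Vp Xp; apply: XV; exists (h p).
  exact: (@filterS _ FF FFF _ _ sub (hl V nV)).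
have nPsi : FF [set p | W (Psi p)] := cPsi _ nW'.
have nTu := away _ _ _ _ nW cTu.
have nPp := away _ _ _ _ nB cPp.
have nU1 : FF [set p | U (a1 p)] := @toFF _ _ _ ca1 _ nU.
have nU2 : FF [set p | U (a2 p)] := @toFF _ _ _ ca2 _ nU.
have all := filterI (filterI nPsi nTu) (filterI nPp (filterI nU1 nU2)).
have [p [[x1 [x2 [t' [u' [nx m1 m2 pE]]]]] hp]] := clS _ (all FFF FFF FFF FFF).
have A1 : a1 p = val (x1 i) by rewrite pE; apply/funext.
have A2 : a2 p = val (x2 i) by rewrite pE; apply/funext.
have [|[WPsi TuP] [PpP [U1 U2]]] := hp.
  by split; rewrite ?A1 ?A2; exact: set_valP.
rewrite /= A1 in U1; rewrite /= A2 in U2.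
have [z1 z1E g1] := fG _ U1; have [z2 z2E g2] := fG _ U2.
have PsiE : Psi p = flat (tcat (tcat (tcat t' u') v) (pair_pt z1 z2)).
  apply/funext => -[[[[j|j]|j]|k] l]; rewrite /Psi /flat //=; [by rewrite pE|by rewrite pE|].
  by rewrite /pair_pt; case: (k == ord0); rewrite ?A1 ?A2 -?z1E -?z2E.
have TuE : Tu p = flat (tcat t' u').
  by apply/funext => -[[j|j] l]; rewrite /Tu /flat /= pE.
have PpE : Pp p = flat (tcat (pair_pt (x1 i) z1) (pair_pt (x2 i) z2)).
  by apply/funext => -[[k|k] l]; rewrite /Pp /flat /= /pair_pt; case: (k == ord0);
    rewrite ?A1 ?A2 -?z1E -?z2E.
exists (Psi p); split; last exact: WPsi.
rewrite PsiE; exists (tcat (tcat (tcat t' u') v) (pair_pt z1 z2)) => //.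
exists (tcat x1 x2) => /=; split; first by [].
split; first by [].
split.
  by move=> h; apply: TuP; rewrite TuE; exists (tcat t' u').
(* The excluded set asks for two distinct points; they are distinct because x1 and x2 differ at
   [i]. *)
move=> h; apply: PpP; rewrite PpE; exists (tcat (pair_pt (x1 i) z1) (pair_pt (x2 i) z2)) => //.
by split=> // e; apply: nx; have := congr1 (fun g => g ord0) e.
Qed.

Lemma large2_plane : large 2 [set: 'I_2 -> D].
Proof.
exists [:: ord0; ord_max] => //=.
apply: sub_infinite_set infD => a _ /=; apply: sub_infinite_set infD => b _ /=.
by exists (pair_pt a b).
Qed.

Lemma ord2P (i : 'I_2) : i = ord0 \/ i = ord_max.
Proof.
by case: i => -[|[|//]] lt; [left|right]; apply: val_inj.
Qed.

Lemma generic_dim_flat A n (I : finType) (X : set (I -> D)) (x : I -> D) : params SM A ->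
  dfn SM A X -> large n X -> generic SK (flat_params A) (flat_set X) (flat x) ->
  n * dim_relic SK D <= dim_flat A set0 x.
Proof. by move=> pA Xd RX [_]; rewrite dim_flatE => ->; exact: dim_set_rank. Qed.

Lemma generic_rank A n (I : finType) (x : I -> D) : params SM A -> 0 < n ->
  n * dim_relic SK D <= dim_flat A set0 x -> forall Z : set (I -> D), dfn SM A Z -> Z x ->
    large n Z.
Proof.
move=> pA n0 h Z Zd Zx; apply: contrapT => nR.
have : dim_flat A set0 x <= n.-1 * dim_relic SK D by apply: (rank_le0 _ pA Zd Zx);
  rewrite prednK.
by move=> /(leq_trans h); rewrite leq_pmul2r // leqNgt prednK // leqnn.
Qed.

(** As [X] omits the diagonal, (p, p) would lie in its frontier. The frontier axiom then asks for
    dimension below that of [X], which is at most 2 * [dim_relic], while p alone has at least this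
    dimension. *)
Lemma not_common_closure (G : set ('I_2 + 'I_2 -> D)) (p : 'I_2 -> D) : dfn SM set0 G ->
  (forall v, finite_set [set v' | large 1 [set p | G (tcat p v) /\ G (tcat p v')]]) ->
  2 * dim_relic SK D <= dim_flat set0 set0 p ->
  ~ closure (flat_set [set z : 'I_2 + 'I_2 -> D | z \o inl <> z \o inr /\
      large 1 (common G (z \o inl) (z \o inr))]) (flat (tcat p p)).
Proof.
move=> Gd Gf hp; set X := [set z | _] => clX.
have Xd : dfn SM set0 X.
  apply: dfn_and; last exact: (dfn_large1 (P :=
    fun z => common G (z \o inl) (z \o inr)) (dfn_common _ Gd)).
  have h : dfn SM set0 (fun z : 'I_2 + 'I_2 -> D => forall k, z (inl k) = z (inr k)).
    by apply: dfn_all_idx => k; exact: dfn_eq.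
  apply: dfn_ext (dfn_not h) => z; split=> k e; apply: k; last exact/funext.
  by move=> k; exact: (congr1 (fun g => g k) e).
have fr : closure (frontier (flat_set X)) (flat (tcat p p)).
  apply: subset_closure; split=> // -[z [ne _] /flat_inj ze]; apply: ne.
  by rewrite ze.
have dX : definable_over SK (reals set0) (flat_set X).
  have := dfn_flat H0 Xd; rewrite flat_params0 dfnE.
  exact: dfn_sub (@sub0set _ _).
have := hg_frontier HK (@countable0 _) dX fr.
have dimC (I : finType) (w : I -> D) : dim SK (reals set0) (flat w) = dim_flat set0 set0 w.
  by rewrite dim_realsE /dim_flat /acl_flat flat_params0.
rewrite dimC ltnNge => /negP; apply; apply: dim_set_le => _ [z [_ Rz] <-].
rewrite dimC; apply: leq_trans (dim_common_infinite Gd Gf Rz) _.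
apply: leq_trans hp _; apply: dim_flat_sub; first exact: params0.
by rewrite range_tcat; exact: subsetUl.
Qed.

End RelicRank.

(** * The contradiction for parameters independent in M *)

Theorem theorem4 (LK : language) (K : topologicalType) (SK : structure LK K)
  (LM : language) (m : nat) (D : set ('I_m -> K)) (SM : structure LM D)
  (HK : hausdorff_geometric SK)
  (Hrelic : definable_relic SK SM)
  (Hsm : strongly_minimal SM)
  (Hnlm : not_locally_modular SM)
  (H0def : preserves_0definable SK SM)
  (Hcountable : countable_language LM)
  (Hacl : infinite_set (acl SM set0))
  (Hexcellent : exists (P : set ('I_2 -> D)) (C : ('I_2 -> D) -> set ('I_2 -> D)),
     family_over SM set0 P C /\ excellent_family SM P C) :
  weakly_detects_closures SK SM -> detects_multiple_intersections SK SM.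
Proof.
move=> W A r s P C Q E x t u pA [r1 [[Pd Cd] _] pcC mP _] [s1 [[Qd Ed] _] _ mQ stE].
move=> [[gx gt gu _ _] [_ ram]] mi.
(* [strongly_minimal] as stated also allows finite structures. *)
have infD : infinite_set [set: D] by apply: sub_infinite_set Hacl.
have UM := relic_uniformly_minimal HK H0def Hsm infD; have gA := definable_classes_params pA.
have bd := bounded HK H0def Hsm infD.
have d0p := dim_relic_gt0 H0def (hg_saturated HK) infD.
have p0 := params0 SM; have g0 := definable_classes_params p0.
pose G1 := fam_graph P C; pose G2 := fam_graph Q E.
have RP : large r P by have [] := (morleyE UM _ (dfn_definable0 gA Pd)).1 mP.
have RQ : large s Q by have [] := (morleyE UM _ (dfn_definable0 gA Qd)).1 mQ.
have G1c t' : ~ large 2 [set p | G1 (tcat p t')].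
  move=> R; have [_ _ /large_along_nonempty[p [/pcC[dC mC] _]]] := R.
  by have [_] := (morleyE UM _ dC).1 mC; apply; apply: large_mono R => q [].
have G2c p : ~ large s [set u' | G2 (tcat p u')].
  move=> R; apply: (stE p); apply/(morley_geE UM) => //.
  exact: (dfn_definable p gA Ed).
have dt := generic_dim_flat HK H0def Hsm infD pA Pd RP gt.
have du := generic_dim_flat HK H0def Hsm infD pA Qd RQ gu.
have dx := generic_dim_flat HK H0def Hsm infD pA (dfnT SM A 'I_2) (large2_plane infD) gx.
have rkt := rk_ge UM bd gA (generic_rank HK H0def Hsm infD pA r1 dt).
have rku := rk_ge UM bd gA (generic_rank HK H0def Hsm infD pA s1 du).
(* The assumed independence [mi] enters here: t and u have ranks at least r and s, so (t, u) has
   rank at least r + s. *)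
have htu Z : dfn SM A Z -> Z (tcat t u) -> large (r + s) Z.
  by move=> Zd Zz; apply: (rk_large UM bd gA Zd Zz); rewrite mi; exact: leq_add.
have gent j : generic SK set0 D (val (t j)).
  by apply: (coordinate_generic HK H0def j pA); rewrite card_ord.
have genu j : generic SK set0 D (val (u j)).
  by apply: (coordinate_generic HK H0def j pA); rewrite card_ord.
have nW : ~ closure (flat_set [set tu : 'I_r + 'I_s ->
  D | large 1 (meets G1 G2 tu)]) (flat (tcat t u)).
  move=> clW; have Wd := dfn_large1 HK H0def Hsm infD (P :=
    fun tu => meets G1 G2 tu) (dfn_meets Cd Ed).
  (* First use of weak detection: the parameters with infinite intersection would form a set of rank
     at least r + s. *)
  have [|R _] := weak_closure HK H0def Hsm infD W pA Wd clW _ htu; first by case.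
  exact: (rank_infinite_intersections HK H0def Hsm infD pA Cd Ed s1 G1c G2c R).
have [PF [F [[PFd Gd] [[d [Fd Ffin]] mPF pcF dualF]]]] := Hexcellent.
pose G := fam_graph PF F.
have fG v k b : finite_set [set p | G (tcat p v) /\ p k = b].
  have [/pcF[_ /(_ k b)]|nP] := pselect (PF v).
    by apply: sub_finite_set => p [[_ Fp] pk].
  by apply: sub_finite_set (@finite_set0 _) => p [[]].
have RF v : PF v -> large 1 [set p | G (tcat p v)].
  move=> Pv; have [[dF mF] _] := pcF v Pv; have [R _] := (morleyE UM _ dF).1 mF.
  by apply: large_mono R => p Fp; split.
have Gc v : ~ large 2 [set p | G (tcat p v)].
  move=> R; have [_ _ /large_along_nonempty[p [/pcF[[dC mC] _] _]]] := R.
  by have [_] := (morleyE UM _ dC).1 mC; apply; apply: large_mono R => q [].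
have Gdual p : ~ large 2 [set v | G (tcat p v)].
  have [e|[[dC mC] _]] := dualF p.
    by move=> [_ _ /large_along_nonempty[v Gv]]; have : set0 v by rewrite -e.
  by have [_] := (morleyE UM _ dC).1 mC; apply.
have RPF : large 2 PF by have [] := (morleyE UM _ (dfn_definable0 g0 PFd)).1 mPF.
have Gf v : finite_set [set v' | large 1 [set p | G (tcat p v) /\ G (tcat p v')]].
  have [Pv|nP] := pselect (PF v); last first.
    by apply: sub_finite_set (@finite_set0 _) => v' /= [_ _ /large_along_nonempty[p [[]]]].
  have [[dF mF] _] := pcF v Pv; have [R1 nR2] := (morleyE UM _ dF).1 mF.
  have [Rd nRd] := (morleyE UM _ dF).1 (Fd v Pv).
  (* Almost faithfulness names some common rank [d]; as the members are plane curves it is 1. *)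
  have d1 : d = 1.
    apply/eqP; rewrite eqn_leq; apply/andP; split; rewrite leqNgt; apply/negP => lt.
      by apply: nR2; exact: large_le Rd.
    by apply: nRd; exact: large_le R1.
  apply: sub_finite_set (Ffin v Pv) => v' /= R.
  have [_ _ /large_along_nonempty[p [_ [Pv' _]]]] := R; split => //; rewrite d1.
  have FE : F v `&` F v' = [set p | G (tcat p v) /\ G (tcat p v')].
    by apply/seteqP; split=> q [h1 h2]; split; try (by split); [case: h1|case: h2].
  have dFF : definable SM (F v `&` F v').
    rewrite FE; exact: (dfn_definable (tcat v v') g0 (dfn_meets Gd Gd)).
  apply/(morleyE UM _ dFF); rewrite {1}FE; split => // R2; apply: nR2.
  by apply: large_mono R2 => q [].
pose S (i : 'I_2) :=
  [set p : (('I_2 * 'I_m -> K) * ('I_r * 'I_m -> K) * ('I_s * 'I_m -> K)) *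
           (('I_2 * 'I_m -> K) * ('I_r * 'I_m -> K) * ('I_s * 'I_m -> K)) |
    exists x1 x2 t' u', [/\ x1 i <> x2 i, meets G1 G2 (tcat t' u') x1,
      meets G1 G2 (tcat t' u') x2
      & p = ((flat x1, flat t', flat u'), (flat x2, flat t', flat u'))]].
(* Ramification only says that the two points differ. Closure commutes with finite unions, so for
   some [i] the pairs that differ at [i] accumulate. *)
have [i clS] : exists i, closure (S i) ((flat x, flat t, flat u), (flat x, flat t, flat u)).
  suff : closure (S ord0 `|` S ord_max) ((flat x, flat t, flat u), (flat x, flat t, flat u)).
    by rewrite closureU => -[h|h]; [exists ord0|exists ord_max].
  apply: closureS ram => -[[[xa ta] ua] [[xb tb] ub]] [] /=.
  move=> [[[t1 Pt1 et1] [t2 [x1 [et2 Cx1 ex1]]]] [[u1 Qu1 eu1] [u2 [x2 [eu2 Ex2 ex2]]]]].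
  move=> [[_ [t3 [x3 [et3 Cx3 ex3]]]] [_ [u3 [x4 [eu3 Ex4 ex4]]]]] ne [et eu].
  have {}et1 : flat t1 = ta := et1; have {}et2 : ta = flat t2 := et2.
  have {}eu1 : flat u1 = ua := eu1; have {}eu2 : ua = flat u2 := eu2.
  have {}ex1 : xa = flat x1 := ex1; have {}ex2 : xa = flat x2 := ex2.
  have {}ex3 : xb = flat x3 := ex3; have {}ex4 : xb = flat x4 := ex4.
  have {}et3 : tb = flat t3 := et3; have {}eu3 : ub = flat u3 := eu3.
  have e1 : t1 = t2 by apply: flat_inj; rewrite et1 et2.
  have e2 : u1 = u2 by apply: flat_inj; rewrite eu1 eu2.
  have e3 : x1 = x2 by apply: flat_inj; rewrite -ex1 -ex2.
  have e4 : x3 = x4 by apply: flat_inj; rewrite -ex3 -ex4.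
  have e5 : t3 = t2 by apply: flat_inj; rewrite -et3 -et2 -et.
  have e6 : u3 = u2 by apply: flat_inj; rewrite -eu3 -eu2 -eu.
  subst t1 u1 x2 x4 t3 u3.
  have m1 : meets G1 G2 (tcat t2 u2) x1 by split; split.
  have m3 : meets G1 G2 (tcat t2 u2) x3 by split; split.
  have [k ne'] : exists k, x1 k <> x3 k.
    apply/existsNP => h; apply: ne; rewrite ex1 ex3 et eu.
    by have -> : x1 = x3 by exact/funext.
  have pE : ((xa, ta, ua), (xb, tb, ub)) =
      ((flat x1, flat t2, flat u2), (flat x3, flat t2, flat u2)).
    by rewrite ex1 ex3 et3 eu3 et2 eu2.
  by rewrite pE; case: (ord2P k) => ke; subst k; [left|right]; exists x1, x3, t2, u2.
have [B [cB hB]] := base_exists H0def pA.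
(* Including x, t and u makes v and y generic over all data chosen so far. *)
pose B0 := B `|` (range (flat x) `|` range (flat (tcat t u))).
have cB0 : countable B0.
  by apply: countable_setU => //; apply: countable_setU; exact: countable_range.
have hB0 C' : acl_flat SK A C' `<=` acl_flat SK (@set0 (eqelt D)) (B0 `|` C').
  have sub : B `|` C' `<=` B0 `|` C' by apply: setSU; exact: subsetUl.
  by move=> k /hB hk; exact: (acl_over_mono sub hk).
pose a := x i.
have da : dim_relic SK D <= dim_flat SK set0 set0 (fun _ : unit => a).
  apply: leq_trans (dim_flat_base SK A set0 _);
    apply: (dim_flat_coordinate HK H0def (x := x) i pA).
  by rewrite card_ord.
have aB : range (flat (fun _ : unit => a)) `<=` B0.
  by move=> k /range_pt hk; right; left.
have [v [y [Pv Gay dv dy dav]]] := generic_curve_point HK H0def Hsm infD PFd Gd RPF RF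
  (fun v k b _ => fG v k b) Gdual cB0 aB da.
have dp : 2 * dim_relic SK D <= dim_flat SK set0 set0 (pair_pt a y).
  apply: (@leq_trans (dim_flat SK set0 set0 (tcat (fun _ : unit => a) (fun _ : unit => y)))).
    rewrite (dim_flatD HK H0def _ _ _ p0) mul2n -addnn leq_add //; apply: leq_trans dy _.
    by apply: (dim_flat_mono HK H0def _ p0); rewrite set0U.
  by apply: (dim_flat_sub HK H0def _ p0); rewrite range_tcat range_pair_pt.
have [U [f [nU fa cf fG']]] := local_branch HK H0def Hsm infD Gd fG (Gc v) Gay dav.
have nB := not_common_closure HK H0def Hsm infD Gd Gf dp.
have clz := witness_closure clS nW nB nU fa cf fG'.
have Zd := dfn_witness HK H0def Hsm infD i Cd Ed Gd.
have dy0 : dim_relic SK D <= dim_flat SK set0 set0 (fun _ : unit => y).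
  by apply: leq_trans dy _; exact: (dim_flat_mono HK H0def _ p0).
have gz (k : (('I_r + 'I_s) + 'I_2) + 'I_2) :
    generic SK set0 D (val (tcat (tcat (tcat t u) v) (pair_pt y y) k)).
  case: k => [[[j|j]|j]|j] /=; [exact: gent|exact: genu| |].
    apply: (coordinate_generic HK H0def j p0); rewrite card_ord; apply: leq_trans dv _.
    exact: (dim_flat_mono HK H0def _ p0).
  have -> : pair_pt y y j = y by rewrite /pair_pt; case: (j == ord0).
  by apply: (coordinate_generic HK H0def tt p0); rewrite card_unit mul1n.
have tuB : range (flat (tcat t u)) `<=` B0 by move=> k hk; right; right.
have hz := rank_adjoin_generic HK H0def Hsm infD pA (yy := pair_pt y y) cB0 hB0 tuB dv htu.
(* Second use of weak detection: (t, u, v, y, y) has rank at least r + s + 2, the maximum that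
   [witness_rank] allows for the witness set. *)
have [_ ind] := weak_closure HK H0def Hsm infD W pA Zd clz gz hz.
have e : morley_independent SM A (fun _ : unit => y) (fun _ : unit => y).
  apply: (ind (witness_rank HK H0def Hsm infD (i :=
    i) pA Cd Ed Gd fG) (inr ord0) (inr ord_max)) => //.
  by move=> z Wz le; have [_] := witness_dim HK H0def Hsm infD pA Cd Ed Gd fG Wz; apply.
have dyA : 1 * dim_relic SK D <= dim_flat SK A set0 (fun _ : unit => y).
  rewrite mul1n; apply: leq_trans dy _.
  rewrite -[B0]setU0; exact: dim_flat_over_base.
have h1 := rk_ge UM bd gA (generic_rank HK H0def Hsm infD pA (ltn0Sn 0) dyA).
(* Independence of y from itself would give (y, y) rank at least 2, against the bound 1 from the
   diagonal. *)
by have := rk_diagonal UM bd y gA; rewrite e => /(leq_trans (leq_add h1 h1)).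
Qed.
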